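(* Let $a,b\in\mathbb{C}$, $c,c'\in\mathbb{C}\setminus\mathbb{Z}_{\leqslant 0}$ and $\Re(c)>\Re(b)>0$. For any fixed $y\in\mathbb{C}\setminus\{0\}$, $$\Psi_1\left[a,b;c,c';x,\frac{y}{x}\right]\sim\frac{\Gamma(c')}{\Gamma(a)}\,{}_1F_1\left[\begin{matrix}b\\c\end{matrix};y\right]\left(\frac{y}{x}\right)^{a-c'}\mathrm{e}^{y/x}+\frac{\Gamma(c')}{\Gamma(c'-a)}\left(-\frac{y}{x}\right)^{-a}$$ as $x\to0$ such that $-\pi\leqslant\arg\left(-\frac{y}{x}\right)\leqslant\pi$.
   Context: The Humbert function $\Psi_1$ is defined for $a,b\in\mathbb{C}$, $c,c'\in\mathbb{C}\setminus\mathbb{Z}_{\leqslant 0}$, $|x|<1$, $y\in\mathbb{C}$ by $$\Psi_1[a,b;c,c';x,y]=\sum_{m,n=0}^{\infty}\frac{(a)_{m+n}(b)_m}{(c)_m(c')_n}\frac{x^m}{m!}\frac{y^n}{n!},$$ where $(a)_n=a(a+1)\cdots(a+n-1)$, $(a)_0=1$, and ${}_1F_1\left[\begin{matrix}b\\c\end{matrix};z\right]=\sum_{n\geqslant0}\frac{(b)_n}{(c)_n}\frac{z^n}{n!}$. $1/\Gamma$ denotes the entire reciprocal Gamma function (zero at nonpositive integers). Complex powers have their principal values. The symbol $\sim$ is leading-term asymptotics of both contributions: $f(x)\sim C_1\varphi_1(x)+C_2\varphi_2(x)$, with $C_1,C_2$ independent of $x$, means $f(x)=(C_1+o(1))\varphi_1(x)+(C_2+o(1))\varphi_2(x)$;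 here $\varphi_1(x)=(y/x)^{a-c'}\mathrm{e}^{y/x}$ and $\varphi_2(x)=(-y/x)^{-a}$. *)

(* Defs.v *)
From Stdlib Require Import Factorial Reals.
From Coquelicot Require Import Coquelicot.

Local Open Scope C_scope.

Definition Cexp (z : C) : C :=
  ((exp (Re z) * cos (Im z))%R, (exp (Re z) * sin (Im z))%R).

(** Principal argument, with values in (-PI, PI]; in particular it equals [PI]
    on the negative real axis.  Its value at 0 is irrelevant. *)
Definition Carg (z : C) : R :=
  if Rle_dec 0 (Im z) then acos (Re z / Cmod z) else (- acos (Re z / Cmod z))%R.

Definition Cln (z : C) : C := (ln (Cmod z), Carg z).

(** Principal value of [z ^ w], meaningful for [z <> 0]. *)
Definition Cpower (z w : C) : C := Cexp (w * Cln z).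

Definition CLim_seq (u : nat -> C) : C :=
  (real (Lim_seq (fun n => Re (u n))), real (Lim_seq (fun n => Im (u n)))).

Definition CSeries (u : nat -> C) : C :=
  (Series (fun n => Re (u n)), Series (fun n => Im (u n))).

(** Rising factorial [(a)_n = a (a + 1) ... (a + n - 1)]. *)
Fixpoint Cpoch (a : C) (n : nat) : C :=
  match n with
  | O => 1
  | S k => Cpoch a k * (a + INR k)
  end.

(** The entire function 1/Gamma, by Gauss's product formula
    [1 / Gamma z = lim z (z + 1) ... (z + n) / (n! n^z)]; the limit exists for
    every complex [z] and is 0 exactly at 0, -1, -2, ... *)
Definition rGamma (z : C) : C :=
  CLim_seq (fun n => Cpoch z (S n) / (INR (fact n) * Cpower (INR n) z)).

(** Meaningful when [z] is not a nonpositive integer. *)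
Definition Gamma (z : C) : C := / rGamma z.

Definition nonpos_int (z : C) : Prop := exists k : nat, z = - INR k.

Definition hyp1F1 (b c z : C) : C :=
  CSeries (fun n => Cpoch b n / Cpoch c n * (z ^ n / INR (fact n))).

(** The double series converges absolutely for [|x| < 1], [y] arbitrary and
    [c], [c'] not nonpositive integers, so it is summed as an iterated series. *)
Definition HumbertPsi1 (a b c c' x y : C) : C :=
  CSeries (fun m => CSeries (fun n =>
    Cpoch a (m + n) * Cpoch b m / (Cpoch c m * Cpoch c' n)
    * (x ^ m / INR (fact m)) * (y ^ n / INR (fact n)))).

(** [f ~ C1 phi1 + C2 phi2] along [F], in the sense
    [f = (C1 + o(1)) phi1 + (C2 + o(1)) phi2]: an error term for each of the
    two contributions, whichever of them is dominant. *)
Definition asymp2 (F : (C -> Prop) -> Prop) (f : C -> C)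
    (C1 : C) (phi1 : C -> C) (C2 : C) (phi2 : C -> C) : Prop :=
  exists e1 e2 : C -> C,
    filterlim e1 F (locally (RtoC 0)) /\
    filterlim e2 F (locally (RtoC 0)) /\
    F (fun x => f x = (C1 + e1 x) * phi1 x + (C2 + e2 x) * phi2 x).

(* Main.v *)
Require Import Defs.
From Stdlib Require Import Arith Factorial Reals Lra Lia.
From Coquelicot Require Import Coquelicot.

(** With [z = y / x], summing over [n] first turns the function into
    [sum_m (b)_m / (c)_m * y ^ m / m! * h_m(z)], where
    [h_m(z) = (a)_m * z ^ (- m) * 1F1(a + m; c'; z)] ([HumbertPsi1_rows]), and
    [z] tends to infinity. The exponential leading term of [h_m] is that of
    [1F1(a; c'; z)] for every [m], whereas its algebraic leading term is smaller by
    [z ^ (- 2 m)] ([psi_row_two_term]). Summation over [m] therefore multiplies the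
    exponential contribution by [1F1(b; c; y)] and leaves the algebraic one
    unchanged. The interchange of limit and sum ([tannery]) needs a bound of [h_m]
    uniform in [m]: the contiguous relation in the parameter [a] is a three-term
    recurrence for [h_m] whose solutions grow essentially
    like [D ^ m * m! / |z| ^ m] at most ([psi_row_bound]).

    There remains the two-term asymptotic formula for [F(z) = 1F1(a; c; z)], in all
    directions at once ([hyp1F1_asymptotics]).

    The quotient [u] of [F] by [exp z * z ^ (a - c)] solves
    [(E u')' = - lambda E u / z ^ 2] with [E = exp z * z ^ k], [k = 2 a - c]. Along
    the curves [z = om s + (2 - Re k) ln s], with [om] in the right half-plane, the
    modulus of [E] grows at least like [s ^ 2]; this yields [u = O(1)] and
    [u' = O(1 / z)], and [u + u'] then has a derivative of order [1 / z ^ 2]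
    ([log_path_bound]). Hence [u] has the same limit in every direction of a region
    [Re z >= p ln |z|], [p > 2 - Re k] ([exponential_asymptotics]). On the positive
    axis the limit is found from the power series: its coefficients behave like
    [Gamma c / Gamma a * n ^ (a - c)] by Gauss's product for [1 / Gamma], and the
    weights [x ^ n / n!] concentrate near [n = x] ([hyp1F1_positive_axis]).

    Kummer's transformation [F(a; c; z) = exp z * F(c - a; c; - z)] gives the
    algebraic term in the opposite region. Both thresholds for [p] depend on [k],
    which increases by 2 when [a] increases by 1. So in a given strip
    [|Re z| <= L ln |z|] about the imaginary axis, where the two contributions
    compete, the exponential formula holds for [a + n] and the algebraic one for
    [a - n], when [n] is large. Elimination in the contiguous relation between
    these two ends recovers both terms at [a] ([two_term_strip]): this boundary value
    problem is well conditioned, while following the recurrence in either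
    direction would lose the smaller contribution. *)

Local Open Scope C_scope.

(** * Complex exponential, argument and powers *)

Tactic Notation "bound" constr(H) := eapply Rle_trans; [apply H|].

(** Sign goals on products, quotients, powers and exponentials. *)
Ltac pos := solve [repeat first
  [ lra | assumption | apply exp_pos | apply Cmod_ge_0 | apply pos_INR | apply Rabs_pos | apply pow2_ge_0
  | apply INR_fact_lt_0 | apply Rmult_lt_0_compat | apply Rinv_0_lt_compat | apply Rdiv_lt_0_compat
  | apply pow_lt | apply Rmult_le_pos | apply pow_le
  | left; apply exp_pos | left; apply Rinv_0_lt_compat | left; apply Rdiv_lt_0_compat ]].

Lemma Cmod_sq (z : C) : (Cmod z ^ 2 = Re z ^ 2 + Im z ^ 2)%R.
Proof. apply Cmod2_alt. Qed.

Lemma im_le_Cmod (z : C) : (Rabs (Im z) <= Cmod z).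
Proof. eapply Rle_trans; [apply Rmax_r|apply Rmax_Cmod]. Qed.

Lemma Cmod_le_re_im (z : C) : (Cmod z <= Rabs (Re z) + Rabs (Im z))%R.
Proof.
  pose proof (Cmod_sq z) as H.
  pose proof (Rabs_pos (Re z)) as P1. pose proof (Rabs_pos (Im z)) as P2.
  pose proof (pow2_abs (Re z)) as H1. pose proof (pow2_abs (Im z)) as H2.
  apply Rsqr_incr_0_var; [unfold Rsqr; nra|lra].
Qed.

Lemma Cmod_triangle_minus (x y : C) : (Cmod x - Cmod y <= Cmod (x + y))%R.
Proof.
  pose proof (Cmod_triangle (x + y) (- y)) as H. rewrite Cmod_opp in H.
  replace (x + y + - y) with x in H by ring. lra.
Qed.

Lemma Cmod_INR (n : nat) : Cmod (INR n) = INR n.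
Proof. rewrite Cmod_R. apply Rabs_pos_eq, pos_INR. Qed.

Lemma Cmult_eq_0 (x y : C) : x * y = 0 -> x = 0 \/ y = 0.
Proof.
  intro H. apply (f_equal Cmod) in H. rewrite Cmod_mult, Cmod_0 in H.
  apply Rmult_integral in H. destruct H; [left|right]; now apply Cmod_eq_0.
Qed.

Lemma RtoC_neq_0 (r : R) : r <> 0%R -> RtoC r <> 0.
Proof. intros H E. apply H. now apply RtoC_inj. Qed.

Lemma Cexp_plus (z w : C) : Cexp (z + w) = Cexp z * Cexp w.
Proof.
  unfold Cexp, Cmult, Cplus, Re, Im; simpl.
  rewrite exp_plus, cos_plus, sin_plus. f_equal; ring.
Qed.

Lemma Cexp_0 : Cexp 0 = 1.
Proof.
  unfold Cexp, Re, Im; simpl. rewrite exp_0, cos_0, sin_0.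
  unfold RtoC; f_equal; ring.
Qed.

Lemma Cmod_Cexp (z : C) : Cmod (Cexp z) = exp (Re z).
Proof.
  unfold Cmod, Cexp; simpl.
  replace (_ + _)%R with (exp (Re z) * exp (Re z))%R.
  - apply sqrt_square. pos.
  - pose proof (sin2_cos2 (Im z)) as H. unfold Rsqr in H.
    replace (exp (Re z) * exp (Re z))%R
      with (exp (Re z) * exp (Re z) * (sin (Im z) * sin (Im z) + cos (Im z) * cos (Im z)))%R
      by (rewrite H; ring). ring.
Qed.

Lemma Cexp_neq_0 (z : C) : Cexp z <> 0.
Proof. apply Cmod_gt_0. rewrite Cmod_Cexp. apply exp_pos. Qed.

Lemma Cexp_opp_l (z : C) : Cexp (- z) * Cexp z = 1.
Proof. rewrite <- Cexp_plus, <- Cexp_0. f_equal; ring. Qed.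

Lemma Cexp_opp (z : C) : Cexp (- z) = / Cexp z.
Proof.
  pose proof (Cexp_opp_l z) as H. pose proof (Cexp_neq_0 z) as H0.
  rewrite <- (Cmult_1_l (/ Cexp z)), <- H. now field.
Qed.

Lemma Carg_bound (z : C) : (- PI <= Carg z <= PI)%R.
Proof.
  unfold Carg. pose proof (acos_bound (Re z / Cmod z)) as H.
  destruct (Rle_dec 0 (Im z)); lra.
Qed.

Lemma Re_div_Cmod_bound (z : C) : z <> 0 -> (-1 <= Re z / Cmod z <= 1)%R.
Proof.
  intro Hz. apply Cmod_gt_0 in Hz. pose proof (re_le_Cmod z) as H.
  apply Rabs_le_between in H.
  split; [apply Rle_div_r|apply Rle_div_l]; lra.
Qed.

Lemma sin_acos_Re (z : C) : z <> 0 -> sin (acos (Re z / Cmod z)) = (Rabs (Im z) / Cmod z)%R.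
Proof.
  intro Hz. rewrite sin_acos by now apply Re_div_Cmod_bound.
  apply Cmod_gt_0 in Hz. pose proof (Cmod_sq z) as H.
  replace (1 - (Re z / Cmod z)²)%R with ((Rabs (Im z) / Cmod z) ^ 2)%R.
  - apply sqrt_pow2. apply Rle_div_r; auto. rewrite Rmult_0_l. apply Rabs_pos.
  - unfold Rsqr. pose proof (pow2_abs (Im z)) as H2.
    replace ((Rabs (Im z) / Cmod z) ^ 2)%R with (Rabs (Im z) ^ 2 / Cmod z ^ 2)%R by (field; lra).
    rewrite H2. replace (Im z ^ 2)%R with (Cmod z ^ 2 - Re z ^ 2)%R by lra. field. lra.
Qed.

Lemma Cexp_Cln (z : C) : z <> 0 -> Cexp (Cln z) = z.
Proof.
  intro Hz. pose proof (proj1 (Cmod_gt_0 z) Hz) as Hm.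
  pose proof (cos_acos _ (Re_div_Cmod_bound z Hz)) as Hc.
  pose proof (sin_acos_Re z Hz) as Hs.
  unfold Cexp, Cln; simpl Re; simpl Im. rewrite exp_ln by auto.
  transitivity (Re z, Im z); [|now destruct z].
  unfold Carg. destruct (Rle_dec 0 (Im z)) as [Hi|Hi].
  - rewrite Hc, Hs, Rabs_pos_eq by auto. f_equal; field; lra.
  - rewrite cos_neg, sin_neg, Hc, Hs, Rabs_left by lra. f_equal; field; lra.
Qed.

Lemma Cpower_neq_0 (z w : C) : Cpower z w <> 0.
Proof. apply Cexp_neq_0. Qed.

Lemma Cpower_plus (z w w' : C) : Cpower z (w + w') = Cpower z w * Cpower z w'.
Proof. unfold Cpower. rewrite <- Cexp_plus. f_equal; ring. Qed.

Lemma Cpower_1_r (z : C) : z <> 0 -> Cpower z 1 = z.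
Proof. intro Hz. unfold Cpower. rewrite Cmult_1_l. now apply Cexp_Cln. Qed.

Lemma Cpower_opp (z w : C) : Cpower z (- w) = / Cpower z w.
Proof. unfold Cpower. rewrite <- Cexp_opp. f_equal; ring. Qed.

Lemma Cpower_succ (z w : C) : z <> 0 -> Cpower z (w + 1) = z * Cpower z w.
Proof. intro Hz. rewrite Cpower_plus, Cpower_1_r by auto. ring. Qed.

Lemma Cmod_Cpower (z w : C) :
  Cmod (Cpower z w) = (Rpower (Cmod z) (Re w) * exp (- (Im w * Carg z)))%R.
Proof.
  unfold Cpower. rewrite Cmod_Cexp. unfold Rpower. rewrite <- exp_plus.
  apply f_equal. destruct w as [u v]. unfold Cln. simpl. ring.
Qed.

Lemma Im_mul_Carg_bound (z w : C) : (- (Rabs (Im w) * PI) <= Im w * Carg z <= Rabs (Im w) * PI)%R.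
Proof.
  apply Rabs_le_between. rewrite Rabs_mult. apply Rmult_le_compat_l; [apply Rabs_pos|].
  apply Rabs_le. apply Carg_bound.
Qed.

Lemma exp_le (x y : R) : (x <= y) -> (exp x <= exp y).
Proof. intros [H| ->]; [left; now apply exp_increasing|right; auto]. Qed.

Lemma Cmod_Cpower_le (z w : C) :
  (Cmod (Cpower z w) <= Rpower (Cmod z) (Re w) * exp (Rabs (Im w) * PI))%R.
Proof.
  rewrite Cmod_Cpower. apply Rmult_le_compat_l; [pos|].
  apply exp_le. pose proof (Im_mul_Carg_bound z w). lra.
Qed.

Lemma Cmod_Cpower_ge (z w : C) :
  (Rpower (Cmod z) (Re w) * exp (- (Rabs (Im w) * PI)) <= Cmod (Cpower z w))%R.
Proof.
  rewrite Cmod_Cpower. apply Rmult_le_compat_l; [pos|].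
  apply exp_le. pose proof (Im_mul_Carg_bound z w). lra.
Qed.

Lemma ln_ge_0 (x : R) : (1 <= x) -> (0 <= ln x).
Proof. intro H. rewrite <- ln_1. apply ln_le; lra. Qed.

Lemma Rinv_pos_le_1 (x : R) : (1 <= x) -> (0 < / x <= 1)%R.
Proof.
  intro H. split; [apply Rinv_0_lt_compat; lra|].
  rewrite <- Rinv_1. apply Rinv_le_contravar; lra.
Qed.

Lemma Rmult_Rabs_bounds (p x : R) : (0 <= x) -> (- (Rabs p * x) <= p * x <= Rabs p * x)%R.
Proof.
  intro Hx. pose proof (proj1 (Rabs_le_between p (Rabs p)) (Rle_refl _)). nra.
Qed.

(** * Absolutely convergent complex series *)

Definition Csummable (u : nat -> C) : Prop := ex_series (fun n => Cmod (u n)).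

Lemma Csummable_le (u : nat -> C) (v : nat -> R) :
  (forall n, (Cmod (u n) <= v n)) -> ex_series v -> Csummable u.
Proof.
  intros H Hv. apply (ex_series_le (V := R_CompleteNormedModule) _ v); auto.
  intro n. unfold norm; simpl; unfold abs; simpl.
  rewrite Rabs_pos_eq; auto. apply Cmod_ge_0.
Qed.

Lemma Csummable_re (u : nat -> C) : Csummable u -> ex_series (fun n => Rabs (Re (u n))).
Proof.
  intro H. apply (ex_series_le (V := R_CompleteNormedModule) _ (fun n => Cmod (u n))); auto.
  intro n. unfold norm; simpl; unfold abs; simpl. rewrite Rabs_Rabsolu. apply re_le_Cmod.
Qed.

Lemma Csummable_im (u : nat -> C) : Csummable u -> ex_series (fun n => Rabs (Im (u n))).
Proof.
  intro H. apply (ex_series_le (V := R_CompleteNormedModule) _ (fun n => Cmod (u n))); auto.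
  intro n. unfold norm; simpl; unfold abs; simpl. rewrite Rabs_Rabsolu. apply im_le_Cmod.
Qed.

Lemma Csummable_re' (u : nat -> C) : Csummable u -> ex_series (fun n => Re (u n)).
Proof. intro H. now apply ex_series_Rabs, Csummable_re. Qed.

Lemma Csummable_im' (u : nat -> C) : Csummable u -> ex_series (fun n => Im (u n)).
Proof. intro H. now apply ex_series_Rabs, Csummable_im. Qed.

Lemma CSeries_ext (u v : nat -> C) : (forall n, u n = v n) -> CSeries u = CSeries v.
Proof.
  intro H. unfold CSeries. f_equal; apply Series_ext; intro n; now rewrite H.
Qed.

Lemma Csummable_ext (u v : nat -> C) : (forall n, u n = v n) -> Csummable u -> Csummable v.
Proof. intros H. apply ex_series_ext. intro n. now rewrite H. Qed.

Lemma Csummable_plus (u v : nat -> C) :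
  Csummable u -> Csummable v -> Csummable (fun n => u n + v n).
Proof.
  intros Hu Hv. apply (Csummable_le _ (fun n => Cmod (u n) + Cmod (v n))%R).
  - intro n. apply Cmod_triangle.
  - exact (ex_series_plus _ _ Hu Hv).
Qed.

Lemma Csummable_scal (k : C) (u : nat -> C) : Csummable u -> Csummable (fun n => k * u n).
Proof.
  intros Hu. apply (Csummable_le _ (fun n => Cmod k * Cmod (u n))%R).
  - intro n. rewrite Cmod_mult. lra.
  - exact (ex_series_scal (Cmod k) _ Hu).
Qed.

Lemma CSeries_plus (u v : nat -> C) : Csummable u -> Csummable v ->
  CSeries (fun n => u n + v n) = CSeries u + CSeries v.
Proof.
  intros Hu Hv. unfold CSeries, Cplus; simpl. f_equal.
  - apply Series_plus; now apply Csummable_re'.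
  - apply Series_plus; now apply Csummable_im'.
Qed.

Lemma CSeries_scal (k : C) (u : nat -> C) : Csummable u ->
  CSeries (fun n => k * u n) = k * CSeries u.
Proof.
  intros Hu. pose proof (Csummable_re' u Hu) as Hr. pose proof (Csummable_im' u Hu) as Hi.
  destruct k as [p q]. unfold CSeries, Cmult; simpl. f_equal.
  - rewrite <- !Series_scal_l, <- Series_minus; [reflexivity| |].
    + exact (ex_series_scal p _ Hr).
    + exact (ex_series_scal q _ Hi).
  - rewrite <- !Series_scal_l, <- Series_plus; [reflexivity| |].
    + exact (ex_series_scal p _ Hi).
    + exact (ex_series_scal q _ Hr).
Qed.

Lemma CSeries_0 (u : nat -> C) : (forall n, u n = 0) -> CSeries u = 0.
Proof.
  intro H. unfold CSeries.
  rewrite (Series_ext _ (fun n => 0 * 0)%R), (Series_ext (fun n => Im (u n)) (fun n => 0 * 0)%R).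
  - rewrite !Series_scal_l. unfold RtoC. f_equal; ring.
  - intro n. rewrite H. simpl. ring.
  - intro n. rewrite H. simpl. ring.
Qed.

Lemma CSeries_incr_1 (u : nat -> C) : Csummable u ->
  CSeries u = u O + CSeries (fun n => u (S n)).
Proof.
  intros Hu. unfold CSeries, Cplus; simpl. f_equal.
  - apply Series_incr_1. now apply Csummable_re'.
  - apply Series_incr_1. now apply Csummable_im'.
Qed.

Lemma Csummable_incr_1 (u : nat -> C) : Csummable u <-> Csummable (fun n => u (S n)).
Proof. apply ex_series_incr_1. Qed.

(** Multiplication by the conjugate of the sum turns the bound into one between
    real series. *)
Lemma Cmod_CSeries_le (u : nat -> C) : Csummable u ->
  (Cmod (CSeries u) <= Series (fun n => Cmod (u n))).
Proof.
  intros Hu. set (w := CSeries u).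
  assert (H : (Cmod w ^ 2 <= Cmod w * Series (fun n => Cmod (u n)))%R).
  { rewrite <- Series_scal_l.
    assert (E : (Cmod w ^ 2 = Re (Cconj w * w))%R).
    { rewrite Cmod_sq. destruct w; simpl; ring. }
    rewrite E. unfold w at 2. rewrite <- CSeries_scal by auto.
    unfold CSeries. simpl Re.
    apply Rle_trans with (Rabs (Series (fun n => Re (Cconj w * u n)))).
    { apply Rle_abs. }
    eapply Rle_trans; [apply Series_Rabs|].
    - apply Csummable_re, Csummable_scal; auto.
    - apply Series_le.
      + intro n. split; [apply Rabs_pos|].
        eapply Rle_trans; [apply re_le_Cmod|]. rewrite Cmod_mult, Cmod_conj. lra.
      + exact (ex_series_scal (Cmod w) _ Hu). }
  pose proof (Cmod_ge_0 w) as Hw.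
  destruct (Req_dec (Cmod w) 0) as [E|E].
  - rewrite E. replace 0%R with (Series (fun _ => 0 * 0)%R) by (rewrite Series_scal_l; ring).
    apply Series_le; auto. intro n. split; [lra|]. rewrite Rmult_0_l. apply Cmod_ge_0.
  - nra.
Qed.

(** * Differentiation along a path *)

Definition Cder (f : R -> C) (t : R) (l : C) : Prop :=
  is_derive (fun s => Re (f s)) t (Re l) /\ is_derive (fun s => Im (f s)) t (Im l).

Lemma is_derive_Rmult (f g : R -> R) (t df dg : R) :
  is_derive f t df -> is_derive g t dg ->
  is_derive (fun s => f s * g s)%R t (df * g t + f t * dg)%R.
Proof.
  intros Hf Hg. apply (is_derive_mult f g t df dg Hf Hg). exact Rmult_comm.
Qed.

Lemma is_derive_Rcomp (f g : R -> R) (t df dg : R) :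
  is_derive f (g t) df -> is_derive g t dg ->
  is_derive (fun s => f (g s)) t (df * dg)%R.
Proof.
  intros Hf Hg. rewrite Rmult_comm. apply (is_derive_comp f g t df dg Hf Hg).
Qed.

Lemma is_derive_eq (f : R -> R) (t l l' : R) : is_derive f t l -> l = l' -> is_derive f t l'.
Proof. now intros H <-. Qed.

Lemma Cder_eq (f : R -> C) (t : R) (l l' : C) : Cder f t l -> l = l' -> Cder f t l'.
Proof. now intros H <-. Qed.

Lemma Cder_ext_loc (f g : R -> C) (t : R) (l : C) :
  locally t (fun s => f s = g s) -> Cder f t l -> Cder g t l.
Proof.
  intros H [H1 H2]. split.
  - apply (is_derive_ext_loc (fun s => Re (f s))); auto.
    refine (filter_imp _ _ _ H). now intros s ->.
  - apply (is_derive_ext_loc (fun s => Im (f s))); auto.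
    refine (filter_imp _ _ _ H). now intros s ->.
Qed.

Lemma Cder_ext (f g : R -> C) (t : R) (l : C) :
  (forall s, f s = g s) -> Cder f t l -> Cder g t l.
Proof. intros H. apply Cder_ext_loc. now apply filter_forall. Qed.

Lemma is_derive_Rconst (k t : R) : is_derive (fun _ : R => k) t 0%R.
Proof. apply (is_derive_const (V := R_NormedModule)). Qed.

Lemma is_derive_Rid (t : R) : is_derive (fun s : R => s) t 1%R.
Proof. apply (is_derive_id (K := R_AbsRing)). Qed.

Lemma Cder_const (k : C) (t : R) : Cder (fun _ => k) t 0.
Proof. split; apply is_derive_Rconst. Qed.

Lemma Cder_real (f : R -> R) (t df : R) : is_derive f t df -> Cder (fun s => RtoC (f s)) t df.
Proof. intro H. split; simpl; [exact H|apply is_derive_Rconst]. Qed.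

Lemma Cder_plus (f g : R -> C) (t : R) (df dg : C) :
  Cder f t df -> Cder g t dg -> Cder (fun s => f s + g s) t (df + dg).
Proof.
  intros [H1 H2] [H3 H4]. split; simpl.
  - exact (is_derive_plus _ _ _ _ _ H1 H3).
  - exact (is_derive_plus _ _ _ _ _ H2 H4).
Qed.

Lemma Cder_mult (f g : R -> C) (t : R) (df dg : C) :
  Cder f t df -> Cder g t dg -> Cder (fun s => f s * g s) t (df * g t + f t * dg).
Proof.
  intros [H1 H2] [H3 H4]. split; simpl.
  - eapply is_derive_eq.
    + exact (is_derive_minus _ _ _ _ _ (is_derive_Rmult _ _ _ _ _ H1 H3) (is_derive_Rmult _ _ _ _ _ H2 H4)).
    + unfold minus, plus, opp, Re, Im; simpl. ring.
  - eapply is_derive_eq.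
    + exact (is_derive_plus _ _ _ _ _ (is_derive_Rmult _ _ _ _ _ H1 H4) (is_derive_Rmult _ _ _ _ _ H2 H3)).
    + unfold plus, Re, Im; simpl. ring.
Qed.

Lemma Cder_scal (k : C) (f : R -> C) (t : R) (df : C) :
  Cder f t df -> Cder (fun s => k * f s) t (k * df).
Proof.
  intro H. eapply Cder_eq; [exact (Cder_mult _ _ _ _ _ (Cder_const k t) H)|cbv beta; ring].
Qed.

Lemma Cder_opp (f : R -> C) (t : R) (df : C) :
  Cder f t df -> Cder (fun s => - f s) t (- df).
Proof.
  intros [H1 H2]. split; simpl.
  - exact (is_derive_opp _ _ _ H1).
  - exact (is_derive_opp _ _ _ H2).
Qed.

Lemma Cder_minus (f g : R -> C) (t : R) (df dg : C) :
  Cder f t df -> Cder g t dg -> Cder (fun s => f s - g s) t (df - dg).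
Proof. intros H1 H2. exact (Cder_plus _ _ _ _ _ H1 (Cder_opp _ _ _ H2)). Qed.

Lemma Cder_Cexp (f : R -> C) (t : R) (df : C) :
  Cder f t df -> Cder (fun s => Cexp (f s)) t (df * Cexp (f t)).
Proof.
  intros [H1 H2].
  pose proof (is_derive_Rcomp exp _ _ _ _ (is_derive_exp _) H1) as He.
  pose proof (is_derive_Rcomp cos _ _ _ _ (is_derive_cos _) H2) as Hc.
  pose proof (is_derive_Rcomp sin _ _ _ _ (is_derive_sin _) H2) as Hs.
  split; simpl.
  - eapply is_derive_eq; [exact (is_derive_Rmult _ _ _ _ _ He Hc)|]. unfold Re, Im; simpl. ring.
  - eapply is_derive_eq; [exact (is_derive_Rmult _ _ _ _ _ He Hs)|]. unfold Re, Im; simpl. ring.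
Qed.

(** The plane cut along the closed negative half-line, where the principal
    logarithm is holomorphic. *)
Definition slit (z : C) : Prop := (0 < Re z) \/ Im z <> 0%R.

Lemma slit_neq_0 (z : C) : slit z -> z <> 0.
Proof. intros [H|H] ->; simpl in H; lra. Qed.

Lemma slit_pos (z : C) : slit z -> (0 < Cmod z + Re z)%R.
Proof.
  intro H. pose proof (proj1 (Cmod_gt_0 z) (slit_neq_0 z H)) as Hm.
  pose proof (Cmod_sq z) as E. destruct H as [H|H]; [lra|].
  assert (0 < Im z ^ 2)%R by (apply pow2_gt_0; auto). nra.
Qed.

(** A single formula, differentiable on the whole slit plane: the quotients of
    the two coordinates would require three charts. *)
Lemma Carg_half_angle (z : C) : slit z -> Carg z = (2 * atan (Im z / (Cmod z + Re z)))%R.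
Proof.
  intro Hs. pose proof (slit_pos z Hs) as Hp. pose proof (Cmod_sq z) as E.
  pose proof (proj1 (Cmod_gt_0 z) (slit_neq_0 z Hs)) as Hm. unfold Carg.
  set (r := Cmod z) in *. set (x := Re z) in *. set (y := Im z) in *.
  assert (Q : forall w, (0 <= w) -> (w ^ 2 = y ^ 2)%R -> acos (x / r) = (2 * atan (w / (r + x)))%R).
  { intros w Hw Ew. set (t := (w / (r + x))%R).
    assert (Ht : (0 <= t)) by (apply Rle_div_r; lra).
    assert (Et : (1 + t² = 2 * r / (r + x))%R).
    { unfold t, Rsqr. apply (Rmult_eq_reg_r ((r + x) * (r + x))); [|nra]. field_simplify; nra. }
    rewrite <- (acos_cos (2 * atan t)).
    - f_equal. rewrite cos_2a_cos, cos_atan.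
      replace (2 * (1 / sqrt (1 + t²)) * (1 / sqrt (1 + t²)))%R with (2 / (sqrt (1 + t²) * sqrt (1 + t²)))%R.
      + rewrite sqrt_sqrt, Et by (pose proof (Rle_0_sqr t); lra). field. split; lra.
      + field. apply Rgt_not_eq, sqrt_lt_R0. pose proof (Rle_0_sqr t). lra.
    - pose proof (atan_bound t). split; [|lra].
      assert (atan 0 <= atan t); [|rewrite atan_0 in *; lra].
      destruct Ht as [Ht|<-]; [left; now apply atan_increasing|lra]. }
  destruct (Rle_dec 0 y) as [Hy|Hy]; [now apply Q|].
  rewrite (Q (- y)%R) by (lra || ring).
  replace (- y / (r + x))%R with (- (y / (r + x)))%R by (field; lra). rewrite atan_opp. ring.
Qed.

Lemma continuous_pos_loc (f : R -> R) (t l : R) : is_derive f t l -> (0 < f t) ->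
  locally t (fun s => (0 < f s)).
Proof.
  intros H Hp. assert (Hc : continuous f t) by (apply (ex_derive_continuous (V := R_NormedModule)); now exists l).
  apply Hc. apply (open_gt 0 (f t) Hp).
Qed.

Lemma Cder_Cln (z : R -> C) (t : R) (z' : C) :
  Cder z t z' -> slit (z t) -> Cder (fun s => Cln (z s)) t (z' / z t).
Proof.
  intros [H1 H2] Hs. pose proof (slit_pos _ Hs) as Hp.
  pose proof (proj1 (Cmod_gt_0 _) (slit_neq_0 _ Hs)) as Hm.
  pose proof (Cmod_sq (z t)) as E. set (r := Cmod (z t)) in *.
  assert (Dr : is_derive (fun s => Cmod (z s)) t ((Re (z t) * Re z' + Im (z t) * Im z') / r)%R).
  { apply (is_derive_ext (fun s => sqrt (Re (z s) * Re (z s) + Im (z s) * Im (z s)))).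
    { intro s. unfold Cmod. f_equal. simpl. unfold Re, Im. ring. }
    assert (Er : sqrt (Re (z t) * Re (z t) + Im (z t) * Im (z t)) = r).
    { rewrite <- (sqrt_pow2 r) by lra. f_equal. lra. }
    eapply is_derive_eq.
    - apply is_derive_sqrt; [|nra].
      exact (is_derive_plus _ _ _ _ _ (is_derive_Rmult _ _ _ _ _ H1 H1) (is_derive_Rmult _ _ _ _ _ H2 H2)).
    - unfold plus; simpl. rewrite Er. field. lra. }
  assert (En : (fst (z t) * (fst (z t) * 1) + snd (z t) * (snd (z t) * 1) = r * r)%R)
    by (unfold Re, Im in E; lra).
  split.
  - simpl Re. eapply is_derive_eq; [exact (is_derive_Rcomp ln (fun s => Cmod (z s)) _ _ _ (is_derive_ln _ Hm) Dr)|].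
    fold r. unfold Cdiv, Cinv. simpl. rewrite En. unfold Re, Im. field. lra.
  - simpl Im. pose proof (is_derive_plus _ _ _ _ _ Dr H1) as Dp.
    apply (is_derive_ext_loc (fun s => 2 * atan (Im (z s) / (Cmod (z s) + Re (z s))))%R).
    { assert (Hl : locally t (fun s => (0 < plus (Cmod (z s)) (Re (z s))))).
      { eapply continuous_pos_loc; [exact Dp|exact Hp]. }
      refine (filter_imp _ _ _ Hl). intros s Hq. unfold plus in Hq; simpl in Hq.
      rewrite Carg_half_angle; auto. destruct (Req_dec (Im (z s)) 0) as [Ei|Ei]; [left|right; auto].
      pose proof (Cmod_le_re_im (z s)) as B. rewrite Ei, Rabs_R0 in B.
      unfold Rabs in B. destruct (Rcase_abs (Re (z s))); lra. }
    eapply is_derive_eq.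
    + apply is_derive_scal. eapply is_derive_Rcomp; [apply is_derive_atan|].
      apply (is_derive_div _ _ _ _ _ H2 Dp). unfold plus; simpl. fold r. lra.
    + unfold plus, Cdiv, Cinv. simpl. fold r. rewrite En. unfold Re, Im, Rsqr in *.
      set (x := fst (z t)) in *. set (y := snd (z t)) in *. set (x' := fst z'). set (y' := snd z').
      assert (Ey : (y * y = r * r - x * x)%R) by lra.
      replace (1 + y / (r + x) * (y / (r + x)))%R with (2 * r / (r + x))%R.
      * replace (y' * (r + x) - y * ((x * x' + y * y') / r + x'))%R
          with ((y' * (r * (r + x) - y * y) - x' * y * (x + r)) / r)%R by (field; lra).
        rewrite Ey. field. lra.
      * replace (1 + y / (r + x) * (y / (r + x)))%R with (1 + y * y / ((r + x) * (r + x)))%R by (field; lra).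
        rewrite Ey. field. lra.
Qed.

Lemma Cder_Cpower (z : R -> C) (t : R) (z' w : C) :
  Cder z t z' -> slit (z t) ->
  Cder (fun s => Cpower (z s) w) t (w * Cpower (z t) (w - 1) * z').
Proof.
  intros H Hs. pose proof (slit_neq_0 _ Hs) as Hz. unfold Cpower at 1.
  eapply Cder_eq.
  - apply Cder_Cexp, Cder_scal, Cder_Cln; eauto.
  - cbv beta. change (Cexp (w * Cln (z t))) with (Cpower (z t) w).
    replace (Cpower (z t) w) with (z t * Cpower (z t) (w - 1)).
    + field. auto.
    + rewrite <- Cpower_succ by auto. f_equal. ring.
Qed.

Lemma Cder_re (f : R -> C) (t : R) (l k : C) : Cder f t l ->
  is_derive (fun s => Re (k * f s)) t (Re (k * l)).
Proof. intro H. apply (Cder_scal k _ _ _ H). Qed.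

(** Mean value inequality; projecting on the direction of the increment
    reduces it to the monotonicity of a real function. *)
Lemma Cmod_increment_le (f f' : R -> C) (g g' : R -> R) (a b : R) : (a <= b) ->
  (forall t, (a <= t <= b) -> Cder f t (f' t)) ->
  (forall t, (a <= t <= b) -> is_derive g t (g' t)) ->
  (forall t, (a <= t <= b) -> (Cmod (f' t) <= g' t)) ->
  (Cmod (f b - f a) <= g b - g a)%R.
Proof.
  intros Hab Hf Hg Hle. set (w := f b - f a).
  set (h := fun t => (Cmod w * g t - Re (Cconj w * f t))%R).
  assert (Hh : forall t, (a <= t <= b) ->
    is_derive h t (Cmod w * g' t - Re (Cconj w * f' t))%R).
  { intros t Ht. unfold h.
    apply (is_derive_minus (fun t => Cmod w * g t)%R (fun t => Re (Cconj w * f t))).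
    - apply is_derive_scal. auto.
    - apply Cder_re. auto. }
  assert (Hd : (h a <= h b)).
  { destruct (MVT_gen h a b (fun t => (Cmod w * g' t - Re (Cconj w * f' t))%R)) as [c [Hc E]].
    - rewrite Rmin_left, Rmax_right by auto. intros t Ht. apply Hh. lra.
    - rewrite Rmin_left, Rmax_right by auto. intros t Ht.
      apply continuity_pt_filterlim. apply (ex_derive_continuous (V := R_NormedModule)).
      eexists. apply Hh. lra.
    - rewrite Rmin_left, Rmax_right in Hc by auto.
      enough (0 <= (Cmod w * g' c - Re (Cconj w * f' c)) * (b - a))%R by lra.
      apply Rmult_le_pos; [|lra].
      enough (Re (Cconj w * f' c) <= Cmod w * g' c)%R by lra.
      bound Rle_abs. bound re_le_Cmod.
      rewrite Cmod_mult, Cmod_conj. apply Rmult_le_compat_l; [apply Cmod_ge_0|]. auto. }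
  assert (E : (Cmod w ^ 2 <= Cmod w * (g b - g a))%R).
  { unfold h in Hd. rewrite Cmod_sq.
    replace (Re w ^ 2 + Im w ^ 2)%R with (Re (Cconj w * f b) - Re (Cconj w * f a))%R; [lra|].
    unfold w. destruct (f a), (f b). simpl. ring. }
  destruct (Req_dec (Cmod w) 0) as [E0|E0].
  - rewrite E0.
    destruct (MVT_gen g a b g') as [c [Hc Ec]].
    + rewrite Rmin_left, Rmax_right by auto. intros t Ht. apply Hg. lra.
    + rewrite Rmin_left, Rmax_right by auto. intros t Ht.
      apply continuity_pt_filterlim. apply (ex_derive_continuous (V := R_NormedModule)).
      eexists. apply Hg. lra.
    + rewrite Rmin_left, Rmax_right in Hc by auto. rewrite Ec.
      apply Rmult_le_pos; [|lra]. bound Cmod_ge_0. now apply Hle.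
  - pose proof (Cmod_ge_0 w). nra.
Qed.

Lemma Cder_id (t : R) : Cder (fun s => RtoC s) t 1.
Proof. apply (Cder_real (fun s => s)), is_derive_Rid. Qed.

Lemma Cmod_Cexp_mult_le (w : C) (t : R) : (0 <= t <= 1) -> (Cmod (Cexp (t * w)) <= exp (Cmod w))%R.
Proof.
  intro Ht. rewrite Cmod_Cexp. apply exp_le.
  bound Rle_abs. bound re_le_Cmod.
  rewrite Cmod_mult, Cmod_R, Rabs_pos_eq by lra. pose proof (Cmod_ge_0 w). nra.
Qed.

Lemma Cexp_sub_1_bound (w : C) : (Cmod (Cexp w - 1) <= Cmod w * exp (Cmod w))%R.
Proof.
  pose proof (Cmod_increment_le (fun t => Cexp (t * w)) (fun t => w * Cexp (t * w))
    (fun t => t * (Cmod w * exp (Cmod w)))%R (fun t => Cmod w * exp (Cmod w))%R 0 1) as H.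
  cbv beta in H. rewrite Cmult_0_l, Cmult_1_l, Cexp_0 in H.
  rewrite Rmult_1_l, Rmult_0_l, Rminus_0_r in H. apply H; [lra| | |].
  - intros t _. eapply Cder_eq.
    + apply Cder_Cexp. apply (Cder_mult (fun t => RtoC t) (fun _ => w)); [apply Cder_id|apply Cder_const].
    + cbv beta; ring.
  - intros t _. eapply is_derive_eq; [apply is_derive_Rmult; [apply is_derive_Rid|apply is_derive_Rconst]|].
    unfold one, zero; simpl. ring.
  - intros t Ht. rewrite Cmod_mult. apply Rmult_le_compat_l; [apply Cmod_ge_0|].
    now apply Cmod_Cexp_mult_le.
Qed.

Lemma Cexp_sub_1_sub_id_bound (w : C) : (Cmod (Cexp w - 1 - w) <= Cmod w ^ 2 * exp (Cmod w))%R.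
Proof.
  pose proof (Cmod_increment_le (fun t => Cexp (t * w) - t * w) (fun t => w * Cexp (t * w) - w)
    (fun t => t * (Cmod w ^ 2 * exp (Cmod w)))%R (fun t => Cmod w ^ 2 * exp (Cmod w))%R 0 1) as H.
  cbv beta in H. rewrite Cmult_0_l, Cmult_1_l, Cexp_0 in H.
  rewrite Rmult_1_l, Rmult_0_l, Rminus_0_r in H.
  replace (Cexp w - 1 - w) with (Cexp w - w - (1 - 0)) by ring. apply H; [lra| | |].
  - intros t _. eapply Cder_eq.
    + apply Cder_minus; [apply Cder_Cexp|];
      apply (Cder_mult (fun t => RtoC t) (fun _ => w)); (apply Cder_id || apply Cder_const).
    + cbv beta; ring.
  - intros t _. eapply is_derive_eq; [apply is_derive_Rmult; [apply is_derive_Rid|apply is_derive_Rconst]|].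
    unfold one, zero; simpl. ring.
  - intros t Ht. replace (w * Cexp (t * w) - w) with (w * (Cexp (t * w) - 1)) by ring.
    rewrite Cmod_mult. pose proof (Cexp_sub_1_bound (t * w)) as B.
    assert (E : (Cmod (t * w) <= Cmod w)%R).
    { rewrite Cmod_mult, Cmod_R, Rabs_pos_eq by lra. pose proof (Cmod_ge_0 w). nra. }
    replace (Cmod w ^ 2 * exp (Cmod w))%R with (Cmod w * (Cmod w * exp (Cmod w)))%R by ring.
    apply Rmult_le_compat_l; [apply Cmod_ge_0|]. eapply Rle_trans; [exact B|].
    apply Rmult_le_compat; auto using Cmod_ge_0. pos. now apply exp_le.
Qed.

(** * Limits of complex-valued functions along a filter *)

Definition Ctends {T : Type} (F : (T -> Prop) -> Prop) (f : T -> C) (l : C) : Prop :=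
  forall eps : R, (0 < eps) -> F (fun x => (Cmod (f x - l) < eps)%R).

Lemma Ctends_bound {T} (F : (T -> Prop) -> Prop) {FF : Filter F} (f : T -> C) (l : C) :
  Ctends F f l -> F (fun x => (Cmod (f x) <= Cmod l + 1)%R).
Proof.
  intro H. refine (filter_imp _ _ _ (H 1%R Rlt_0_1)). intros x Hx.
  pose proof (Cmod_triangle (f x - l) l) as Ht.
  replace (f x - l + l) with (f x) in Ht by ring. lra.
Qed.

Lemma Ctends_ext {T} (F : (T -> Prop) -> Prop) {FF : Filter F} (f g : T -> C) (l : C) :
  F (fun x => f x = g x) -> Ctends F f l -> Ctends F g l.
Proof.
  intros He H eps Heps. refine (filter_imp _ _ _ (filter_and _ _ He (H eps Heps))).
  now intros x [<- Hx].
Qed.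

Lemma Ctends_const {T} (F : (T -> Prop) -> Prop) {FF : Filter F} (l : C) :
  Ctends F (fun _ => l) l.
Proof.
  intros eps Heps. apply filter_forall. intro x.
  replace (l - l) with (RtoC 0) by ring. now rewrite Cmod_0.
Qed.

Lemma Ctends_plus {T} (F : (T -> Prop) -> Prop) {FF : Filter F} (f g : T -> C) (l k : C) :
  Ctends F f l -> Ctends F g k -> Ctends F (fun x => f x + g x) (l + k).
Proof.
  intros H1 H2 eps Heps.
  refine (filter_imp _ _ _ (filter_and _ _ (H1 (eps / 2)%R _) (H2 (eps / 2)%R _))); try lra.
  intros x [A B]. replace (f x + g x - (l + k)) with ((f x - l) + (g x - k)) by ring.
  eapply Rle_lt_trans; [apply Cmod_triangle|]. lra.
Qed.

Lemma Ctends_mult_0 {T} (F : (T -> Prop) -> Prop) {FF : Filter F} (f g : T -> C) (M : R) :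
  F (fun x => (Cmod (f x) <= M)) -> Ctends F g 0 -> Ctends F (fun x => f x * g x) 0.
Proof.
  intros H1 H2 eps Heps.
  assert (Hq : (0 < eps / (Rabs M + 1))%R).
  { apply Rdiv_lt_0_compat; [lra|]. pose proof (Rabs_pos M). lra. }
  refine (filter_imp _ _ _ (filter_and _ _ H1 (H2 _ Hq))).
  intros x [A B]. replace (f x * g x - 0) with (f x * g x) by ring.
  replace (g x - 0) with (g x) in B by ring. rewrite Cmod_mult.
  pose proof (Cmod_ge_0 (f x)) as Hf.
  apply Rlt_div_r in B; [|pose proof (Rabs_pos M); lra].
  pose proof (Rle_abs M). nra.
Qed.

Lemma Ctends_minus_0 {T} (F : (T -> Prop) -> Prop) {FF : Filter F} (f : T -> C) (l : C) :
  Ctends F f l <-> Ctends F (fun x => f x - l) 0.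
Proof.
  split; intros H eps Heps; refine (filter_imp _ _ _ (H eps Heps)); intros x Hx.
  - now replace (f x - l - 0) with (f x - l) by ring.
  - now replace (f x - l - 0) with (f x - l) in Hx by ring.
Qed.

Lemma Ctends_mult {T} (F : (T -> Prop) -> Prop) {FF : Filter F} (f g : T -> C) (l k : C) :
  Ctends F f l -> Ctends F g k -> Ctends F (fun x => f x * g x) (l * k).
Proof.
  intros H1 H2. apply Ctends_minus_0; auto.
  apply (Ctends_ext F (fun x => f x * (g x - k) + k * (f x - l))).
  - apply filter_forall. intro x. ring.
  - replace (RtoC 0) with (0 + 0) by ring. apply Ctends_plus; auto.
    + apply (Ctends_mult_0 F f _ (Cmod l + 1)); [now apply Ctends_bound|].
      now apply (Ctends_minus_0 F g).
    + apply (Ctends_mult_0 F (fun _ => k) _ (Cmod k)).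
      * apply filter_forall. intros _. apply Rle_refl.
      * now apply (Ctends_minus_0 F f).
Qed.

Lemma Ctends_lower {T} (F : (T -> Prop) -> Prop) {FF : Filter F} (f : T -> C) (l : C) :
  l <> 0 -> Ctends F f l -> F (fun x => (Cmod l / 2 <= Cmod (f x))%R).
Proof.
  intros Hl H. apply Cmod_gt_0 in Hl.
  refine (filter_imp _ _ _ (H (Cmod l / 2)%R _)); [|lra]. intros x Hx.
  pose proof (Cmod_triangle_minus l (f x - l)) as Ht.
  replace (l + (f x - l)) with (f x) in Ht by ring. lra.
Qed.

Lemma Ctends_inv {T} (F : (T -> Prop) -> Prop) {FF : Filter F} (f : T -> C) (l : C) :
  l <> 0 -> Ctends F f l -> Ctends F (fun x => / f x) (/ l).
Proof.
  intros Hl H. pose proof (Ctends_lower F f l Hl H) as Hb.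
  pose proof (proj1 (Cmod_gt_0 l) Hl) as Hm.
  assert (Hnz : F (fun x => f x <> 0)).
  { refine (filter_imp _ _ _ Hb). intros x Hx. apply Cmod_gt_0. lra. }
  apply Ctends_minus_0; auto.
  apply (Ctends_ext F (fun x => (- / l * / f x) * (f x - l))).
  - refine (filter_imp _ _ _ Hnz). intros x Hx. field. auto.
  - apply (Ctends_mult_0 F _ _ (/ Cmod l * / (Cmod l / 2))%R).
    + refine (filter_imp _ _ _ (filter_and _ _ Hb Hnz)). intros x [Hx Hx0].
      rewrite Cmod_mult, Cmod_opp, !Cmod_inv by auto.
      apply Rmult_le_compat_l; [pos|].
      apply Rinv_le_contravar; lra.
    + now apply (Ctends_minus_0 F f).
Qed.

Lemma Ctends_unique {T} (F : (T -> Prop) -> Prop) {FF : ProperFilter F} (f : T -> C) (l k : C) :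
  Ctends F f l -> Ctends F f k -> l = k.
Proof.
  intros H1 H2. destruct (Ceq_dec l k) as [E|E]; auto. exfalso.
  assert (Hp : (0 < Cmod (l - k))%R).
  { apply Cmod_gt_0. intro E'. apply E. replace l with (l - k + k) by ring. rewrite E'. ring. }
  assert (Hh : (0 < Cmod (l - k) / 2)%R) by lra.
  destruct (filter_ex _ (filter_and _ _ (H1 _ Hh) (H2 _ Hh))) as [x [A B]].
  pose proof (Cmod_triangle (f x - k) (- (f x - l))) as Ht. rewrite Cmod_opp in Ht.
  replace (f x - k + - (f x - l)) with (l - k) in Ht by ring. lra.
Qed.

(** * The reciprocal Gamma function *)

Lemma CLim_seq_eq (u : nat -> C) (l : C) : Ctends eventually u l -> CLim_seq u = l.
Proof.
  intro H. unfold CLim_seq.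
  rewrite (is_lim_seq_unique (fun n => Re (u n)) (Re l)), (is_lim_seq_unique (fun n => Im (u n)) (Im l)).
  - now destruct l.
  - apply is_lim_seq_spec. intro eps. refine (filter_imp _ _ _ (H eps (cond_pos eps))).
    intros n Hn. eapply Rle_lt_trans; [|exact Hn]. apply (im_le_Cmod (u n - l)).
  - apply is_lim_seq_spec. intro eps. refine (filter_imp _ _ _ (H eps (cond_pos eps))).
    intros n Hn. eapply Rle_lt_trans; [|exact Hn]. apply (re_le_Cmod (u n - l)).
Qed.

Lemma Ctends_cauchy (u : nat -> C) (v : nat -> R) :
  (forall n m, (n <= m)%nat -> (Cmod (u m - u n) <= v n)%R) -> is_lim_seq v 0%R ->
  exists l, Ctends eventually u l.
Proof.
  intros H Hv.
  assert (Q : forall p : C -> R, (forall z w : C, p (z - w)%C = (p z - p w)%R) ->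
    (forall z, Rabs (p z) <= Cmod z) -> ex_finite_lim_seq (fun n => p (u n))).
  { intros p Hp1 Hp2. apply ex_lim_seq_cauchy_corr. intro eps.
    apply is_lim_seq_spec in Hv. destruct (Hv (pos_div_2 eps)) as [N HN]. exists N.
    assert (Hc : forall n, (N <= n)%nat -> (Rabs (p (u n) - p (u N)) < eps / 2)%R).
    { intros n Hn. rewrite <- (Hp1 (u n) (u N)). eapply Rle_lt_trans; [apply Hp2|].
      eapply Rle_lt_trans; [now apply H|]. specialize (HN N (le_n N)). simpl in HN.
      rewrite Rminus_0_r in HN. eapply Rle_lt_trans; [apply Rle_abs|exact HN]. }
    intros n m Hn Hm. replace (p (u n) - p (u m))%R
      with ((p (u n) - p (u N)) + - (p (u m) - p (u N)))%R by ring.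
    eapply Rle_lt_trans; [apply Rabs_triang|]. rewrite Rabs_Ropp.
    pose proof (Hc n Hn). pose proof (Hc m Hm). lra. }
  destruct (Q Re) as [x Hx]; [intros; reflexivity|apply re_le_Cmod|].
  destruct (Q Im) as [y Hy]; [intros; reflexivity|apply im_le_Cmod|].
  exists (x, y). intros eps Heps.
  apply is_lim_seq_spec in Hx. apply is_lim_seq_spec in Hy.
  assert (He : (0 < eps / 2)%R) by lra.
  refine (filter_imp _ _ _ (filter_and _ _ (Hx (mkposreal _ He)) (Hy (mkposreal _ He)))).
  simpl. intros n [A B]. eapply Rle_lt_trans; [apply Cmod_le_re_im|].
  change (Re (u n - (x, y))) with (Re (u n) - x)%R.
  change (Im (u n - (x, y))) with (Im (u n) - y)%R. lra.
Qed.

Lemma inv_sq_le_telescope (n : nat) :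
  (/ (INR n + 1) ^ 2 <= 2 * (/ (INR n + 1) - / (INR n + 2)))%R.
Proof.
  pose proof (pos_INR n).
  replace (2 * (/ (INR n + 1) - / (INR n + 2)))%R with (/ (INR n + 1) * (2 / (INR n + 2)))%R by (field; lra).
  replace (/ (INR n + 1) ^ 2)%R with (/ (INR n + 1) * / (INR n + 1))%R by (field; lra).
  apply Rmult_le_compat_l; [pos|].
  apply Rle_div_r; [lra|]. rewrite Rmult_comm. apply Rle_div_l; lra.
Qed.

Lemma product_bounded (u e : nat -> C) (K : R) : (0 <= K) ->
  (forall n, u (S n) = u n * (1 + e n)) ->
  (forall n, (Cmod (e n) <= K / (INR n + 1) ^ 2)%R) ->
  forall n, (Cmod (u n) <= Cmod (u O) * exp (2 * K * (1 - / (INR n + 1))))%R.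
Proof.
  intros HK Hu He. induction n as [|n IH].
  - simpl INR. replace (2 * K * (1 - / (0 + 1)))%R with 0%R by field. rewrite exp_0. lra.
  - rewrite Hu, Cmod_mult, S_INR.
    assert (E : (Cmod (1 + e n) <= exp (2 * K * (/ (INR n + 1) - / (INR n + 2))))%R).
    { eapply Rle_trans; [|apply exp_ineq1_le]. bound Cmod_triangle.
      rewrite Cmod_1. apply Rplus_le_compat_l. bound He.
      pose proof (inv_sq_le_telescope n). unfold Rdiv. nra. }
    apply Rle_trans with (Cmod (u O) * exp (2 * K * (1 - / (INR n + 1)))
      * exp (2 * K * (/ (INR n + 1) - / (INR n + 2))))%R.
    + apply Rmult_le_compat; auto using Cmod_ge_0.
    + rewrite Rmult_assoc, <- exp_plus. apply Rmult_le_compat_l; [apply Cmod_ge_0|].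
      apply exp_le. replace (INR n + 1 + 1)%R with (INR n + 2)%R by ring. lra.
Qed.

Lemma product_converges (u e : nat -> C) (K : R) : (0 <= K) ->
  (forall n, u (S n) = u n * (1 + e n)) ->
  (forall n, (Cmod (e n) <= K / (INR n + 1) ^ 2)%R) ->
  exists l, Ctends eventually u l.
Proof.
  intros HK Hu He. set (M := (Cmod (u O) * exp (2 * K))%R).
  assert (HM : forall n, (Cmod (u n) <= M)).
  { intro n. eapply Rle_trans; [now apply (product_bounded u e K)|].
    apply Rmult_le_compat_l; [apply Cmod_ge_0|]. apply exp_le.
    pose proof (pos_INR n). pose proof (Rinv_pos_le_1 (INR n + 1) ltac:(lra)). nra. }
  assert (HM0 : (0 <= M)) by (eapply Rle_trans; [apply Cmod_ge_0|apply (HM O)]).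
  apply (Ctends_cauchy u (fun n => 2 * M * K * / (INR n + 1))%R).
  - assert (Q : forall n k, (Cmod (u (n + k)%nat - u n) <=
      2 * M * K * (/ (INR n + 1) - / (INR (n + k) + 1)))%R).
    { intros n k. induction k as [|k IH].
      - rewrite Nat.add_0_r. replace (u n - u n) with (RtoC 0) by ring. rewrite Cmod_0. lra.
      - rewrite Nat.add_succ_r, Hu, S_INR.
        replace (u (n + k)%nat * (1 + e (n + k)%nat) - u n)
          with (u (n + k)%nat - u n + u (n + k)%nat * e (n + k)%nat) by ring.
        bound Cmod_triangle. rewrite Cmod_mult.
        assert (E : (Cmod (u (n + k)%nat) * Cmod (e (n + k)%nat) <= M * (K / (INR (n + k) + 1) ^ 2))%R).
        { apply Rmult_le_compat; auto using Cmod_ge_0. }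
        pose proof (inv_sq_le_telescope (n + k)) as T.
        replace (INR (n + k) + 1 + 1)%R with (INR (n + k) + 2)%R by ring.
        assert (M * (K / (INR (n + k) + 1) ^ 2) <= M * K * (2 * (/ (INR (n + k) + 1) - / (INR (n + k) + 2))))%R.
        { unfold Rdiv. rewrite <- Rmult_assoc. apply Rmult_le_compat_l; [nra|exact T]. }
        lra. }
    intros n m Hnm. replace m with (n + (m - n))%nat by lia.
    bound Q. apply Rmult_le_compat_l; [nra|].
    pose proof (pos_INR (n + (m - n))).
    pose proof (Rinv_pos_le_1 (INR (n + (m - n)) + 1) ltac:(lra)). lra.
  - replace (Finite 0) with (Rbar_mult (2 * M * K)%R 0%R) by (simpl; f_equal; ring).
    apply is_lim_seq_scal_l. apply (is_lim_seq_ext (fun n => / INR (S n))%R).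
    + intro n. now rewrite S_INR.
    + apply (is_lim_seq_incr_1 (fun n => / INR n)%R).
      apply (is_lim_seq_inv INR p_infty); [apply is_lim_seq_INR|discriminate].
Qed.

Lemma Cinv_neq_0 (z : C) : z <> 0 -> / z <> 0.
Proof.
  intros Hz. apply Cmod_gt_0. rewrite Cmod_inv by auto.
  now apply Rinv_0_lt_compat, Cmod_gt_0.
Qed.

Lemma Copp_mult_l (z w : C) : - z * w = - (z * w).
Proof. ring. Qed.

Lemma Cln_pos_real (x : R) : (0 < x) -> Cln x = RtoC (ln x).
Proof.
  intro Hx. unfold Cln. rewrite Cmod_R, Rabs_pos_eq by lra. unfold RtoC at 2. f_equal.
  rewrite Carg_half_angle by (left; exact Hx). simpl. unfold Rdiv. rewrite Rmult_0_l, atan_0. ring.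
Qed.

Lemma Cpower_pos_real (x : R) (w : C) : (0 < x) -> Cpower x w = Cexp (w * RtoC (ln x)).
Proof. intro Hx. unfold Cpower. now rewrite Cln_pos_real. Qed.

Lemma Cpower_pos_real_mult (x x' : R) (w : C) : (0 < x) -> (0 < x') ->
  Cpower (x * x')%R w = Cpower x w * Cpower x' w.
Proof.
  intros Hx Hx'. rewrite !Cpower_pos_real by nra. rewrite ln_mult, RtoC_plus by auto.
  rewrite <- Cexp_plus. f_equal. ring.
Qed.

Lemma ln_1p_bounds (x : R) : (0 < x) -> (x - x ^ 2 <= ln (1 + x) <= x)%R.
Proof.
  intro Hx. split.
  - pose proof (exp_ineq1_le (- ln (1 + x))) as H.
    rewrite exp_Ropp, exp_ln in H by lra.
    assert (E : (/ (1 + x) <= 1 - x + x ^ 2)%R).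
    { rewrite <- (Rmult_1_l (/ _)). apply Rle_div_l; [lra|]. nra. }
    lra.
  - rewrite <- (ln_exp x) at 2. apply ln_le; [lra|]. apply exp_ineq1_le.
Qed.

Lemma INR_S_div (n : nat) : (INR (S (S n)) / INR (S n) = 1 + / (INR n + 1))%R.
Proof. rewrite !S_INR. pose proof (pos_INR n). field. lra. Qed.

(** Gauss's quotients with [n + 1] in place of [n] in the power, so that
    the initial term is meaningful and the recursion starts at 0. *)
Definition gauss (z : C) (n : nat) : C :=
  Cpoch z (S n) / (INR (fact n) * Cpower (INR (S n)) z).

(** The relative increment of [gauss]: the recursion multiplies by
    [(1 + z / (n + 1)) * (1 + 1 / (n + 1)) ^ (- z)], in which the terms of
    order [1 / n] cancel. *)
Definition gauss_err (z : C) (n : nat) : C :=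
  (1 + z * RtoC (/ (INR n + 1))) * Cexp (- z * RtoC (ln (1 + / (INR n + 1)))) - 1.

Lemma INR_fact_neq_0_C (n : nat) : RtoC (INR (fact n)) <> 0.
Proof. apply RtoC_neq_0, INR_fact_neq_0. Qed.

Lemma INR_S_pos (n : nat) : (0 < INR (S n)).
Proof. apply lt_0_INR. lia. Qed.

Lemma INR_S_neq_0_C (n : nat) : RtoC (INR (S n)) <> 0.
Proof. apply RtoC_neq_0, Rgt_not_eq, INR_S_pos. Qed.

Lemma Cpower_INR_SS (z : C) (n : nat) : Cpower (INR (S (S n))) z =
  Cpower (INR (S n)) z * Cexp (z * RtoC (ln (1 + / (INR n + 1)))).
Proof.
  pose proof (INR_S_pos n) as H.
  rewrite <- INR_S_div. rewrite <- Cpower_pos_real.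
  - rewrite <- Cpower_pos_real_mult; auto.
    + f_equal. f_equal. field. lra.
    + apply Rdiv_lt_0_compat; apply INR_S_pos.
  - apply Rdiv_lt_0_compat; apply INR_S_pos.
Qed.

Lemma gauss_S (z : C) (n : nat) : gauss z (S n) = gauss z n * (1 + gauss_err z n).
Proof.
  unfold gauss. rewrite Cpower_INR_SS, fact_simpl, mult_INR, RtoC_mult.
  pose proof (INR_fact_neq_0_C n) as H1. pose proof (Cpower_neq_0 (INR (S n)) z) as H2.
  pose proof (INR_S_neq_0_C n) as H3.
  unfold gauss_err. rewrite <- S_INR, RtoC_inv by apply Rgt_not_eq, INR_S_pos. rewrite Copp_mult_l, Cexp_opp.
  pose proof (Cexp_neq_0 (z * RtoC (ln (1 + / INR (S n))))) as H4.
  change (Cpoch z (S (S n))) with (Cpoch z (S n) * (z + INR (S n))).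
  field. auto.
Qed.

Lemma gauss_err_bound (z : C) : exists K, (0 <= K) /\
  forall n, (Cmod (gauss_err z n) <= K / (INR n + 1) ^ 2)%R.
Proof.
  set (m := Cmod z). assert (Hm : (0 <= m)) by apply Cmod_ge_0.
  pose proof (exp_pos m) as Hexp.
  exists (m + m ^ 2 + m ^ 2 * exp m * (1 + m))%R. split.
  { assert (0 <= m ^ 2 * exp m)%R by nra. nra. }
  intro n. unfold gauss_err. pose proof (pos_INR n) as Hn.
  set (h := (/ (INR n + 1))%R). set (d := ln (1 + h)).
  assert (Hh' : (0 < h <= 1)) by (apply Rinv_pos_le_1; lra). destruct Hh' as [Hh Hh1].
  destruct (ln_1p_bounds h Hh) as [L1 L2]. fold d in L1, L2.
  assert (L0 : (0 <= d)) by nra.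
  replace (_ / (INR n + 1) ^ 2)%R with ((m + m ^ 2 + m ^ 2 * exp m * (1 + m)) * h ^ 2)%R
    by (unfold h; field; lra).
  set (w := - z * d).
  assert (Hw : (Cmod w <= m * h)%R).
  { unfold w. rewrite Cmod_mult, Cmod_opp, Cmod_R, Rabs_pos_eq by auto. fold m. nra. }
  pose proof (Cmod_ge_0 w) as Hw0.
  replace (_ - 1) with ((Cexp w - 1 - w) * (1 + z * h) + (z * RtoC (h - d) - z * z * RtoC (d * h))).
  2: { unfold w. rewrite RtoC_minus, RtoC_mult. ring. }
  pose proof (Cexp_sub_1_sub_id_bound w) as B.
  assert (B1 : (Cmod (Cexp w - 1 - w) <= m ^ 2 * h ^ 2 * exp m)%R).
  { eapply Rle_trans; [exact B|]. apply Rmult_le_compat.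
    - nra.
    - pos.
    - nra.
    - apply exp_le. nra. }
  assert (B2 : (Cmod (1 + z * h) <= 1 + m)%R).
  { bound Cmod_triangle.
    rewrite Cmod_1, Cmod_mult, Cmod_R, Rabs_pos_eq by lra. fold m. nra. }
  assert (B3 : (Cmod (z * RtoC (h - d) - z * z * RtoC (d * h)) <= m * h ^ 2 + m ^ 2 * h ^ 2)%R).
  { bound Cmod_triangle. rewrite Cmod_opp, !Cmod_mult, !Cmod_R.
    rewrite !Rabs_pos_eq by nra. fold m. apply Rplus_le_compat.
    - apply Rmult_le_compat_l; nra.
    - replace (m ^ 2)%R with (m * m)%R by ring. apply Rmult_le_compat_l; nra. }
  bound Cmod_triangle. rewrite Cmod_mult.
  assert (B4 : (Cmod (Cexp w - 1 - w) * Cmod (1 + z * h) <= m ^ 2 * h ^ 2 * exp m * (1 + m))%R).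
  { apply Rmult_le_compat; auto using Cmod_ge_0. }
  lra.
Qed.

Lemma Cexp_ln_step_tends (z : C) :
  Ctends eventually (fun n => Cexp (z * RtoC (ln (1 + / (INR n + 1))))) 1.
Proof.
  intros eps Heps. set (M := (Cmod z * exp (Cmod z))%R).
  assert (HM : (0 <= M)) by (pose proof (Cmod_ge_0 z); pose proof (exp_pos (Cmod z)); unfold M; nra).
  destruct (nfloor_ex (M / eps)) as [N [_ HN]].
  { apply Rle_div_r; lra. }
  exists N. intros n Hn. apply le_INR in Hn. pose proof (pos_INR N) as HN0.
  set (h := (/ (INR n + 1))%R).
  assert (Hh' : (0 < h <= 1)) by (apply Rinv_pos_le_1; lra). destruct Hh' as [Hh Hh1].
  destruct (ln_1p_bounds h Hh) as [L1 L2].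
  set (d := ln (1 + h)) in *. assert (0 <= d) by nra.
  eapply Rle_lt_trans; [apply Cexp_sub_1_bound|].
  rewrite Cmod_mult, Cmod_R, Rabs_pos_eq by auto. pose proof (Cmod_ge_0 z).
  apply Rle_lt_trans with (h * M)%R.
  - unfold M. replace (h * (Cmod z * exp (Cmod z)))%R with (Cmod z * h * exp (Cmod z))%R by ring.
    apply Rmult_le_compat; try nra. pos. apply exp_le. nra.
  - unfold h. rewrite Rmult_comm. apply Rlt_div_l; [lra|].
    apply Rlt_div_l in HN; [|lra]. nra.
Qed.

(** The factors of the product are [1 + O(1 / n ^ 2)], and replacing [n] by
    [n + 1] in the power changes the quotients by a factor tending to 1. *)
Lemma gauss_tends (z : C) : Ctends eventually (gauss z) (rGamma z).
Proof.
  destruct (gauss_err_bound z) as [K [HK0 HK]].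
  destruct (product_converges (gauss z) (gauss_err z) K HK0 (gauss_S z) HK) as [l Hl].
  replace (rGamma z) with l; auto. symmetry. unfold rGamma. apply CLim_seq_eq.
  apply (Ctends_ext _ (fun n => gauss z n * Cexp (z * RtoC (ln (1 + / (INR (pred n) + 1)))))).
  - exists 1%nat. intros [|n] Hn; [lia|]. unfold pred, gauss. rewrite Cpower_INR_SS.
    pose proof (INR_fact_neq_0_C (S n)). pose proof (Cpower_neq_0 (INR (S n)) z).
    pose proof (Cexp_neq_0 (z * RtoC (ln (1 + / (INR n + 1))))). field. auto.
  - replace l with (l * 1) by ring. apply Ctends_mult; [typeclasses eauto|exact Hl|].
    intros eps Heps. destruct (Cexp_ln_step_tends z eps Heps) as [N HN].
    exists (S N). intros [|n] Hn; [lia|]. apply HN. lia.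
Qed.

Lemma Cpoch_neq_0 (c : C) (n : nat) : ~ nonpos_int c -> Cpoch c n <> 0.
Proof.
  intro Hc. induction n as [|n IH]; simpl.
  - apply RtoC_neq_0; lra.
  - intro H. apply Cmult_eq_0 in H. destruct H as [H|H]; [auto|].
    apply Hc. exists n. replace c with (c + INR n - INR n) by ring. rewrite H. ring.
Qed.

(** The reciprocals of the quotients form a convergent product as well, so the
    limit has an inverse. *)
Lemma rGamma_neq_0 (c : C) : ~ nonpos_int c -> rGamma c <> 0.
Proof.
  intro Hc. destruct (gauss_err_bound c) as [K [HK0 HK]].
  destruct (nfloor_ex (2 * K)) as [N0 [_ HN0]]; [lra|].
  (* from the index [2 K] on, the increments are at most 1/2 *)
  set (N := S N0). assert (HN : (2 * K <= INR N)%R) by (unfold N; rewrite S_INR; lra).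
  assert (Hg : forall n, gauss c n <> 0).
  { intro n. unfold gauss. apply Cmult_neq_0; [now apply Cpoch_neq_0|].
    apply Cinv_neq_0. apply Cmult_neq_0; [apply INR_fact_neq_0_C|apply Cpower_neq_0]. }
  set (e := fun n => gauss_err c (N + n)).
  assert (He : forall n, (Cmod (e n) <= 1 / 2 /\ Cmod (e n) <= K / (INR n + 1) ^ 2)%R).
  { intro n. specialize (HK (N + n)%nat). fold (e n) in HK. rewrite plus_INR in HK.
    pose proof (pos_INR n).
    split; (eapply Rle_trans; [exact HK|]).
    - apply Rle_div_l; nra.
    - apply Rmult_le_compat_l; auto. apply Rinv_le_contravar; [nra|]. apply pow_incr. lra. }
  assert (He1 : forall n, (1 / 2 <= Cmod (1 + e n))%R).
  { intro n. pose proof (Cmod_triangle_minus 1 (e n)) as T. rewrite Cmod_1 in T.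
    destruct (He n). lra. }
  assert (He0 : forall n, 1 + e n <> 0) by (intro n; apply Cmod_gt_0; specialize (He1 n); lra).
  destruct (product_converges (fun n => / gauss c (N + n)) (fun n => - e n * / (1 + e n)) (2 * K)) as [l Hl].
  - lra.
  - intro n. rewrite Nat.add_succ_r, gauss_S. fold (e n).
    specialize (He0 n). field. auto.
  - intro n. rewrite Cmod_mult, Cmod_opp, Cmod_inv by auto. destruct (He n) as [_ B].
    replace (2 * K / (INR n + 1) ^ 2)%R with (K / (INR n + 1) ^ 2 * 2)%R by (unfold Rdiv; ring).
    specialize (He1 n). apply Rmult_le_compat; auto using Cmod_ge_0.
    + left. apply Rinv_0_lt_compat. lra.
    + replace 2%R with (/ (1 / 2))%R by field. apply Rinv_le_contravar; lra.
  - assert (Hgt : Ctends eventually (fun n => gauss c (N + n)) (rGamma c)).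
    { intros eps Heps. destruct (gauss_tends c eps Heps) as [M HM]. exists M. intros n Hn. apply HM. lia. }
    pose proof (Ctends_mult _ _ _ _ _ Hgt Hl) as Hp.
    assert (E : RtoC 1 = rGamma c * l).
    { apply (Ctends_unique eventually (fun n => gauss c (N + n) * / gauss c (N + n))); auto.
      apply (Ctends_ext _ (fun _ => RtoC 1)); [|apply Ctends_const; typeclasses eauto].
      apply filter_forall. intro n. field. auto. }
    intro E0. rewrite E0, Cmult_0_l in E. apply (RtoC_neq_0 1); [lra|exact E].
Qed.

Lemma Cpoch_S_l (z : C) (n : nat) : Cpoch z (S n) = z * Cpoch (z + 1) n.
Proof.
  induction n as [|n IH]; [simpl; ring|].
  change (Cpoch z (S (S n))) with (Cpoch z (S n) * (z + INR (S n))).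
  rewrite IH. change (Cpoch (z + 1) (S n)) with (Cpoch (z + 1) n * (z + 1 + INR n)).
  rewrite S_INR, RtoC_plus. ring.
Qed.

Lemma rGamma_succ (z : C) : rGamma z = z * rGamma (z + 1).
Proof.
  apply (Ctends_unique eventually (fun n => gauss z (S n))).
  - intros eps Heps. destruct (gauss_tends z eps Heps) as [N HN]. exists N.
    intros n Hn. apply HN. lia.
  - apply (Ctends_ext _ (fun n => z * gauss (z + 1) n * Cexp (- z * RtoC (ln (1 + / (INR n + 1)))))).
    + apply filter_forall. intro n. unfold gauss. rewrite (Cpoch_S_l z (S n)).
      rewrite Cpower_INR_SS, fact_simpl, mult_INR, RtoC_mult.
      pose proof (INR_S_neq_0_C n) as H3.
      rewrite (Cpower_succ (INR (S n)) z) by auto.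
      rewrite Copp_mult_l, Cexp_opp.
      pose proof (INR_fact_neq_0_C n). pose proof (Cpower_neq_0 (INR (S n)) z).
      pose proof (Cexp_neq_0 (z * RtoC (ln (1 + / (INR n + 1))))). field. auto.
    + replace (z * rGamma (z + 1)) with (z * rGamma (z + 1) * 1) by ring.
      apply Ctends_mult; [typeclasses eauto| |apply Cexp_ln_step_tends].
      apply Ctends_mult; [typeclasses eauto|apply Ctends_const; typeclasses eauto|apply gauss_tends].
Qed.

(** * Entire functions given by exponential generating series *)

Definition egf (q : nat -> C) (z : C) : C :=
  CSeries (fun n => q n * (z ^ n / INR (fact n))).

(** The growth condition under which [egf q] is entire; it is stable under
    shifts, hence under differentiation. *)
Definition geom_bound (q : nat -> C) (A B : R) : Prop :=
  (0 <= A) /\ (0 <= B) /\ forall n, (Cmod (q n) <= A * B ^ n)%R.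

Lemma geom_bound_shift (q : nat -> C) (A B : R) :
  geom_bound q A B -> geom_bound (fun n => q (S n)) (A * B) B.
Proof.
  intros [HA [HB H]]. repeat split; auto; [nra|]. intro n.
  bound H. simpl. lra.
Qed.

Lemma is_series_exp (x : R) : is_series (fun n => x ^ n / INR (fact n))%R (exp x).
Proof.
  pose proof (is_exp_Reals x) as H. unfold is_pseries in H.
  refine (is_series_ext _ _ _ _ H). intro n. rewrite pow_n_pow. unfold scal; simpl; unfold mult; simpl.
  reflexivity.
Qed.

Lemma ex_series_exp (k x : R) : ex_series (fun n => k * (x ^ n / INR (fact n)))%R.
Proof.
  apply (ex_series_scal (V := R_NormedModule) k (fun n => x ^ n / INR (fact n))%R).
  eexists. apply is_series_exp.
Qed.

Lemma Series_exp (k x : R) : Series (fun n => k * (x ^ n / INR (fact n)))%R = (k * exp x)%R.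
Proof. rewrite Series_scal_l. f_equal. apply is_series_unique, is_series_exp. Qed.

Lemma Cmod_egf_term (k z : C) (n : nat) :
  Cmod (k * (z ^ n / INR (fact n))) = (Cmod k * (Cmod z ^ n / INR (fact n)))%R.
Proof.
  rewrite Cmod_mult, Cmod_div by apply INR_fact_neq_0_C. now rewrite Cmod_pow, Cmod_INR.
Qed.

Lemma egf_term_le (q : nat -> C) (A B : R) (z : C) (n : nat) : geom_bound q A B ->
  (Cmod (q n * (z ^ n / INR (fact n))) <= A * ((B * Cmod z) ^ n / INR (fact n)))%R.
Proof.
  intros [HA [HB H]]. rewrite Cmod_egf_term, Rpow_mult_distr.
  replace (A * (B ^ n * Cmod z ^ n / INR (fact n)))%R
    with (A * B ^ n * (Cmod z ^ n / INR (fact n)))%R by (field; apply INR_fact_neq_0).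
  apply Rmult_le_compat_r; [|apply H].
  pos.
Qed.

Lemma egf_summable (q : nat -> C) (A B : R) (z : C) : geom_bound q A B ->
  Csummable (fun n => q n * (z ^ n / INR (fact n))).
Proof.
  intro H. eapply Csummable_le; [|apply (ex_series_exp A (B * Cmod z))].
  intro n. now apply egf_term_le.
Qed.

Lemma egf_bound (q : nat -> C) (A B : R) (z : C) : geom_bound q A B ->
  (Cmod (egf q z) <= A * exp (B * Cmod z))%R.
Proof.
  intro H. unfold egf. eapply Rle_trans; [apply Cmod_CSeries_le; now apply (egf_summable q A B)|].
  rewrite <- Series_exp. apply Series_le; [|apply ex_series_exp].
  intro n. split; [apply Cmod_ge_0|now apply egf_term_le].
Qed.

Lemma egf_0 (q : nat -> C) (A B : R) : geom_bound q A B -> egf q 0 = q O.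
Proof.
  intro H. unfold egf. rewrite CSeries_incr_1 by now apply (egf_summable q A B).
  rewrite CSeries_0.
  - simpl. field.
  - intro n. simpl. unfold Cdiv. ring.
Qed.

Lemma egf_ext (p q : nat -> C) (z : C) : (forall n, p n = q n) -> egf p z = egf q z.
Proof. intro H. apply CSeries_ext. intro n. now rewrite H. Qed.

Lemma egf_plus (p q : nat -> C) (A B A' B' : R) (z : C) : geom_bound p A B -> geom_bound q A' B' ->
  egf (fun n => p n + q n) z = egf p z + egf q z.
Proof.
  intros Hp Hq. unfold egf. rewrite <- CSeries_plus.
  - apply CSeries_ext. intro n. ring.
  - now apply (egf_summable p A B).
  - now apply (egf_summable q A' B').
Qed.

Lemma egf_scal (k : C) (q : nat -> C) (A B : R) (z : C) : geom_bound q A B ->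
  egf (fun n => k * q n) z = k * egf q z.
Proof.
  intros Hq. unfold egf. rewrite <- CSeries_scal by now apply (egf_summable q A B).
  apply CSeries_ext. intro n. ring.
Qed.

Lemma egf_term_S (k z : C) (n : nat) :
  INR (S n) * k * (z ^ (S n) / INR (fact (S n))) = z * (k * (z ^ n / INR (fact n))).
Proof.
  rewrite fact_simpl, mult_INR, RtoC_mult. simpl Cpow.
  pose proof (INR_S_neq_0_C n) as H3.
  pose proof (INR_fact_neq_0_C n). field. auto.
Qed.

Lemma mult_egf (q r : nat -> C) (A B : R) (z : C) : geom_bound q A B ->
  r O = 0 -> (forall n, r (S n) = INR (S n) * q n) -> z * egf q z = egf r z.
Proof.
  intros Hq H0 HS. pose proof (egf_summable q A B z Hq) as Hs.
  assert (E : forall n, r (S n) * (z ^ (S n) / INR (fact (S n))) = z * (q n * (z ^ n / INR (fact n)))).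
  { intro n. rewrite HS. apply egf_term_S. }
  unfold egf. rewrite (CSeries_incr_1 (fun n => r n * (z ^ n / INR (fact n)))).
  - rewrite H0, (CSeries_ext (fun n => r (S n) * (z ^ (S n) / INR (fact (S n)))) _ E).
    rewrite CSeries_scal by auto. ring.
  - apply Csummable_incr_1. eapply Csummable_ext; [|exact (Csummable_scal z _ Hs)].
    intro n. now rewrite E.
Qed.

(** The factor [4] absorbs the [n ^ 2] that the induction produces, so that the
    bound stays geometric and can be summed. *)
Lemma power_remainder (z w : C) (rho : R) (n : nat) : (1 <= rho) ->
  (Cmod z <= rho) -> (Cmod w <= rho) ->
  (Cmod (w ^ n - z ^ n - INR n * z ^ (pred n) * (w - z)) <= (4 * rho) ^ n * Cmod (w - z) ^ 2)%R.
Proof.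
  intros H1 Hz Hw. set (h := w - z).
  assert (Hh : (0 <= Cmod h ^ 2)%R) by (pose proof (Cmod_ge_0 h); nra).
  apply Rle_trans with (INR n ^ 2 * rho ^ n * Cmod h ^ 2)%R.
  - induction n as [|n IH].
    + simpl. replace (1 - 1 - 0 * 1 * h) with (RtoC 0) by ring. rewrite Cmod_0. simpl in Hh. nra.
    + replace (w ^ S n - z ^ S n - INR (S n) * z ^ (pred (S n)) * h) with
        (w * (w ^ n - z ^ n - INR n * z ^ (pred n) * h) + INR n * z ^ (pred n) * (h * h)).
      2: { rewrite S_INR, RtoC_plus. change (pred (S n)) with n. rewrite !Cpow_S.
        destruct n as [|n].
        - unfold h. simpl. ring.
        - change (pred (S n)) with n. rewrite !Cpow_S. unfold h. ring. }
      bound Cmod_triangle. rewrite !Cmod_mult, Cmod_INR, Cmod_pow.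
      assert (E1 : (Cmod z ^ (pred n) <= rho ^ S n)%R).
      { apply Rle_trans with (rho ^ pred n)%R.
        - apply pow_incr. split; auto using Cmod_ge_0.
        - apply Rle_pow; auto. lia. }
      pose proof (pos_INR n) as Hn.
      assert (E2 : (INR n * Cmod z ^ pred n * (Cmod h * Cmod h) <= INR n * rho ^ S n * Cmod h ^ 2)%R).
      { replace (Cmod h ^ 2)%R with (Cmod h * Cmod h)%R by ring.
        apply Rmult_le_compat_r; [nra|]. now apply Rmult_le_compat_l. }
      assert (E3 : (Cmod w * Cmod (w ^ n - z ^ n - INR n * z ^ pred n * h) <=
         rho * (INR n ^ 2 * rho ^ n * Cmod h ^ 2))%R).
      { apply Rmult_le_compat; auto using Cmod_ge_0. }
      rewrite S_INR.
      assert (E4 : (0 <= rho ^ S n * Cmod h ^ 2)%R).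
      { apply Rmult_le_pos; auto. apply pow_le. lra. }
      replace (rho * (INR n ^ 2 * rho ^ n * Cmod h ^ 2))%R
        with (INR n ^ 2 * (rho ^ S n * Cmod h ^ 2))%R in E3 by (simpl; ring).
      nra.
  - apply Rmult_le_compat_r; auto. rewrite Rpow_mult_distr.
    apply Rmult_le_compat_r; [apply pow_le; lra|].
    clear. induction n as [|n IH]; [simpl; lra|]. rewrite S_INR.
    assert (1 <= 4 ^ n)%R by (apply pow_R1_Rle; lra).
    simpl (4 ^ S n)%R. nra.
Qed.

Lemma egf_remainder (q : nat -> C) (A B rho : R) (z w : C) : geom_bound q A B -> (1 <= rho) ->
  (Cmod z <= rho) -> (Cmod w <= rho) ->
  (Cmod (egf q w - egf q z - egf (fun n => q (S n)) z * (w - z))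
    <= A * exp (B * (4 * rho)) * Cmod (w - z) ^ 2)%R.
Proof.
  intros Hq H1 Hz Hw.
  pose proof (egf_summable q A B z Hq) as Sz. pose proof (egf_summable q A B w Hq) as Sw.
  pose proof (egf_summable _ _ _ z (geom_bound_shift q A B Hq)) as Sd.
  set (v := fun n => q n * (INR n * z ^ (pred n) / INR (fact n))).
  assert (Ev : forall n, v (S n) = q (S n) * (z ^ n / INR (fact n))).
  { intro n. unfold v. rewrite fact_simpl, mult_INR, RtoC_mult. change (pred (S n)) with n.
    pose proof (INR_S_neq_0_C n) as H3.
    pose proof (INR_fact_neq_0_C n). field. auto. }
  assert (Sv : Csummable v).
  { apply Csummable_incr_1. eapply Csummable_ext; [|exact Sd]. intro n. now rewrite Ev. }
  assert (E : egf (fun n => q (S n)) z = CSeries v).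
  { rewrite (CSeries_incr_1 v) by auto. unfold v at 1. simpl INR.
    rewrite (CSeries_ext (fun n => v (S n)) _ Ev). unfold egf, Cdiv. ring. }
  assert (E' : egf q w - egf q z - egf (fun n => q (S n)) z * (w - z) =
    CSeries (fun n => (q n * (w ^ n / INR (fact n)) + (- (1)) * (q n * (z ^ n / INR (fact n))))
       + (- (w - z)) * v n)).
  { rewrite CSeries_plus, CSeries_plus, !CSeries_scal; auto using Csummable_plus, Csummable_scal.
    rewrite E. unfold egf. ring. }
  rewrite E'.
  assert (T : forall n, (Cmod ((q n * (w ^ n / INR (fact n)) + (- (1)) * (q n * (z ^ n / INR (fact n))))
       + (- (w - z)) * v n) <= A * Cmod (w - z) ^ 2 * ((B * (4 * rho)) ^ n / INR (fact n)))%R).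
  { intro n. replace (_ + - (w - z) * v n) with
     (q n * ((w ^ n - z ^ n - INR n * z ^ (pred n) * (w - z)) / INR (fact n)))
     by (unfold v, Cdiv; ring).
    rewrite Cmod_mult, Cmod_div by apply INR_fact_neq_0_C. rewrite Cmod_INR.
    destruct Hq as [HA [HB Hq]]. rewrite (Rpow_mult_distr B).
    replace (A * Cmod (w - z) ^ 2 * (B ^ n * (4 * rho) ^ n / INR (fact n)))%R with
      (A * B ^ n * ((4 * rho) ^ n * Cmod (w - z) ^ 2 / INR (fact n)))%R by (field; apply INR_fact_neq_0).
    assert (Hf : (0 < / INR (fact n))%R) by pos.
    apply Rmult_le_compat; auto using Cmod_ge_0.
    - pos.
    - apply Rmult_le_compat_r; [lra|]. now apply power_remainder. }
  bound Cmod_CSeries_le.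
  - auto using Csummable_plus, Csummable_scal.
  - replace (A * exp (B * (4 * rho)) * Cmod (w - z) ^ 2)%R
      with (A * Cmod (w - z) ^ 2 * exp (B * (4 * rho)))%R by ring.
    rewrite <- Series_exp. apply Series_le; [|apply ex_series_exp].
    intro n. split; [apply Cmod_ge_0|apply T].
Qed.

Lemma is_derive_dominated (r m : R -> R) (t : R) :
  locally t (fun s => Rabs (r s) <= m s) -> m t = 0%R -> is_derive m t 0%R -> is_derive r t 0%R.
Proof.
  intros H H0 Hm. apply is_derive_Reals. apply is_derive_Reals in Hm.
  intros eps Heps. destruct (Hm eps Heps) as [d Hd]. destruct H as [d' Hd'].
  assert (Hdd : (0 < Rmin d d')) by (apply Rmin_pos; apply cond_pos).
  exists (mkposreal _ Hdd). simpl. intros h Hh Hlt.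
  specialize (Hd h Hh (Rlt_le_trans _ _ _ Hlt (Rmin_l _ _))).
  rewrite H0, Rminus_0_r in Hd.
  assert (Rt : r t = 0%R).
  { specialize (Hd' t (ball_center t d')). simpl in Hd'. rewrite H0 in Hd'.
    pose proof (Rabs_pos (r t)). apply Rabs_eq_0. lra. }
  assert (Rh : (Rabs (r (t + h)) <= m (t + h))%R).
  { apply Hd'. unfold ball; simpl; unfold AbsRing_ball, abs, minus, plus, opp; simpl.
    replace (t + h + - t)%R with h by ring. eapply Rlt_le_trans; [exact Hlt|apply Rmin_r]. }
  rewrite Rt, Rminus_0_r, Rminus_0_r. rewrite Rminus_0_r in Hd.
  eapply Rle_lt_trans; [|exact Hd]. unfold Rdiv. rewrite !Rabs_mult.
  apply Rmult_le_compat_r; [apply Rabs_pos|]. eapply Rle_trans; [exact Rh|apply Rle_abs].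
Qed.

(** Chain rule, from a quadratic remainder estimate for the outer function. *)
Lemma Cder_comp_quadratic (f : C -> C) (z : R -> C) (t : R) (z' d : C) (M : R) :
  (forall w, (Cmod (w - z t) <= 1)%R -> (Cmod (f w - f (z t) - d * (w - z t)) <= M * Cmod (w - z t) ^ 2)%R) ->
  Cder z t z' -> Cder (fun s => f (z s)) t (d * z').
Proof.
  intros H Hz.
  set (lin := fun s => f (z t) + d * (z s - z t)).
  assert (Hl : Cder lin t (d * z')).
  { eapply Cder_eq.
    - apply Cder_plus; [apply Cder_const|]. apply Cder_scal, Cder_minus; [exact Hz|apply Cder_const].
    - ring. }
  set (m := fun s => ((Re (z s) - Re (z t)) * (Re (z s) - Re (z t)) + (Im (z s) - Im (z t)) * (Im (z s) - Im (z t)))%R).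
  assert (Em : forall s, m s = (Cmod (z s - z t) ^ 2)%R).
  { intro s. rewrite Cmod_sq. unfold m.
    change (Re (z s - z t)) with (Re (z s) - Re (z t))%R.
    change (Im (z s - z t)) with (Im (z s) - Im (z t))%R. ring. }
  assert (Dm : is_derive m t 0%R).
  { destruct Hz as [H1 H2].
    assert (Q : forall (x : R -> R) l, is_derive x t l -> is_derive (fun s => x s - x t)%R t l).
    { intros x l Hx. eapply is_derive_eq.
      - apply (is_derive_minus x (fun _ => x t)); [exact Hx|apply is_derive_Rconst].
      - unfold minus, plus, opp; simpl. ring. }
    eapply is_derive_eq.
    - apply (is_derive_plus (fun s => (Re (z s) - Re (z t)) * (Re (z s) - Re (z t)))%R);
        (apply is_derive_Rmult; apply Q; eassumption).
    - unfold plus; simpl. ring. }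
  assert (Hloc : locally t (fun s => (Cmod (f (z s) - lin s) <= M * m s)%R)).
  { assert (Hc : locally t (fun s => (0 < 1 - m s)%R)).
    { apply (continuous_pos_loc _ _ (0 - 0)%R).
      - apply (is_derive_minus (fun _ => 1%R) m); [apply is_derive_Rconst|exact Dm].
      - unfold m. nra. }
    refine (filter_imp _ _ _ Hc). intros s Hs. rewrite Em in *.
    unfold lin. replace (f (z s) - (f (z t) + d * (z s - z t)))
      with (f (z s) - f (z t) - d * (z s - z t)) by ring.
    apply H. nra. }
  assert (DMm : is_derive (fun s => M * m s)%R t 0%R).
  { eapply is_derive_eq; [apply is_derive_scal; exact Dm|]. ring. }
  assert (M0 : (M * m t = 0)%R) by (unfold m; ring).
  apply (Cder_ext (fun s => lin s + (f (z s) - lin s))); [intro; ring|].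
  eapply Cder_eq; [apply Cder_plus; [exact Hl|]|].
  - instantiate (1 := 0). split.
    + apply (is_derive_dominated _ (fun s => M * m s)%R); auto.
      refine (filter_imp _ _ _ Hloc). intros s Hs. eapply Rle_trans; [apply re_le_Cmod|exact Hs].
    + apply (is_derive_dominated _ (fun s => M * m s)%R); auto.
      refine (filter_imp _ _ _ Hloc). intros s Hs. eapply Rle_trans; [apply im_le_Cmod|exact Hs].
  - ring.
Qed.

Lemma Cder_egf (q : nat -> C) (A B : R) (z : R -> C) (t : R) (z' : C) : geom_bound q A B ->
  Cder z t z' -> Cder (fun s => egf q (z s)) t (egf (fun n => q (S n)) (z t) * z').
Proof.
  intros Hq Hz. apply (Cder_comp_quadratic _ _ _ _ _ (A * exp (B * (4 * (Cmod (z t) + 1))))); auto.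
  intros w Hw. apply egf_remainder; auto.
  - pose proof (Cmod_ge_0 (z t)). lra.
  - lra.
  - pose proof (Cmod_triangle (w - z t) (z t)) as Ht. replace (w - z t + z t) with w in Ht by ring. lra.
Qed.

(** The coefficients of [exp z * egf p z], generated by Pascal's rule. *)
Fixpoint binomial_transform (p : nat -> C) (n : nat) : C :=
  match n with
  | O => p O
  | S k => binomial_transform p k + binomial_transform (fun j => p (S j)) k
  end.

Lemma binomial_transform_bound (p : nat -> C) (A B : R) :
  geom_bound p A B -> geom_bound (binomial_transform p) A (1 + B).
Proof.
  intro H. assert (H0 := H). destruct H0 as [HA [HB _]]. repeat split; auto; [lra|].
  intro n. revert p A HA H. induction n as [|n IH]; intros p A HA H; simpl.
  - destruct H as [_ [_ H]]. specialize (H O). simpl in H. lra.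
  - bound Cmod_triangle.
    pose proof (IH p A HA H) as I1.
    pose proof (IH (fun j => p (S j)) (A * B)%R ltac:(nra) (geom_bound_shift _ _ _ H)) as I2. lra.
Qed.

Lemma binomial_transform_ext (p q : nat -> C) (n : nat) : (forall k, p k = q k) ->
  binomial_transform p n = binomial_transform q n.
Proof.
  revert p q. induction n as [|n IH]; intros p q H; simpl; auto.
  rewrite (IH p q), (IH (fun j => p (S j)) (fun j => q (S j))); auto.
Qed.

Lemma Cder_tz (z : C) (t : R) : Cder (fun s => s * z) t z.
Proof.
  eapply Cder_eq; [apply (Cder_mult (fun s => RtoC s) (fun _ => z)); [apply Cder_id|apply Cder_const]|].
  cbv beta. ring.
Qed.

(** Along the ray through [z] the defect and those of the shifted sequences
    form a chain in which each is a primitive of the next, all vanishing at 0;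
    hence the defect is bounded by the Taylor remainders of an exponential. *)
Lemma Cexp_mult_egf (p : nat -> C) (A B : R) (z : C) : geom_bound p A B ->
  Cexp z * egf p z = egf (binomial_transform p) z.
Proof.
  intro Hp.
  set (h := fun (p : nat -> C) (t : R) =>
    egf p (t * z) - Cexp (- (t * z)) * egf (binomial_transform p) (t * z)).
  assert (HB : (0 <= B)) by apply Hp.
  assert (Dh : forall p A, geom_bound p A B -> forall t, Cder (h p) t (h (fun j => p (S j)) t * z)).
  { clear p A Hp. intros p A Hp t. unfold h.
    pose proof (binomial_transform_bound p A B Hp) as Hb.
    pose proof (binomial_transform_bound _ _ _ (geom_bound_shift p A B Hp)) as Hb'.
    eapply Cder_eq.
    - apply Cder_minus.
      + apply (Cder_egf p A B); [auto|apply Cder_tz].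
      + apply Cder_mult; [apply Cder_Cexp, Cder_opp, Cder_tz|].
        eapply Cder_egf; [exact Hb|apply Cder_tz].
    - cbv beta.
      assert (E : egf (fun n => binomial_transform p (S n)) (t * z) =
        egf (binomial_transform p) (t * z) + egf (binomial_transform (fun j => p (S j))) (t * z))
        by exact (egf_plus _ _ _ _ _ _ (t * z) Hb Hb').
      rewrite E. ring. }
  set (K := (exp (B * Cmod z) + exp (Cmod z) * exp ((1 + B) * Cmod z))%R).
  assert (HK : (0 <= K)).
  { unfold K. pose proof (exp_pos (B * Cmod z)). pose proof (exp_pos (Cmod z)).
    pose proof (exp_pos ((1 + B) * Cmod z)). nra. }
  assert (Bh : forall p A, geom_bound p A B -> forall t, (0 <= t <= 1) -> (Cmod (h p t) <= A * K)%R).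
  { clear p A Hp. intros p A Hp t Ht. unfold h.
    pose proof (binomial_transform_bound p A B Hp) as Hb.
    assert (Hz : (Cmod (t * z) <= Cmod z)%R).
    { rewrite Cmod_mult, Cmod_R, Rabs_pos_eq by lra. pose proof (Cmod_ge_0 z). nra. }
    assert (HA : (0 <= A)) by apply Hp.
    assert (B1 : (Cmod (egf p (t * z)) <= A * exp (B * Cmod z))%R).
    { eapply Rle_trans; [apply (egf_bound p A B); auto|].
      apply Rmult_le_compat_l; auto. apply exp_le. now apply Rmult_le_compat_l. }
    assert (B2 : (Cmod (egf (binomial_transform p) (t * z)) <= A * exp ((1 + B) * Cmod z))%R).
    { eapply Rle_trans; [apply (egf_bound _ A (1 + B)); auto|].
      apply Rmult_le_compat_l; auto. apply exp_le. apply Rmult_le_compat_l; lra. }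
    assert (B3 : (Cmod (Cexp (- (t * z))) <= exp (Cmod z))%R).
    { rewrite Cmod_Cexp. apply exp_le. bound Rle_abs.
      bound re_le_Cmod. now rewrite Cmod_opp. }
    bound Cmod_triangle. rewrite Cmod_opp, Cmod_mult.
    assert (B4 : (Cmod (Cexp (- (t * z))) * Cmod (egf (binomial_transform p) (t * z)) <=
       exp (Cmod z) * (A * exp ((1 + B) * Cmod z)))%R)
      by (apply Rmult_le_compat; auto using Cmod_ge_0).
    unfold K. lra. }
  assert (H0 : forall p A, geom_bound p A B -> h p 0%R = 0).
  { clear p A Hp. intros p A Hp. unfold h.
    replace (0%R * z) with (RtoC 0) by ring.
    rewrite (egf_0 _ _ _ Hp), (egf_0 _ _ _ (binomial_transform_bound p A B Hp)).
    replace (- RtoC 0) with (RtoC 0) by ring. rewrite Cexp_0. simpl. ring. }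
  assert (T : forall n p A, geom_bound p A B -> forall t, (0 <= t <= 1) ->
    (Cmod (h p t) <= A * K * ((B * Cmod z * t) ^ n / INR (fact n)))%R).
  { clear p A Hp. induction n as [|n IH]; intros p A Hp t Ht.
    - simpl. replace (1 / 1)%R with 1%R by field. rewrite Rmult_1_r. now apply Bh.
    - pose proof (Cmod_increment_le (h p) (fun t => h (fun j => p (S j)) t * z)
        (fun t => A * K * ((B * Cmod z * t) ^ S n / INR (fact (S n))))%R
        (fun t => A * B * K * ((B * Cmod z * t) ^ n / INR (fact n)) * Cmod z)%R 0 t) as I.
      cbv beta in I. rewrite (H0 p A Hp) in I.
      replace (h p t - 0) with (h p t) in I by ring.
      replace (A * K * ((B * Cmod z * 0) ^ S n / INR (fact (S n))))%R with 0%R in I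
        by (rewrite Rmult_0_r; simpl pow; field; apply INR_fact_neq_0).
      rewrite Rminus_0_r in I. apply I; [lra| | |].
      + intros s _. now apply (Dh p A).
      + intros s _. eapply is_derive_eq.
        * apply is_derive_scal.
          apply (is_derive_ext (fun s => / INR (fact (S n)) * (B * Cmod z * s) ^ S n)%R).
          { intro x. apply Rmult_comm. }
          apply is_derive_scal, is_derive_pow. apply is_derive_scal, is_derive_Rid.
        * change (pred (S n)) with n. rewrite fact_simpl, mult_INR. field.
          split; [apply INR_fact_neq_0|apply Rgt_not_eq, INR_S_pos].
      + intros s Hs. rewrite Cmod_mult. apply Rmult_le_compat_r; [apply Cmod_ge_0|].
        apply IH; [now apply geom_bound_shift|lra]. }
  assert (E : h p 1%R = 0).
  { apply Cmod_eq_0. apply Rle_antisym; [|apply Cmod_ge_0].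
    apply Rnot_lt_le. intro Hpos.
    set (L := (A * K + 1)%R).
    assert (HL : (0 < L)) by (destruct Hp as [HA _]; unfold L; nra).
    destruct (cv_speed_pow_fact (B * Cmod z) (Cmod (h p 1%R) / L)%R) as [N HN].
    { now apply Rdiv_lt_0_compat. }
    specialize (HN N (le_n N)). unfold Rdist in HN. rewrite Rminus_0_r in HN.
    pose proof (T N p A Hp 1%R ltac:(lra)) as TN. rewrite Rmult_1_r in TN.
    set (x := ((B * Cmod z) ^ N / INR (fact N))%R) in *.
    assert (Hx : (0 <= x)).
    { pos. }
    rewrite Rabs_pos_eq in HN by auto. apply Rlt_div_r in HN; auto.
    assert (A * K * x <= L * x)%R by (apply Rmult_le_compat_r; unfold L; lra). lra. }
  unfold h in E. rewrite Cmult_1_l in E.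
  assert (E' : egf p z = Cexp (- z) * egf (binomial_transform p) z).
  { replace (egf p z) with (egf p z - Cexp (- z) * egf (binomial_transform p) z
      + Cexp (- z) * egf (binomial_transform p) z) by ring. rewrite E. ring. }
  rewrite E'. rewrite Cmult_assoc, (Cmult_comm (Cexp z)), Cexp_opp_l. ring.
Qed.

(** * Kummer's function *)

Definition hcoef (b c : C) (n : nat) : C := Cpoch b n / Cpoch c n.

Lemma hyp1F1_egf (b c z : C) : hyp1F1 b c z = egf (hcoef b c) z.
Proof. reflexivity. Qed.

Lemma nonpos_int_succ (c : C) : ~ nonpos_int c -> ~ nonpos_int (c + 1).
Proof.
  intros Hc [k Hk]. apply Hc. exists (S k). rewrite S_INR, RtoC_plus.
  replace c with (c + 1 - 1) by ring. rewrite Hk. ring.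
Qed.

Lemma shift_neq_0 (c : C) (n : nat) : ~ nonpos_int c -> c + INR n <> 0.
Proof.
  intros Hc H. apply Hc. exists n. replace c with (c + INR n - INR n) by ring. rewrite H. ring.
Qed.

Lemma nonpos_int_neq_0 (c : C) : ~ nonpos_int c -> c <> 0.
Proof. intros Hc ->. apply Hc. exists O. simpl. ring. Qed.

(** Bounds the denominators of the hypergeometric coefficients away from 0,
    uniformly in the index. *)
Lemma dist_nonpos_int (c : C) : ~ nonpos_int c ->
  exists d, (0 < d) /\ forall k, (d * (1 + INR k) <= Cmod (c + INR k))%R.
Proof.
  intro Hc. pose proof (Cmod_ge_0 c) as Hm.
  destruct (nfloor_ex (2 * Cmod c + 1)) as [N [_ HN]]; [lra|].
  assert (Q : forall n, exists d, (0 < d) /\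
    forall k, (k < n)%nat -> (d * (1 + INR k) <= Cmod (c + INR k))%R).
  { induction n as [|n [d [Hd IH]]].
    - exists 1%R. split; [lra|]. intros; lia.
    - pose proof (proj1 (Cmod_gt_0 _) (shift_neq_0 c n Hc)) as Hn. pose proof (pos_INR n).
      exists (Rmin d (Cmod (c + INR n) / (1 + INR n))). split.
      + apply Rmin_pos; auto. apply Rdiv_lt_0_compat; lra.
      + intros k Hk. pose proof (pos_INR k). destruct (Nat.eq_dec k n) as [->|Hne].
        * apply Rle_div_r; [lra|]. apply Rmin_r.
        * eapply Rle_trans; [|apply IH; lia]. apply Rmult_le_compat_r; [lra|apply Rmin_l]. }
  destruct (Q (S N)) as [d [Hd H]].
  exists (Rmin d (/ 2)). split; [apply Rmin_pos; lra|]. intro k. pose proof (pos_INR k).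
  destruct (le_lt_dec (S N) k) as [Hk|Hk].
  - apply le_INR in Hk. rewrite S_INR in Hk.
    pose proof (Cmod_triangle_minus (INR k) c) as T. rewrite Cmod_INR in T.
    rewrite (Cplus_comm c).
    assert (Rmin d (/ 2) * (1 + INR k) <= / 2 * (1 + INR k))%R
      by (apply Rmult_le_compat_r; [lra|apply Rmin_r]). lra.
  - eapply Rle_trans; [|now apply H]. apply Rmult_le_compat_r; [lra|apply Rmin_l].
Qed.

Lemma hcoef_S (b c : C) (n : nat) : ~ nonpos_int c ->
  hcoef b c (S n) = hcoef b c n * ((b + INR n) / (c + INR n)).
Proof.
  intro Hc. unfold hcoef. simpl. pose proof (Cpoch_neq_0 c n Hc). pose proof (shift_neq_0 c n Hc).
  field. auto.
Qed.

Lemma hcoef_0 (b c : C) : hcoef b c 0 = 1.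
Proof. unfold hcoef. simpl. field. Qed.

Lemma hcoef_bound (b c : C) : ~ nonpos_int c -> exists B, geom_bound (hcoef b c) 1 B.
Proof.
  intro Hc. destruct (dist_nonpos_int c Hc) as [d [Hd H]].
  pose proof (Cmod_ge_0 b) as Hb.
  exists ((Cmod b + 1) / d)%R.
  assert (HB : (0 <= (Cmod b + 1) / d)%R) by pos.
  repeat split; [lra|auto|]. intro n. rewrite Rmult_1_l.
  induction n as [|n IH].
  - rewrite hcoef_0, Cmod_1. simpl. lra.
  - rewrite hcoef_S, Cmod_mult, Cmod_div by (auto using shift_neq_0). simpl.
    rewrite Rmult_comm. apply Rmult_le_compat; auto using Cmod_ge_0.
    + apply Rmult_le_pos; [apply Cmod_ge_0|]. left. apply Rinv_0_lt_compat.
      now apply Cmod_gt_0, shift_neq_0.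
    + pose proof (proj1 (Cmod_gt_0 _) (shift_neq_0 c n Hc)) as Hn. pose proof (pos_INR n).
      apply Rle_div_l; [auto|]. apply Rle_trans with ((Cmod b + 1) / d * (d * (1 + INR n)))%R.
      * replace ((Cmod b + 1) / d * (d * (1 + INR n)))%R with ((Cmod b + 1) * (1 + INR n))%R by (field; lra).
        bound Cmod_triangle. rewrite Cmod_INR. nra.
      * apply Rmult_le_compat_l; auto.
Qed.

Lemma geom_bound_plus (p q : nat -> C) (A B A' B' : R) : geom_bound p A B -> geom_bound q A' B' ->
  geom_bound (fun n => p n + q n) (A + A') (B + B').
Proof.
  intros [HA [HB Hp]] [HA' [HB' Hq]]. repeat split; try lra. intro n.
  bound Cmod_triangle.
  assert (B ^ n <= (B + B') ^ n)%R by (apply pow_incr; lra).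
  assert (B' ^ n <= (B + B') ^ n)%R by (apply pow_incr; lra).
  specialize (Hp n). specialize (Hq n).
  assert (A * B ^ n <= A * (B + B') ^ n)%R by (now apply Rmult_le_compat_l).
  assert (A' * B' ^ n <= A' * (B + B') ^ n)%R by (now apply Rmult_le_compat_l). lra.
Qed.

Lemma geom_bound_scal (k : C) (q : nat -> C) (A B : R) : geom_bound q A B ->
  geom_bound (fun n => k * q n) (Cmod k * A) B.
Proof.
  intros [HA [HB Hq]]. repeat split; auto.
  - pose proof (Cmod_ge_0 k). nra.
  - intro n. rewrite Cmod_mult, Rmult_assoc. apply Rmult_le_compat_l; [apply Cmod_ge_0|auto].
Qed.

Definition hyp1F1' (b c z : C) : C := egf (fun n => hcoef b c (S n)) z.
Definition hyp1F1'' (b c z : C) : C := egf (fun n => hcoef b c (S (S n))) z.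

(** Both this equation and the contiguous relation below amount to identities
    between coefficients, since multiplication by [z] acts on them by an index
    shift. *)
Lemma kummer_ode (b c z : C) : ~ nonpos_int c ->
  z * hyp1F1'' b c z = (z - c) * hyp1F1' b c z + b * hyp1F1 b c z.
Proof.
  intro Hc. destruct (hcoef_bound b c Hc) as [B H0].
  pose proof (geom_bound_shift _ _ _ H0) as H1. pose proof (geom_bound_shift _ _ _ H1) as H2.
  cbv beta in H2. rewrite hyp1F1_egf. unfold hyp1F1', hyp1F1''.
  pose proof (geom_bound_scal (- (1)) _ _ _ H1) as H1m.
  pose proof (geom_bound_scal (- c) _ _ _ H1) as H1c.
  pose proof (geom_bound_scal b _ _ _ H0) as H0b.
  pose proof (mult_egf (fun n => hcoef b c (S (S n)) + - (1) * hcoef b c (S n))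
    (fun n => b * hcoef b c n + - c * hcoef b c (S n)) _ _ z (geom_bound_plus _ _ _ _ _ _ H2 H1m)) as E.
  rewrite (egf_plus _ _ _ _ _ _ z H2 H1m), (egf_plus _ _ _ _ _ _ z H0b H1c) in E.
  rewrite (egf_scal _ _ _ _ z H1), (egf_scal _ _ _ _ z H1), (egf_scal _ _ _ _ z H0) in E.
  replace (z * egf (fun n => hcoef b c (S (S n))) z) with
    (z * (egf (fun n => hcoef b c (S (S n))) z + - (1) * egf (fun n => hcoef b c (S n)) z)
      + z * egf (fun n => hcoef b c (S n)) z) by ring.
  rewrite E; [ring| |].
  - rewrite hcoef_S, hcoef_0 by auto. simpl INR. pose proof (nonpos_int_neq_0 c Hc).
    field. auto.
  - intro n. rewrite (hcoef_S b c (S n)) by auto. pose proof (shift_neq_0 c (S n) Hc). field. auto.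
Qed.

Lemma kummer_contiguous (al c z : C) : ~ nonpos_int c ->
  z * hyp1F1 al c z =
  al * hyp1F1 (al + 1) c z - (2 * al - c) * hyp1F1 al c z - (c - al) * hyp1F1 (al - 1) c z.
Proof.
  intro Hc. destruct (hcoef_bound al c Hc) as [B H0].
  destruct (hcoef_bound (al + 1) c Hc) as [Bp Hp]. destruct (hcoef_bound (al - 1) c Hc) as [Bm Hm].
  rewrite !hyp1F1_egf.
  pose proof (geom_bound_scal al _ _ _ Hp) as Hp'.
  pose proof (geom_bound_scal (- (2 * al - c)) _ _ _ H0) as H0'.
  pose proof (geom_bound_scal (- (c - al)) _ _ _ Hm) as Hm'.
  rewrite (mult_egf (hcoef al c) (fun n => al * hcoef (al + 1) c n + - (2 * al - c) * hcoef al c n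
    + - (c - al) * hcoef (al - 1) c n) 1 B z H0).
  - rewrite (egf_plus _ _ _ _ _ _ z (geom_bound_plus _ _ _ _ _ _ Hp' H0') Hm').
    rewrite (egf_plus _ _ _ _ _ _ z Hp' H0').
    rewrite (egf_scal _ _ _ _ z Hp), (egf_scal _ _ _ _ z H0), (egf_scal _ _ _ _ z Hm). ring.
  - rewrite !hcoef_0. ring.
  - intro n. unfold hcoef.
    pose proof (Cpoch_neq_0 c n Hc). pose proof (shift_neq_0 c n Hc).
    replace (al * (Cpoch (al + 1) (S n) / Cpoch c (S n))) with (Cpoch al (S (S n)) / Cpoch c (S n))
      by (rewrite (Cpoch_S_l al (S n)); unfold Cdiv; ring).
    rewrite (Cpoch_S_l (al - 1)). replace (al - 1 + 1) with al by ring.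
    change (Cpoch al (S (S n))) with (Cpoch al n * (al + INR n) * (al + INR (S n))).
    change (Cpoch al (S n)) with (Cpoch al n * (al + INR n)).
    change (Cpoch c (S n)) with (Cpoch c n * (c + INR n)).
    rewrite S_INR, RtoC_plus. field. auto.
Qed.

(** The Chu-Vandermonde identity, by Pascal's rule. *)
Lemma binomial_transform_hcoef (k d c : C) (n : nat) : ~ nonpos_int c ->
  binomial_transform (fun j => k * ((- (1)) ^ j * hcoef d c j)) n = k * hcoef (c - d) c n.
Proof.
  revert k d c. induction n as [|n IH]; intros k d c Hc.
  - simpl. rewrite !hcoef_0. ring.
  - simpl binomial_transform. rewrite IH by auto.
    rewrite (binomial_transform_ext _ (fun j => (- k * (d / c)) * ((- (1)) ^ j * hcoef (d + 1) (c + 1) j))).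
    + rewrite IH by now apply nonpos_int_succ.
      replace (c + 1 - (d + 1)) with (c - d) by ring. rewrite hcoef_S by auto. unfold hcoef.
      pose proof (Cpoch_neq_0 c n Hc). pose proof (shift_neq_0 c n Hc).
      assert (Hc0 : c <> 0) by (now apply nonpos_int_neq_0).
      assert (E : Cpoch (c + 1) n = Cpoch c n * (c + INR n) / c).
      { change (Cpoch c n * (c + INR n)) with (Cpoch c (S n)). rewrite Cpoch_S_l. field. auto. }
      rewrite E. field. auto.
    + intro j. simpl Cpow. unfold hcoef. rewrite !Cpoch_S_l.
      assert (Hc0 : c <> 0) by (now apply nonpos_int_neq_0).
      pose proof (Cpoch_neq_0 (c + 1) j (nonpos_int_succ c Hc)) as H1. field. auto.
Qed.

Lemma kummer_transformation (a c z : C) : ~ nonpos_int c ->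
  hyp1F1 a c z = Cexp z * hyp1F1 (c - a) c (- z).
Proof.
  intro Hc. destruct (hcoef_bound (c - a) c Hc) as [B [_ [HB H]]].
  assert (E : hyp1F1 (c - a) c (- z) = egf (fun j => 1 * ((- (1)) ^ j * hcoef (c - a) c j)) z).
  { rewrite hyp1F1_egf. apply CSeries_ext. intro n.
    replace (- z) with (- (1) * z) by ring. rewrite Cpow_mult_l. unfold Cdiv. ring. }
  rewrite E, (Cexp_mult_egf _ 1 B).
  - rewrite hyp1F1_egf. apply egf_ext. intro n. rewrite binomial_transform_hcoef by auto.
    replace (c - (c - a)) with a by ring. ring.
  - repeat split; auto; [lra|]. intro n.
    rewrite !Cmod_mult, Cmod_pow, Cmod_m1, Cmod_1, pow1, !Rmult_1_l.
    specialize (H n). lra.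
Qed.

(** * Concentration of the exponential series around its index [n = x] *)

(** Non-negative terms are part of the notion, so that it passes to smaller
    sequences and to subfamilies of the terms. *)
Definition sum_le (f : nat -> R) (B : R) : Prop :=
  (forall n, (0 <= f n)) /\ ex_series f /\ (Series f <= B).

Lemma sum_le_mono (f g : nat -> R) (B : R) :
  (forall n, (0 <= f n <= g n)) -> sum_le g B -> sum_le f B.
Proof.
  intros H [Hg [Eg Bg]]. repeat split.
  - apply H.
  - apply (ex_series_le (V := R_CompleteNormedModule) f g); auto.
    intro n. unfold norm; simpl; unfold abs; simpl. rewrite Rabs_pos_eq; apply H.
  - eapply Rle_trans; [apply Series_le; [exact H|exact Eg]|exact Bg].
Qed.

Lemma sum_le_plus (f g : nat -> R) (B D : R) :
  sum_le f B -> sum_le g D -> sum_le (fun n => f n + g n)%R (B + D).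
Proof.
  intros [Hf [Ef Bf]] [Hg [Eg Bg]]. repeat split.
  - intro n. specialize (Hf n). specialize (Hg n). lra.
  - exact (ex_series_plus f g Ef Eg).
  - rewrite Series_plus by auto. lra.
Qed.

Lemma sum_le_scal (k : R) (f : nat -> R) (B : R) : (0 <= k) ->
  sum_le f B -> sum_le (fun n => k * f n)%R (k * B).
Proof.
  intros Hk [Hf [Ef Bf]]. repeat split.
  - intro n. specialize (Hf n). nra.
  - exact (ex_series_scal k f Ef).
  - rewrite Series_scal_l. nra.
Qed.

Lemma sum_le_shift (f : nat -> R) (B : R) : f O = 0%R ->
  sum_le (fun n => f (S n)) B -> sum_le f B.
Proof.
  intros H0 [Hf [Ef Bf]]. repeat split.
  - intros [|n]; [rewrite H0; lra|apply Hf].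
  - now apply ex_series_incr_1.
  - rewrite Series_incr_1 by now apply ex_series_incr_1. rewrite H0. lra.
Qed.

Lemma sum_le_unshift (f : nat -> R) (B : R) : sum_le f B -> sum_le (fun n => f (S n)) B.
Proof.
  intros [Hf [Ef Bf]]. repeat split.
  - intro n. apply Hf.
  - now apply (ex_series_incr_1 f).
  - rewrite Series_incr_1 in Bf by auto. specialize (Hf O). lra.
Qed.

Definition expterm (x : R) (n : nat) : R := (x ^ n / INR (fact n))%R.

Lemma expterm_pos (x : R) (n : nat) : (0 <= x) -> (0 <= expterm x n).
Proof.
  intro Hx. unfold expterm. pos.
Qed.

Lemma expterm_S (x : R) (n : nat) : (expterm x (S n) * INR (S n) = x * expterm x n)%R.
Proof.
  unfold expterm. rewrite fact_simpl, mult_INR. simpl pow. field.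
  split; [apply INR_fact_neq_0|apply Rgt_not_eq, INR_S_pos].
Qed.

Lemma is_series_shift0 (f : nat -> R) (l : R) :
  f O = 0%R -> is_series (fun n => f (S n)) l -> is_series f l.
Proof.
  intros H0 H. apply is_series_decr_1. unfold plus, opp; simpl. rewrite H0.
  replace (l + - 0)%R with l by ring. exact H.
Qed.

Lemma is_series_Rscal (k : R) (f : nat -> R) (l : R) :
  is_series f l -> is_series (fun n => k * f n)%R (k * l)%R.
Proof. exact (is_series_scal k f l). Qed.

Lemma is_series_Rplus (f g : nat -> R) (l m : R) :
  is_series f l -> is_series g m -> is_series (fun n => f n + g n)%R (l + m)%R.
Proof. exact (is_series_plus f g l m). Qed.

Lemma is_series_exp_moment1 (x : R) :
  is_series (fun n => expterm x n * INR n)%R (x * exp x)%R.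
Proof.
  apply is_series_shift0; [simpl; ring|].
  apply (is_series_ext (fun n => x * expterm x n)%R).
  - intro n. symmetry. apply expterm_S.
  - apply (is_series_Rscal x). apply is_series_exp.
Qed.

Lemma is_series_exp_moment2 (x : R) :
  is_series (fun n => expterm x n * INR n * (INR n - 1))%R (x * (x * exp x))%R.
Proof.
  apply is_series_shift0; [simpl; ring|].
  apply (is_series_ext (fun n => x * (expterm x n * INR n))%R).
  - intro n. rewrite expterm_S, S_INR. ring_simplify. apply Rmult_comm || reflexivity.
  - apply (is_series_Rscal x). apply is_series_exp_moment1.
Qed.

Lemma exp_variance (s : R) : exists K, (0 <= K) /\ forall x, (1 <= x) ->
  sum_le (fun n => expterm x n * ((INR n + s) / x - 1) ^ 2)%R (K * (exp x / x)).
Proof.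
  exists (1 + s ^ 2)%R. split; [nra|]. intros x Hx.
  assert (H : is_series (fun n => expterm x n * ((INR n + s) / x - 1) ^ 2)%R
    (/ x ^ 2 * (x * (x * exp x) + ((1 + 2 * s - 2 * x) * (x * exp x) + (s - x) ^ 2 * exp x)))%R).
  { apply (is_series_ext (fun n => / x ^ 2 * (expterm x n * INR n * (INR n - 1) +
      ((1 + 2 * s - 2 * x) * (expterm x n * INR n) + (s - x) ^ 2 * expterm x n)))%R).
    - intro n. field_simplify; [|lra|lra]. reflexivity.
    - apply (is_series_Rscal (/ x ^ 2)%R).
      apply (is_series_Rplus (fun n => expterm x n * INR n * (INR n - 1))%R); [apply is_series_exp_moment2|].
      apply (is_series_Rplus (fun n => (1 + 2 * s - 2 * x) * (expterm x n * INR n))%R).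
      + apply (is_series_Rscal (1 + 2 * s - 2 * x)%R), is_series_exp_moment1.
      + apply (is_series_Rscal ((s - x) ^ 2)%R), is_series_exp. }
  repeat split.
  - intro n. apply Rmult_le_pos; [apply expterm_pos; lra|]. apply pow2_ge_0.
  - eexists; exact H.
  - rewrite (is_series_unique _ _ H).
    replace (/ x ^ 2 * _)%R with (exp x / x * ((x + s ^ 2) / x))%R by (field; lra).
    rewrite (Rmult_comm (1 + s ^ 2)). apply Rmult_le_compat_l.
    + pos.
    + apply Rle_div_l; [lra|]. nra.
Qed.

(** A factor [n / x] is absorbed by the weight at the price of a shift of the
    index, whence the two free shifts in the statement. *)
Lemma exp_moment_pos (j : nat) : forall s s' : R, (0 <= s) ->
  exists K, (0 <= K) /\ forall x, (1 <= x) ->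
  sum_le (fun n => expterm x n * (((INR n + s) / x) ^ j * ((INR n + s') / x - 1) ^ 2))%R (K * (exp x / x)).
Proof.
  induction j as [|j IH]; intros s s' Hs.
  - destruct (exp_variance s') as [K [HK H]]. exists K. split; auto. intros x Hx.
    eapply sum_le_mono; [|now apply H]. intro n. simpl (_ ^ 0)%R. rewrite Rmult_1_l. split; [|lra].
    apply Rmult_le_pos; [apply expterm_pos; lra|apply pow2_ge_0].
  - destruct (IH (s + 1)%R (s' + 1)%R ltac:(lra)) as [K1 [HK1 H1]].
    destruct (IH s s' Hs) as [K2 [HK2 H2]].
    exists (K1 + s * K2)%R. split; [nra|]. intros x Hx.
    set (g := fun n => (((INR n + s) / x) ^ j * ((INR n + s') / x - 1) ^ 2)%R).
    assert (Hg : forall n, (0 <= g n)).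
    { intro n. apply Rmult_le_pos; [apply pow_le|apply pow2_ge_0].
      pose proof (pos_INR n). apply Rle_div_r; lra. }
    assert (A1 : sum_le (fun n => expterm x n * INR n / x * g n)%R (K1 * (exp x / x))).
    { apply sum_le_shift; [simpl; unfold Rdiv; ring|]. eapply sum_le_mono; [|apply (H1 x Hx)].
      intro n. cbv beta. rewrite expterm_S.
      replace (x * expterm x n / x * g (S n))%R with (expterm x n * g (S n))%R by (field; lra).
      split; [apply Rmult_le_pos; auto; apply expterm_pos; lra|].
      right. unfold g. rewrite S_INR.
      replace (INR n + 1 + s)%R with (INR n + (s + 1))%R by ring.
      replace (INR n + 1 + s')%R with (INR n + (s' + 1))%R by ring. reflexivity. }
    pose proof (sum_le_plus _ _ _ _ A1 (sum_le_scal s _ _ Hs (H2 x Hx))) as A.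
    replace ((K1 + s * K2) * (exp x / x))%R with (K1 * (exp x / x) + s * (K2 * (exp x / x)))%R by ring.
    eapply sum_le_mono; [|exact A]. intro n. cbv beta. fold (g n).
    pose proof (expterm_pos x n ltac:(lra)) as He. pose proof (pos_INR n) as Hn. specialize (Hg n).
    replace (((INR n + s) / x) ^ S j * ((INR n + s') / x - 1) ^ 2)%R
      with ((INR n + s) / x * g n)%R by (unfold g; simpl; ring).
    assert (0 <= expterm x n * g n)%R by nra.
    split.
    + apply Rmult_le_pos; auto. apply Rmult_le_pos; auto. apply Rle_div_r; lra.
    + replace (expterm x n * ((INR n + s) / x * g n))%R
        with (expterm x n * INR n / x * g n + s / x * (expterm x n * g n))%R by (field; lra).
      apply Rplus_le_compat_l. apply Rmult_le_compat_r; auto.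
      apply Rle_div_l; [lra|]. nra.
Qed.

(** The factor [x / (n + 1)] turns a weight into the next one. *)
Lemma exp_moment_neg (j : nat) : forall s : R,
  exists K, (0 <= K) /\ forall x, (1 <= x) ->
  sum_le (fun n => expterm x n * ((x / (INR n + 1)) ^ j * ((INR n + s) / x - 1) ^ 2))%R (K * (exp x / x)).
Proof.
  induction j as [|j IH]; intros s.
  - destruct (exp_variance s) as [K [HK H]]. exists K. split; auto. intros x Hx.
    eapply sum_le_mono; [|now apply H]. intro n. simpl (_ ^ 0)%R. rewrite Rmult_1_l. split; [|lra].
    apply Rmult_le_pos; [apply expterm_pos; lra|apply pow2_ge_0].
  - destruct (IH (s - 1)%R) as [K [HK H]].
    exists (2 ^ j * K)%R.
    assert (H2 : (0 <= 2 ^ j)%R) by pos.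
    split; [nra|]. intros x Hx. rewrite Rmult_assoc.
    pose proof (sum_le_unshift _ _ (sum_le_scal (2 ^ j) _ _ H2 (H x Hx))) as A.
    eapply sum_le_mono; [|exact A]. intro n. cbv beta. pose proof (pos_INR n) as Hn.
    pose proof (expterm_pos x n ltac:(lra)) as He.
    assert (Hq : (0 < x / (INR n + 1))%R) by pos.
    split.
    + apply Rmult_le_pos; auto. apply Rmult_le_pos; [apply pow_le; lra|apply pow2_ge_0].
    + assert (E : (expterm x n * (x / (INR n + 1)) = expterm x (S n))%R).
      { apply (Rmult_eq_reg_r (INR (S n))); [|apply Rgt_not_eq, INR_S_pos].
        rewrite expterm_S, S_INR. field. lra. }
      rewrite S_INR in *. replace (INR n + 1 + (s - 1))%R with (INR n + s)%R by ring.
      simpl ((x / (INR n + 1)) ^ S j)%R.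
      replace (expterm x n * (x / (INR n + 1) * (x / (INR n + 1)) ^ j * ((INR n + s) / x - 1) ^ 2))%R
        with (expterm x n * (x / (INR n + 1)) * ((x / (INR n + 1)) ^ j * ((INR n + s) / x - 1) ^ 2))%R by ring.
      rewrite E.
      replace (2 ^ j * (expterm x (S n) * ((x / (INR n + 1 + 1)) ^ j * ((INR n + s) / x - 1) ^ 2)))%R
        with (expterm x (S n) * ((2 ^ j * (x / (INR n + 1 + 1)) ^ j) * ((INR n + s) / x - 1) ^ 2))%R by ring.
      apply Rmult_le_compat_l; [apply expterm_pos; lra|]. apply Rmult_le_compat_r; [apply pow2_ge_0|].
      rewrite <- Rpow_mult_distr. apply pow_incr. split; [lra|].
      replace (2 * (x / (INR n + 1 + 1)))%R with (x * (2 / (INR n + 1 + 1)))%R by (field; lra).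
      apply Rmult_le_compat_l; [lra|]. apply Rle_div_r; [lra|].
      rewrite Rmult_comm. apply Rle_div_l; lra.
Qed.

Lemma Ctends_bounded (u : nat -> C) (l : C) : Ctends eventually u l ->
  exists K, (0 <= K) /\ forall n, (Cmod (u n) <= K).
Proof.
  intro H. destruct (Ctends_bound _ _ _ H) as [N HN].
  assert (Q : forall m, exists K, (0 <= K) /\ forall n, (n < m)%nat -> (Cmod (u n) <= K)).
  { induction m as [|m [K [HK IH]]].
    - exists 0%R. split; [lra|]. intros; lia.
    - exists (K + Cmod (u m))%R. pose proof (Cmod_ge_0 (u m)). split; [lra|].
      intros n Hn. destruct (Nat.eq_dec n m) as [->|Hne]; [lra|].
      specialize (IH n ltac:(lia)). lra. }
  destruct (Q N) as [K [HK HQ]]. exists (K + (Cmod l + 1))%R. pose proof (Cmod_ge_0 l).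
  split; [lra|]. intro n. destruct (le_lt_dec N n) as [Hn|Hn].
  - specialize (HN n Hn). lra.
  - specialize (HQ n Hn). lra.
Qed.

(** Gamma quotients converging to the constant in [A * n ^ (a - c)]. *)
Definition hlead (a c : C) (n : nat) : C := gauss a (pred n) / gauss c (pred n).

Lemma hcoef_hlead (a c : C) (n : nat) : ~ nonpos_int c -> (1 <= n)%nat ->
  hcoef a c n = hlead a c n * Cpower (INR n) (a - c).
Proof.
  intros Hc Hn. destruct n as [|n]; [lia|]. unfold hcoef, hlead, gauss. change (pred (S n)) with n.
  unfold Cminus. rewrite Cpower_plus, Cpower_opp.
  pose proof (INR_fact_neq_0_C n). pose proof (Cpower_neq_0 (INR (S n)) a).
  pose proof (Cpower_neq_0 (INR (S n)) c). pose proof (Cpoch_neq_0 c (S n) Hc). field. auto.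
Qed.

Lemma hlead_tends (a c : C) : ~ nonpos_int c ->
  Ctends eventually (hlead a c) (Gamma c * rGamma a).
Proof.
  intro Hc. assert (H : Ctends eventually (fun n => gauss a n * / gauss c n) (Gamma c * rGamma a)).
  { rewrite Cmult_comm. apply Ctends_mult; [typeclasses eauto|apply gauss_tends|].
    apply Ctends_inv; [typeclasses eauto|now apply rGamma_neq_0|apply gauss_tends]. }
  intros eps Heps. destruct (H eps Heps) as [N HN]. exists (S N). intros n Hn.
  apply HN. lia.
Qed.

Lemma ln_abs_le (t : R) : (Rabs (t - 1) <= 1 / 2)%R -> (Rabs (ln t) <= 2 * Rabs (t - 1))%R.
Proof.
  intro H. apply Rabs_le_between in H. assert (Ht : (0 < t)) by lra.
  assert (U : (ln t <= t - 1)%R).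
  { rewrite <- (ln_exp (t - 1)). apply ln_le; auto. pose proof (exp_ineq1_le (t - 1)). lra. }
  assert (L : (1 - / t <= ln t)%R).
  { pose proof (exp_ineq1_le (- ln t)) as E. rewrite exp_Ropp, exp_ln in E by auto. lra. }
  assert (L' : (- (2 * Rabs (t - 1)) <= 1 - / t)%R).
  { replace (1 - / t)%R with ((t - 1) / t)%R by (field; lra). apply Rle_div_r; auto.
    unfold Rabs. destruct (Rcase_abs (t - 1)); nra. }
  apply Rabs_le. split; [lra|]. pose proof (Rle_abs (t - 1)). lra.
Qed.

Lemma Cmod_Cexp_ln_le (e : C) (t : R) (J : nat) : (0 < t) -> (Rabs (Re e) <= INR J) ->
  (Cmod (Cexp (e * RtoC (ln t))) <= t ^ J + (/ t) ^ J)%R.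
Proof.
  intros Ht HJ. rewrite Cmod_Cexp.
  replace (Re (e * RtoC (ln t))) with (Re e * ln t)%R by (simpl; unfold Re; ring).
  rewrite <- (Rpower_pow J t), <- (Rpower_pow J (/ t)) by (auto; now apply Rinv_0_lt_compat).
  unfold Rpower. rewrite ln_Rinv by auto.
  pose proof (exp_pos (INR J * ln t)). pose proof (exp_pos (INR J * - ln t)).
  apply Rabs_le_between in HJ.
  destruct (Rle_dec 0 (ln t)) as [Hl|Hl].
  - assert (exp (Re e * ln t) <= exp (INR J * ln t))%R by (apply exp_le; nra). lra.
  - assert (exp (Re e * ln t) <= exp (INR J * - ln t))%R by (apply exp_le; nra). lra.
Qed.

(** The coefficients behave like [A * n ^ (a - c)], and the exponential weights
    concentrate near [n = x]: the factor [(n / x - 1) ^ 2] absorbs the terms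
    away from [x], whatever the polynomial growth of the coefficients. *)
Lemma hyp1F1_positive_axis (a c : C) : ~ nonpos_int c ->
  forall eps, (0 < eps) -> exists M, (1 <= M) /\ forall x, (M < x) ->
  (Cmod (Cexp (- x) * Cpower x (c - a) * hyp1F1 a c x - Gamma c * rGamma a) < eps)%R.
Proof.
  intros Hc eps Heps. set (A := Gamma c * rGamma a). set (e := a - c).
  pose proof (Cmod_ge_0 A) as HA0. pose proof (Cmod_ge_0 e) as He0.
  destruct (Ctends_bounded _ _ (hlead_tends a c Hc)) as [W [HW0 HW]].
  destruct (nfloor_ex (Rabs (Re e))) as [J0 [_ HJ0]]; [apply Rabs_pos|].
  set (J := S J0). assert (HJ : (Rabs (Re e) <= INR J)) by (unfold J; rewrite S_INR; lra). clearbody J.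
  destruct (exp_moment_pos J 0 0 (Rle_refl 0)) as [K1 [HK1 S1]].
  destruct (exp_moment_neg J 0) as [K2 [HK2 S2]].
  destruct (exp_variance 0) as [K3 [HK3 S3]].
  (* [J] bounds the exponent, and [2 ^ J] pays for [n + 1] in place of [n] in
     the negative power, which keeps the term [n = 0] meaningful *)
  set (C1 := (W * 2 ^ J + 1)%R).
  assert (H2J : (1 <= 2 ^ J)%R) by (apply pow_R1_Rle; lra).
  assert (HC1 : (1 <= C1)) by (unfold C1; nra).
  assert (Hq : forall x n, (1 <= x) ->
    (Cmod (hcoef a c n * Cexp (- e * RtoC (ln x))) <= C1 * ((INR n / x) ^ J + (x / (INR n + 1)) ^ J))%R).
  { intros x n Hx. pose proof (pos_INR n) as Hn0.
    assert (Hp1 : (0 <= (INR n / x) ^ J)%R) by (apply pow_le; apply Rle_div_r; lra).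
    assert (Hp2 : (0 <= (x / (INR n + 1)) ^ J)%R) by (apply pow_le; apply Rle_div_r; lra).
    destruct n as [|n].
    - rewrite hcoef_0, Cmult_1_l. simpl INR in *. replace (x / (0 + 1))%R with x in * by field.
      rewrite Cmod_Cexp. replace (Re (- e * RtoC (ln x))) with (- Re e * ln x)%R by (simpl; unfold Re; ring).
      assert (Hl : (0 <= ln x)) by (apply ln_ge_0; lra).
      apply Rabs_le_between in HJ.
      assert (exp (- Re e * ln x) <= x ^ J)%R.
      { rewrite <- (Rpower_pow J x) by lra. unfold Rpower. apply exp_le.
        apply Rmult_le_compat_r; [lra|]. lra. }
      nra.
    - assert (Hn : (0 < INR (S n))) by apply INR_S_pos.
      assert (Hn1 : (1 <= INR (S n))) by (rewrite S_INR; pose proof (pos_INR n); lra).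
      rewrite hcoef_hlead by (auto; lia). rewrite Cpower_pos_real by auto. fold e.
      rewrite <- Cmult_assoc, <- Cexp_plus.
      replace (e * RtoC (ln (INR (S n))) + - e * RtoC (ln x)) with (e * RtoC (ln (INR (S n) / x))).
      2: { rewrite ln_div by lra. rewrite RtoC_minus. ring. }
      assert (Ht : (0 < INR (S n) / x)%R) by pos.
      rewrite Cmod_mult. pose proof (Cmod_Cexp_ln_le e (INR (S n) / x) J Ht HJ) as B.
      assert (B' : ((/ (INR (S n) / x)) ^ J <= 2 ^ J * (x / (INR (S n) + 1)) ^ J)%R).
      { rewrite <- Rpow_mult_distr. apply pow_incr. split; [pos|].
        replace (/ (INR (S n) / x))%R with (x * / INR (S n))%R by (field; lra).
        replace (2 * (x / (INR (S n) + 1)))%R with (x * (2 / (INR (S n) + 1)))%R by (field; lra).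
        apply Rmult_le_compat_l; [lra|]. apply Rle_div_r; [lra|].
        rewrite Rmult_comm. apply Rle_div_l; lra. }
      specialize (HW (S n)).
      apply Rle_trans with (W * (2 ^ J * ((INR (S n) / x) ^ J + (x / (INR (S n) + 1)) ^ J)))%R.
      + apply Rmult_le_compat; auto using Cmod_ge_0. nra.
      + unfold C1. nra. }
  set (del := Rmin 1 (eps / (2 * (2 + Cmod A)))).
  assert (Hdel : (0 < del)) by (apply Rmin_pos; [lra|apply Rdiv_lt_0_compat; lra]).
  assert (Hdel1 : (del <= 1)) by apply Rmin_l.
  assert (Hdel2 : (del * (2 + Cmod A) <= eps / 2)%R).
  { apply Rle_trans with (eps / (2 * (2 + Cmod A)) * (2 + Cmod A))%R.
    - apply Rmult_le_compat_r; [lra|apply Rmin_r].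
    - right. field. lra. }
  set (eta := Rmin (1 / 2) (del / (2 * (Cmod e + 1) * exp (Cmod e)))).
  assert (Heta : (0 < eta)).
  { apply Rmin_pos; [lra|]. apply Rdiv_lt_0_compat; auto.
    pose proof (exp_pos (Cmod e)). nra. }
  assert (Hetaexp : forall t, (Rabs (t - 1) < eta)%R -> (Cmod (Cexp (e * RtoC (ln t)) - 1) <= del)%R).
  { intros t Ht.
    assert (Ht1 : (Rabs (t - 1) <= 1 / 2)%R) by (pose proof (Rmin_l (1 / 2) (del / (2 * (Cmod e + 1) * exp (Cmod e)))); fold eta in H; lra).
    pose proof (ln_abs_le t Ht1) as L.
    bound Cexp_sub_1_bound.
    rewrite Cmod_mult, Cmod_R.
    assert (E1 : (exp (Cmod e * Rabs (ln t)) <= exp (Cmod e))%R) by (apply exp_le; nra).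
    assert (E2 : (Cmod e * Rabs (ln t) <= 2 * (Cmod e + 1) * eta)%R).
    { apply Rle_trans with (Cmod e * (2 * eta))%R; [apply Rmult_le_compat_l; lra|nra]. }
    apply Rle_trans with (2 * (Cmod e + 1) * eta * exp (Cmod e))%R.
    - apply Rmult_le_compat; auto.
      + pos.
      + pos.
    - pose proof (exp_pos (Cmod e)).
      apply Rle_trans with (2 * (Cmod e + 1) * (del / (2 * (Cmod e + 1) * exp (Cmod e))) * exp (Cmod e))%R.
      + apply Rmult_le_compat_r; [lra|]. apply Rmult_le_compat_l; [lra|apply Rmin_r].
      + right. field. split; lra. }
  destruct (hlead_tends a c Hc del Hdel) as [N HN]. fold A in HN.
  set (C2 := (C1 + Cmod A)%R).
  assert (HC2 : (0 <= C2 / eta ^ 2)%R).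
  { apply Rmult_le_pos; [unfold C2; lra|]. left. apply Rinv_0_lt_compat. now apply pow_lt. }
  set (K := (C2 / eta ^ 2 * (K1 + (K2 + K3)))%R).
  exists (Rmax 1 (Rmax (2 * (INR N + 1)) (2 * K / eps))). split; [apply Rmax_l|].
  intros x Hx.
  apply Rmax_Rlt in Hx as [Hx1 Hx]. apply Rmax_Rlt in Hx as [HxN HxK].
  set (d := fun n => hcoef a c n * Cexp (- e * RtoC (ln x)) - A).
  assert (Hd : forall n, (Cmod (d n) <= eps / 2 + C2 / eta ^ 2 *
     ((INR n / x) ^ J * (INR n / x - 1) ^ 2 + ((x / (INR n + 1)) ^ J * (INR n / x - 1) ^ 2 + (INR n / x - 1) ^ 2)))%R).
  { intro n. pose proof (pos_INR n) as Hn0.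
    assert (Hp1 : (0 <= (INR n / x) ^ J)%R) by (apply pow_le; apply Rle_div_r; lra).
    assert (Hp2 : (0 <= (x / (INR n + 1)) ^ J)%R) by (apply pow_le; apply Rle_div_r; lra).
    pose proof (pow2_ge_0 (INR n / x - 1)) as Hsq.
    assert (Hpos : (0 <= C2 / eta ^ 2 *
     ((INR n / x) ^ J * (INR n / x - 1) ^ 2 + ((x / (INR n + 1)) ^ J * (INR n / x - 1) ^ 2 + (INR n / x - 1) ^ 2)))%R).
    { apply Rmult_le_pos; auto. nra. }
    destruct (Rlt_dec (Rabs (INR n / x - 1)) eta) as [Hc1|Hc1].
    - assert (Hhalf : (Rabs (INR n / x - 1) < 1 / 2)%R) by (eapply Rlt_le_trans; [exact Hc1|apply Rmin_l]).
      apply Rabs_lt_between in Hhalf.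
      assert (Hnx : (x / 2 < INR n)%R).
      { assert (1 / 2 < INR n / x)%R by lra. apply Rlt_div_r in H; lra. }
      assert (Hn : (N < n)%nat) by (apply INR_lt; lra).
      unfold d. rewrite hcoef_hlead by (auto; lia). rewrite Cpower_pos_real by lra. fold e.
      rewrite <- Cmult_assoc, <- Cexp_plus.
      replace (e * RtoC (ln (INR n)) + - e * RtoC (ln x)) with (e * RtoC (ln (INR n / x))).
      2: { rewrite ln_div by lra. rewrite RtoC_minus. ring. }
      specialize (Hetaexp _ Hc1). specialize (HN n ltac:(lia)).
      set (E := Cexp (e * RtoC (ln (INR n / x)))) in *.
      replace (hlead a c n * E - A) with ((hlead a c n - A) * (E - 1) + (hlead a c n - A) + A * (E - 1)) by ring.
      bound Cmod_triangle. rewrite Cmod_mult.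
      pose proof (Cmod_triangle ((hlead a c n - A) * (E - 1)) (hlead a c n - A)) as T.
      rewrite Cmod_mult in T.
      pose proof (Cmod_ge_0 (hlead a c n - A)). nra.
    - apply Rnot_lt_le in Hc1.
      assert (Hsq1 : (1 <= (INR n / x - 1) ^ 2 / eta ^ 2)%R).
      { apply Rle_div_r; [now apply pow_lt|]. rewrite Rmult_1_l, <- (pow2_abs (INR n / x - 1)).
        apply pow_incr. lra. }
      assert (B : (Cmod (d n) <= C2 * ((INR n / x) ^ J + (x / (INR n + 1)) ^ J + 1))%R).
      { unfold d. bound Cmod_triangle. rewrite Cmod_opp.
        pose proof (Hq x n ltac:(lra)). unfold C2. nra. }
      replace (C2 / eta ^ 2 * _)%R with
        (C2 * ((INR n / x) ^ J + (x / (INR n + 1)) ^ J + 1) * ((INR n / x - 1) ^ 2 / eta ^ 2))%R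
        by (field; lra).
      assert (0 <= C2 * ((INR n / x) ^ J + (x / (INR n + 1)) ^ J + 1))%R.
      { apply Rmult_le_pos; [unfold C2; lra|lra]. }
      nra. }
  assert (HS : sum_le (fun n => Cmod (d n * RtoC (expterm x n))) (eps / 2 * exp x + K * (exp x / x))).
  { assert (P : sum_le (fun n => eps / 2 * expterm x n)%R (eps / 2 * exp x)).
    { apply sum_le_scal; [lra|]. repeat split.
      - intro n. apply expterm_pos. lra.
      - eexists. apply is_series_exp.
      - right. apply is_series_unique, is_series_exp. }
    pose proof (sum_le_plus _ _ _ _ P (sum_le_scal _ _ _ HC2
      (sum_le_plus _ _ _ _ (S1 x ltac:(lra)) (sum_le_plus _ _ _ _ (S2 x ltac:(lra)) (S3 x ltac:(lra)))))) as Q.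
    replace (K * (exp x / x))%R with
      (C2 / eta ^ 2 * (K1 * (exp x / x) + (K2 * (exp x / x) + K3 * (exp x / x))))%R by (unfold K; ring).
    eapply sum_le_mono; [|exact Q]. intro n. split; [apply Cmod_ge_0|]. cbv beta.
    rewrite Cmod_mult, Cmod_R. pose proof (expterm_pos x n ltac:(lra)) as He. rewrite Rabs_pos_eq by auto.
    rewrite !Rplus_0_r. specialize (Hd n).
    eapply Rle_trans; [apply Rmult_le_compat_r; [exact He|exact Hd]|]. right. ring. }
  destruct HS as [_ [HSe HSb]].
  assert (HF : CSeries (fun n => d n * RtoC (expterm x n)) =
    Cexp (- e * RtoC (ln x)) * hyp1F1 a c x - A * RtoC (exp x)).
  { destruct (hcoef_bound a c Hc) as [B HB]. pose proof (egf_summable _ _ _ x HB) as Sh.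
    assert (Se : Csummable (fun n => RtoC (expterm x n))).
    { eapply Csummable_le; [|eexists; apply (is_series_exp x)]. intro n. rewrite Cmod_R, Rabs_pos_eq.
      - apply Rle_refl.
      - apply expterm_pos. lra. }
    assert (Ee : CSeries (fun n => RtoC (expterm x n)) = RtoC (exp x)).
    { unfold CSeries, RtoC. simpl. f_equal.
      - apply is_series_unique, is_series_exp.
      - replace 0%R with (0 * 0)%R by ring. rewrite Series_scal_l. ring. }
    rewrite (CSeries_ext _ (fun n => Cexp (- e * RtoC (ln x)) * (hcoef a c n * (x ^ n / INR (fact n)))
       + (- A) * RtoC (expterm x n))).
    - rewrite CSeries_plus, !CSeries_scal, Ee; auto using Csummable_scal. unfold hyp1F1, hcoef. ring.
    - intro n. unfold d, expterm. rewrite RtoC_div by apply INR_fact_neq_0. rewrite RtoC_pow. ring. }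
  assert (HF2 : Cexp (- x) * Cpower x (c - a) * hyp1F1 a c x - A =
     Cexp (- x) * CSeries (fun n => d n * RtoC (expterm x n))).
  { rewrite HF. rewrite Cpower_pos_real by lra. replace (c - a) with (- e) by (unfold e; ring).
    assert (E : Cexp (- x) * RtoC (exp x) = 1).
    { replace (RtoC (exp x)) with (Cexp x); [apply Cexp_opp_l|].
      unfold Cexp, RtoC; simpl. rewrite cos_0, sin_0. f_equal; ring. }
    replace (Cexp (- x) * (Cexp (- e * RtoC (ln x)) * hyp1F1 a c x - A * RtoC (exp x)))
     with (Cexp (- x) * Cexp (- e * RtoC (ln x)) * hyp1F1 a c x - A * (Cexp (- x) * RtoC (exp x))) by ring.
    rewrite E. ring. }
  rewrite HF2, Cmod_mult, Cmod_Cexp. simpl Re.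
  pose proof (exp_pos x) as Hex.
  assert (B : (Cmod (CSeries (fun n => d n * RtoC (expterm x n))%C) <= eps / 2 * exp x + K * (exp x / x))%R).
  { eapply Rle_trans; [apply Cmod_CSeries_le; exact HSe|exact HSb]. }
  apply Rle_lt_trans with (exp (- x) * (eps / 2 * exp x + K * (exp x / x)))%R.
  - apply Rmult_le_compat_l; [pos|exact B].
  - replace (exp (- x) * (eps / 2 * exp x + K * (exp x / x)))%R with (eps / 2 + K / x)%R.
    + assert (K / x < eps / 2)%R; [|lra]. apply Rlt_div_l; [lra|].
      apply Rlt_div_l in HxK; lra.
    + rewrite exp_Ropp. field. split; lra.
Qed.

(** * Kummer's function where its exponential part dominates *)

(** [kU] is Kummer's function divided by its exponential leading term, [kU1]
    its derivative, and [kE] the integrating factor that turns Kummer's equation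
    into [(kE * kU1)' = - (c - a) * (1 - a) * kE * kU / z ^ 2]. The derivative of
    [kP = kU + kU1] is a combination of [kU1 / z] and [kU / z ^ 2], one power of
    [z] better than that of [kU]: the oscillation of [kE] is thereby accounted for
    without cancellation between integrals. *)
Definition kU (a c z : C) : C := Cexp (- z) * Cpower z (c - a) * hyp1F1 a c z.

Definition kU1 (a c z : C) : C := Cexp (- z) *
  (Cpower z (c - a) * (hyp1F1' a c z - hyp1F1 a c z)
   + (c - a) * Cpower z (c - a - 1) * hyp1F1 a c z).

Definition kP (a c z : C) : C := Cexp (- z) *
  (Cpower z (c - a) * hyp1F1' a c z + (c - a) * Cpower z (c - a - 1) * hyp1F1 a c z).

(** This is [kE * kU1], in a form that can be differentiated termwise. *)
Definition kQ (a c z : C) : C :=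
  Cpower z a * (hyp1F1' a c z - hyp1F1 a c z) + (c - a) * Cpower z (a - 1) * hyp1F1 a c z.

Definition kE (a c z : C) : C := Cexp z * Cpower z (2 * a - c).

Lemma kP_eq (a c z : C) : kP a c z = kU a c z + kU1 a c z.
Proof. unfold kP, kU, kU1. ring. Qed.

Lemma kE_kU1 (a c z : C) : kE a c z * kU1 a c z = kQ a c z.
Proof.
  unfold kE, kU1, kQ.
  replace (Cpower z a) with (Cpower z (2 * a - c) * Cpower z (c - a)) by (rewrite <- Cpower_plus; f_equal; ring).
  replace (Cpower z (a - 1)) with (Cpower z (2 * a - c) * Cpower z (c - a - 1)) by (rewrite <- Cpower_plus; f_equal; ring).
  pose proof (Cexp_opp_l z) as H.
  transitivity ((Cexp (- z) * Cexp z) * (Cpower z (2 * a - c) * (Cpower z (c - a) * (hyp1F1' a c z - hyp1F1 a c z)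
   + (c - a) * Cpower z (c - a - 1) * hyp1F1 a c z))); [ring|]. rewrite H. ring.
Qed.

Lemma Cder_hyp1F1 (a c : C) (z : R -> C) (t : R) (z' : C) : ~ nonpos_int c -> Cder z t z' ->
  Cder (fun s => hyp1F1 a c (z s)) t (hyp1F1' a c (z t) * z').
Proof.
  intros Hc Hz. destruct (hcoef_bound a c Hc) as [B HB]. exact (Cder_egf _ _ _ z t z' HB Hz).
Qed.

Lemma Cder_hyp1F1' (a c : C) (z : R -> C) (t : R) (z' : C) : ~ nonpos_int c -> Cder z t z' ->
  Cder (fun s => hyp1F1' a c (z s)) t (hyp1F1'' a c (z t) * z').
Proof.
  intros Hc Hz. destruct (hcoef_bound a c Hc) as [B HB].
  exact (Cder_egf _ _ _ z t z' (geom_bound_shift _ _ _ HB) Hz).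
Qed.

Lemma Cpower_2_step (z w : C) : z <> 0 ->
  Cpower z (w - 1) = z * Cpower z (w - 1 - 1) /\ Cpower z w = z * (z * Cpower z (w - 1 - 1)).
Proof.
  intro Hz.
  assert (E : forall v, Cpower z v = z * Cpower z (v - 1)).
  { intro v. rewrite <- Cpower_succ by auto. f_equal. ring. }
  split; [apply E|]. rewrite <- (E (w - 1)). apply E.
Qed.

Lemma Cder_kQ (a c : C) (z : R -> C) (t : R) (z' : C) : ~ nonpos_int c -> Cder z t z' -> slit (z t) ->
  Cder (fun s => kQ a c (z s)) t
    (- ((c - a) * (1 - a)) * (kE a c (z t) * kU a c (z t) / (z t * z t)) * z').
Proof.
  intros Hc Hz Hs. pose proof (slit_neq_0 _ Hs) as Hn.
  pose proof (Cder_hyp1F1 a c z t z' Hc Hz) as H0.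
  pose proof (Cder_hyp1F1' a c z t z' Hc Hz) as H1.
  unfold kQ. eapply Cder_eq.
  - apply Cder_plus; apply Cder_mult; [| |apply Cder_scal|].
    + apply Cder_Cpower; eassumption.
    + apply Cder_minus; eassumption.
    + apply Cder_Cpower; eassumption.
    + eassumption.
  - cbv beta. pose proof (kummer_ode a c (z t) Hc) as Ho. unfold kE, kU.
    revert Hn Ho. generalize (z t). clear. intros x Hn Ho.
    destruct (Cpower_2_step x a Hn) as [E1 E2]. rewrite E1, E2.
    assert (E3 : Cpower x (2 * a - c) * Cpower x (c - a) = x * (x * Cpower x (a - 1 - 1))).
    { rewrite <- Cpower_plus, <- E2. f_equal. ring. }
    pose proof (Cexp_opp_l x) as H. set (w := Cpower x (a - 1 - 1)) in *.
    replace (Cexp x * Cpower x (2 * a - c) * (Cexp (- x) * Cpower x (c - a) * hyp1F1 a c x))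
      with ((Cexp (- x) * Cexp x) * (Cpower x (2 * a - c) * Cpower x (c - a)) * hyp1F1 a c x) by ring.
    rewrite H, E3. set (F2 := hyp1F1'' a c x) in *.
    replace (x * (x * w) * (F2 * z' - hyp1F1' a c x * z'))
      with (x * w * z' * (x * F2) - x * (x * w) * hyp1F1' a c x * z') by ring.
    rewrite Ho. field. auto.
Qed.

Lemma Cder_kP (a c : C) (z : R -> C) (t : R) (z' : C) : ~ nonpos_int c -> Cder z t z' -> slit (z t) ->
  Cder (fun s => kP a c (z s)) t
    ((- (2 * a - c) * (kU1 a c (z t) / z t) - (c - a) * (1 - a) * (kU a c (z t) / (z t * z t))) * z').
Proof.
  intros Hc Hz Hs. pose proof (slit_neq_0 _ Hs) as Hn.
  pose proof (Cder_hyp1F1 a c z t z' Hc Hz) as H0.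
  pose proof (Cder_hyp1F1' a c z t z' Hc Hz) as H1.
  unfold kP. eapply Cder_eq.
  - apply Cder_mult; [apply Cder_Cexp, Cder_opp; eassumption|].
    apply Cder_plus; apply Cder_mult; [| |apply Cder_scal|].
    + apply Cder_Cpower; eassumption.
    + eassumption.
    + apply Cder_Cpower; eassumption.
    + eassumption.
  - cbv beta. pose proof (kummer_ode a c (z t) Hc) as Ho. unfold kU, kU1.
    revert Hn Ho. generalize (z t). clear. intros x Hn Ho. set (d := c - a) in *.
    destruct (Cpower_2_step x d Hn) as [E1 E2]. rewrite E1, E2. set (w := Cpower x (d - 1 - 1)) in *.
    set (F2 := hyp1F1'' a c x) in *. set (F1 := hyp1F1' a c x) in *. set (F := hyp1F1 a c x) in *.
    assert (Ec : c = a + d) by (unfold d; ring).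
    replace (x * (x * w) * (F2 * z')) with (x * w * z' * (x * F2)) by ring.
    rewrite Ho, Ec. field. auto.
Qed.

Lemma Rpower_ratio_bound (r k : R) : (/ 2 <= r <= 2)%R ->
  (exp (- (Rabs k * ln 2)) <= Rpower r k <= exp (Rabs k * ln 2))%R.
Proof.
  intro Hr. unfold Rpower.
  assert (L : (- ln 2 <= ln r <= ln 2)%R).
  { split; [rewrite <- ln_Rinv by lra|]; apply ln_le; lra. }
  assert (Rabs (k * ln r) <= Rabs k * ln 2)%R.
  { rewrite Rabs_mult. apply Rmult_le_compat_l; [apply Rabs_pos|]. apply Rabs_le. lra. }
  apply Rabs_le_between in H. split; apply exp_le; lra.
Qed.

Lemma ln_le_self (s : R) : (1 <= s) -> (0 <= ln s <= s).
Proof.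
  intro Hs. split; [now apply ln_ge_0|].
  pose proof (exp_ineq1_le (ln s)) as H. rewrite exp_ln in H by lra. lra.
Qed.

(** The curve joining a point of bounded modulus to a distant one; with
    [p0 = 2 - Re (2 a - c)] the modulus of [kE] grows along it like
    [exp (s * Re om) * s ^ 2]. *)
Definition log_path (om : C) (p0 s : R) : C := om * RtoC s + RtoC (p0 * ln s).

Lemma Cder_log_path (om : C) (p0 s : R) : (0 < s) ->
  Cder (log_path om p0) s (om + RtoC (p0 / s)).
Proof.
  intro Hs. unfold log_path. apply Cder_plus.
  - eapply Cder_eq; [apply Cder_scal, Cder_id|ring].
  - apply Cder_real. apply is_derive_scal. now apply is_derive_ln.
Qed.

Lemma log_path_mod (om : C) (p0 R0 s : R) : (4 * Rabs p0 <= R0)%R ->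
  (3 / 4 * R0 <= Cmod om <= 5 / 4 * R0)%R -> (1 <= s) ->
  (R0 * s / 2 <= Cmod (log_path om p0 s) <= 2 * (R0 * s))%R.
Proof.
  intros Hp Hom Hs. unfold log_path. destruct (ln_le_self s Hs) as [L0 L1].
  pose proof (Cmod_triangle (om * RtoC s) (RtoC (p0 * ln s))) as T1.
  pose proof (Cmod_triangle_minus (om * RtoC s) (RtoC (p0 * ln s))) as T2.
  rewrite !Cmod_mult, !Cmod_R in T1, T2. rewrite (Rabs_pos_eq s) in T1, T2 by lra.
  rewrite Rabs_mult, (Rabs_pos_eq (ln s)) in T1, T2 by lra.
  pose proof (Rabs_pos p0).
  nra.
Qed.

Lemma log_path_slit (om : C) (p0 R0 s : R) : (4 * Rabs p0 <= R0)%R -> (0 < R0) ->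
  (3 / 4 * R0 <= Cmod om <= 5 / 4 * R0)%R -> (0 <= Re om) -> (1 <= s) ->
  slit (log_path om p0 s).
Proof.
  intros Hp HR Hom Hre Hs. destruct (Req_dec (Im om) 0) as [E|E].
  - left. pose proof (Cmod_le_re_im om) as H. rewrite E, Rabs_R0, Rabs_pos_eq in H by auto.
    unfold log_path. destruct om as [x y]. simpl in *.
    destruct (ln_le_self s Hs) as [L0 L1]. pose proof (Rabs_pos p0).
    pose proof (Rmult_Rabs_bounds p0 (ln s) L0). nra.
  - right. unfold log_path. destruct om as [x y]. simpl in *.
    intro H. apply E. nra.
Qed.

(** [p0] is chosen so that [s ^ p0 * |z| ^ k], with [|z|] comparable to
    [R0 * s], is a constant times [s ^ 2]. *)
Lemma kE_along_log_path (a c om : C) (R0 : R) :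
  let p0 := (2 - Re (2 * a - c))%R in
  let k := Re (2 * a - c) in
  let c2 := exp (Rabs k * ln 2 + Rabs (Im (2 * a - c)) * PI) in
  (4 * Rabs p0 <= R0)%R -> (0 < R0) ->
  (3 / 4 * R0 <= Cmod om <= 5 / 4 * R0)%R -> forall s, (1 <= s) ->
  (Rpower R0 k * (exp (Re om * s) * s ^ 2) / c2 <= Cmod (kE a c (log_path om p0 s))
    <= c2 * (Rpower R0 k * (exp (Re om * s) * s ^ 2)))%R.
Proof.
  intros p0 k c2 Hp HR Hom s Hs.
  pose proof (log_path_mod om p0 R0 s Hp Hom Hs) as Hm.
  unfold kE. rewrite Cmod_mult, Cmod_Cexp.
  pose proof (Cmod_Cpower_le (log_path om p0 s) (2 * a - c)) as Hle.
  pose proof (Cmod_Cpower_ge (log_path om p0 s) (2 * a - c)) as Hge. fold k in Hle, Hge.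
  assert (Ere : exp (Re (log_path om p0 s)) = (exp (Re om * s) * (s ^ 2 * / Rpower s k))%R).
  { replace (Re (log_path om p0 s)) with (Re om * s + p0 * ln s)%R
      by (unfold log_path; destruct om; simpl; ring).
    rewrite exp_plus. f_equal. rewrite <- (Rpower_pow 2 s), <- Rpower_Ropp, <- Rpower_plus by lra.
    unfold Rpower, p0. fold k. reflexivity. }
  set (z := log_path om p0 s) in *.
  set (r := (Cmod z / (R0 * s))%R).
  assert (HRs : (0 < R0 * s)%R) by nra.
  assert (Hr : (/ 2 <= r <= 2)%R).
  { unfold r. split; [apply Rle_div_r|apply Rle_div_l]; lra. }
  assert (Ez : Rpower (Cmod z) k = (Rpower R0 k * Rpower s k * Rpower r k)%R).
  { rewrite !Rpower_mult_distr; try lra. f_equal. unfold r. field. lra. }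
  destruct (Rpower_ratio_bound r k Hr) as [B1 B2].
  assert (Hs0 : (0 < Rpower s k)) by apply exp_pos.
  assert (HR0 : (0 < Rpower R0 k)) by apply exp_pos.
  set (I := (Rabs (Im (2 * a - c)) * PI)%R) in *.
  assert (Ec : c2 = (exp (Rabs k * ln 2) * exp I)%R) by (unfold c2; apply exp_plus).
  assert (Eci : (/ c2 = exp (- (Rabs k * ln 2)) * exp (- I))%R).
  { rewrite Ec, !exp_Ropp. field. split; apply Rgt_not_eq, exp_pos. }
  rewrite Ere. rewrite Ez in Hle, Hge.
  set (m := (exp (Re om * s) * s ^ 2)%R) in *.
  assert (Hm0 : (0 < m)) by (unfold m; pos).
  assert (Em : forall P, (exp (Re om * s) * (s ^ 2 * / Rpower s k) * P = m * (/ Rpower s k * P))%R)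
    by (intro; unfold m; ring).
  rewrite Em. split.
  - unfold Rdiv. rewrite Eci.
    replace (Rpower R0 k * m * (exp (- (Rabs k * ln 2)) * exp (- I)))%R
      with (m * (/ Rpower s k * (Rpower R0 k * Rpower s k * exp (- (Rabs k * ln 2)) * exp (- I))))%R
      by (field; lra).
    apply Rmult_le_compat_l; [lra|]. apply Rmult_le_compat_l; [pos|].
    eapply Rle_trans; [|exact Hge]. apply Rmult_le_compat_r; [pos|].
    apply Rmult_le_compat_l; [nra|exact B1].
  - rewrite Ec.
    replace (exp (Rabs k * ln 2) * exp I * (Rpower R0 k * m))%R
      with (m * (/ Rpower s k * (Rpower R0 k * Rpower s k * exp (Rabs k * ln 2) * exp I)))%R
      by (field; lra).
    apply Rmult_le_compat_l; [lra|]. apply Rmult_le_compat_l; [pos|].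
    eapply Rle_trans; [exact Hle|]. apply Rmult_le_compat_r; [pos|].
    apply Rmult_le_compat_l; [nra|exact B2].
Qed.

Lemma continuity_pt_Cmod (f : R -> C) (t : R) (l : C) : Cder f t l ->
  continuity_pt (fun s => Cmod (f s)) t.
Proof.
  intros [H1 H2].
  assert (Q : forall (g : R -> R) l, is_derive g t l -> continuity_pt g t).
  { intros g l0 H. apply continuity_pt_filterlim.
    apply (ex_derive_continuous (V := R_NormedModule)). now exists l0. }
  apply (continuity_pt_ext (fun s => sqrt (Re (f s) * Re (f s) + Im (f s) * Im (f s)))).
  { intro s. unfold Cmod. f_equal. simpl. unfold Re, Im. ring. }
  apply (continuity_pt_comp (fun s => Re (f s) * Re (f s) + Im (f s) * Im (f s))%R sqrt).
  - eapply Q. apply (is_derive_plus (fun s => Re (f s) * Re (f s))%R); apply is_derive_Rmult; eassumption.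
  - apply continuity_pt_sqrt. nra.
Qed.

Definition bounded_on (D : C -> Prop) (f : C -> C) : Prop :=
  exists K, (0 <= K) /\ forall z, D z -> (Cmod (f z) <= K).

Lemma bounded_on_plus D f g : bounded_on D f -> bounded_on D g -> bounded_on D (fun z => f z + g z).
Proof.
  intros [K [HK H]] [L [HL H']]. exists (K + L)%R. split; [lra|]. intros z Hz.
  bound Cmod_triangle. specialize (H z Hz). specialize (H' z Hz). lra.
Qed.

Lemma bounded_on_mult D f g : bounded_on D f -> bounded_on D g -> bounded_on D (fun z => f z * g z).
Proof.
  intros [K [HK H]] [L [HL H']]. exists (K * L)%R. split; [nra|]. intros z Hz.
  rewrite Cmod_mult. apply Rmult_le_compat; auto using Cmod_ge_0.
Qed.

Lemma bounded_on_const D k : bounded_on D (fun _ => k).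
Proof. exists (Cmod k). split; [apply Cmod_ge_0|]. intros; lra. Qed.

Definition annulus (r : R) (z : C) : Prop := (1 <= Cmod z <= r).

Lemma bounded_on_Cpower r w : bounded_on (annulus r) (fun z => Cpower z w).
Proof.
  exists (exp (Rabs (Re w) * ln r) * exp (Rabs (Im w) * PI))%R. split.
  - pos.
  - intros z [H1 H2]. bound Cmod_Cpower_le.
    apply Rmult_le_compat_r; [pos|]. unfold Rpower. apply exp_le.
    assert (L0 : (0 <= ln (Cmod z))) by now apply ln_ge_0.
    assert (L1 : (ln (Cmod z) <= ln r)) by (apply ln_le; lra).
    pose proof (Rle_abs (Re w)). pose proof (Rabs_pos (Re w)). nra.
Qed.

Lemma bounded_on_Cexp_opp r : bounded_on (annulus r) (fun z => Cexp (- z)).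
Proof.
  exists (exp r). split; [pos|]. intros z [_ H2]. rewrite Cmod_Cexp. apply exp_le.
  bound Rle_abs. bound re_le_Cmod. now rewrite Cmod_opp.
Qed.

Lemma bounded_on_egf r q A B : geom_bound q A B -> bounded_on (annulus r) (egf q).
Proof.
  intro H. assert (H' := H). destruct H' as [HA [HB _]].
  exists (A * exp (B * r))%R. split.
  - pos.
  - intros z [_ H2]. eapply Rle_trans; [now apply (egf_bound q A B)|].
    apply Rmult_le_compat_l; auto. apply exp_le. now apply Rmult_le_compat_l.
Qed.

Lemma kU_kU1_bounded (a c : C) (r : R) : ~ nonpos_int c ->
  bounded_on (annulus r) (kU a c) /\ bounded_on (annulus r) (kU1 a c).
Proof.
  intro Hc. destruct (hcoef_bound a c Hc) as [B H0].
  pose proof (bounded_on_egf r _ _ _ H0) as F0.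
  pose proof (bounded_on_egf r _ _ _ (geom_bound_shift _ _ _ H0)) as F1.
  assert (F0m : bounded_on (annulus r) (fun z => - hyp1F1 a c z)).
  { destruct F0 as [K [HK F0]]. exists K. split; auto. intros z Hz. rewrite Cmod_opp. now apply F0. }
  split.
  - apply bounded_on_mult; [apply bounded_on_mult|exact F0].
    + apply bounded_on_Cexp_opp.
    + apply bounded_on_Cpower.
  - apply bounded_on_mult; [apply bounded_on_Cexp_opp|].
    apply bounded_on_plus; apply bounded_on_mult.
    + apply bounded_on_Cpower.
    + apply (bounded_on_plus _ _ _ F1 F0m).
    + apply bounded_on_mult; [apply bounded_on_const|apply bounded_on_Cpower].
    + exact F0.
Qed.

(** A bootstrap along the path: [kE * kU1] has derivative [kE * kU / z ^ 2] up
    to a constant, so the growth of [kE] gives [kU1 = O(1 / s)]; then the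
    derivative of [kP = kU + kU1] is integrable, and the maximum of [kU] is
    bounded by a constant plus a fraction of itself once [R0] is large. *)
Lemma log_path_bound (a c : C) : ~ nonpos_int c ->
  let p0 := (2 - Re (2 * a - c))%R in
  exists R0 K, (1 <= R0) /\ (4 * Rabs p0 <= R0)%R /\ (0 <= K) /\
  forall om T, (0 <= Re om) -> (3 / 4 * R0 <= Cmod om <= 5 / 4 * R0)%R -> (1 <= T) ->
  (Cmod (kU a c (log_path om p0 T)) <= K) /\ (Cmod (kU1 a c (log_path om p0 T)) <= K / T)%R.
Proof.
  intros Hc p0.
  set (k := Re (2 * a - c)).
  set (c2 := exp (Rabs k * ln 2 + Rabs (Im (2 * a - c)) * PI)).
  set (lam := Cmod ((c - a) * (1 - a))). set (kap := Cmod (2 * a - c)).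
  assert (Hlam : (0 <= lam)) by apply Cmod_ge_0.
  assert (Hkap : (0 <= kap)) by apply Cmod_ge_0.
  assert (Hc2 : (0 < c2)) by apply exp_pos.
  set (al := ((3 * kap + 1) * (c2 * c2))%R).
  assert (Hal : (0 <= al)) by (unfold al; nra).
  set (R0 := (4 + 4 * Rabs p0 + 12 * lam * (al + 1))%R).
  assert (HR4 : (4 <= R0)).
  { unfold R0. pose proof (Rabs_pos p0). nra. }
  assert (HRp : (4 * Rabs p0 <= R0)%R).
  { unfold R0. nra. }
  assert (HRl : (12 * lam * (al + 1) <= R0)%R) by (unfold R0; pose proof (Rabs_pos p0); nra).
  destruct (kU_kU1_bounded a c (2 * R0) Hc) as [[C0 [HC0 B0]] [C1 [HC1 B1]]].
  set (CC := (C0 + C1)%R).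
  set (K := (4 * CC + 2 * al * CC)%R).
  set (K' := (c2 * c2 * CC + 6 * lam * (c2 * c2) / R0 * K)%R).
  assert (HCC : (0 <= CC)) by (unfold CC; lra).
  assert (HK : (0 <= K)) by (unfold K; nra).
  assert (HlR : (0 <= 6 * lam * (c2 * c2) / R0)%R).
  { apply Rmult_le_pos; [nra|pos]. }
  assert (HK' : (0 <= K')) by (unfold K'; nra).
  assert (Main : forall om T, (0 <= Re om) -> (3 / 4 * R0 <= Cmod om <= 5 / 4 * R0)%R -> (1 <= T) ->
    (Cmod (kU a c (log_path om p0 T)) <= K) /\ (Cmod (kU1 a c (log_path om p0 T)) <= K' / T)%R).
  { intros om T Hre Hom HT.
    set (z := log_path om p0). set (z' := fun s => om + RtoC (p0 / s)).
    assert (Hz' : forall s, (1 <= s) -> Cder z s (z' s)) by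
      (intros s Hs; apply Cder_log_path; lra).
    assert (Bz' : forall s, (1 <= s) -> (Cmod (z' s) <= 3 / 2 * R0)%R).
    { intros s Hs. bound Cmod_triangle. rewrite Cmod_R.
      assert (Rabs (p0 / s) <= R0 / 4)%R; [|lra].
      unfold Rdiv at 1. rewrite Rabs_mult, (Rabs_pos_eq (/ s)) by (pos).
      apply Rle_div_l; [lra|]. nra. }
    assert (Hslit : forall s, (1 <= s) -> slit (z s)) by
      (intros s Hs; apply (log_path_slit om p0 R0 s); auto; lra).
    assert (Hmod : forall s, (1 <= s) -> (R0 * s / 2 <= Cmod (z s) <= 2 * (R0 * s))%R) by
      (intros s Hs; now apply log_path_mod).
    assert (Hq1 : forall s, 1 <= s -> (Cmod (z' s / z s) <= 3 / s)%R).
    { intros s Hs. pose proof (Hmod s Hs). specialize (Bz' s Hs). assert (Hs0 : (0 < R0 * s / 2)%R) by nra.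
      rewrite Cmod_div by (apply Cmod_gt_0; lra).
      apply Rle_trans with (3 / 2 * R0 * / (R0 * s / 2))%R; [|right; field; lra].
      apply Rmult_le_compat; auto using Cmod_ge_0; [pos|]. apply Rinv_le_contravar; lra. }
    assert (Hq2 : forall s, 1 <= s -> (Cmod (z' s / (z s * z s)) <= 6 / (R0 * s ^ 2))%R).
    { intros s Hs. pose proof (Hmod s Hs). assert (Hs0 : (0 < R0 * s / 2)%R) by nra.
      assert (Hzn : z s <> 0) by (apply Cmod_gt_0; lra).
      replace (z' s / (z s * z s)) with (z' s / z s * / z s) by (field; auto).
      rewrite Cmod_mult, Cmod_inv by auto.
      apply Rle_trans with (3 / s * / (R0 * s / 2))%R; [|right; field; lra].
      apply Rmult_le_compat; auto using Cmod_ge_0; [pos|]. apply Rinv_le_contravar; lra. }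
    assert (Hz1 : z 1%R = om) by (unfold z, log_path; rewrite ln_1, Rmult_0_r; ring).
    assert (HU0 : (Cmod (kU a c om) <= CC)).
    { eapply Rle_trans; [apply B0; split; lra|unfold CC; lra]. }
    assert (HU1 : (Cmod (kU1 a c om) <= CC)).
    { eapply Rle_trans; [apply B1; split; lra|unfold CC; lra]. }
    assert (Hcont : forall s, (1 <= s <= T) -> continuity_pt (fun s => Cmod (kU a c (z s))) s).
    { intros s Hs. eapply continuity_pt_Cmod. unfold kU. apply Cder_mult.
      - apply Cder_mult.
        + apply Cder_Cexp, Cder_opp, Hz'. lra.
        + apply Cder_Cpower; [apply Hz'; lra|apply Hslit; lra].
      - apply Cder_hyp1F1; [exact Hc|apply Hz'; lra]. }
    destruct (continuity_ab_maj (fun s => Cmod (kU a c (z s))) 1 T HT Hcont) as [sm [Hsm Hsm1]].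
    set (Um := Cmod (kU a c (z sm))) in *.
    assert (HUm : (0 <= Um)) by apply Cmod_ge_0.
    set (Rk := Rpower R0 k). assert (HRk : (0 < Rk)) by apply exp_pos.
    set (sg := Re om) in *.
    set (X := (c2 * c2 * CC + 6 * lam * (c2 * c2) / R0 * Um)%R).
    assert (HX : (0 <= X)) by (unfold X; nra).
    assert (HE : forall s, (1 <= s) -> (Rk * (exp (sg * s) * s ^ 2) / c2 <= Cmod (kE a c (z s))
      <= c2 * (Rk * (exp (sg * s) * s ^ 2)))%R).
    { intros s Hs. apply (kE_along_log_path a c om R0 HRp); auto; lra. }
    assert (Step1 : forall t, (1 <= t <= T) -> (Cmod (kU1 a c (z t)) <= X / t)%R).
    { intros t Ht. set (G := (6 * lam * c2 * Rk / R0 * Um)%R).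
      assert (HG : (0 <= G)).
      { unfold G. repeat apply Rmult_le_pos; try lra. pos. }
      pose proof (Cmod_increment_le (fun s => kQ a c (z s))
        (fun s => - ((c - a) * (1 - a)) * (kE a c (z s) * kU a c (z s) / (z s * z s)) * z' s)
        (fun s => G * (exp (sg * s) * s))%R (fun s => G * (sg * exp (sg * s) * s + exp (sg * s) * 1))%R 1 t) as I.
      cbv beta in I.
      assert (I' : (Cmod (kQ a c (z t) - kQ a c (z 1%R)) <= G * (exp (sg * t) * t) - G * (exp (sg * 1) * 1))%R).
      { apply I; [lra| | |].
        - intros s Hs. apply Cder_kQ; [exact Hc|apply Hz'; lra|apply Hslit; lra].
        - intros s Hs. apply is_derive_scal.
          assert (De : is_derive (fun s => sg * s)%R s (sg * 1)%R)
            by exact (is_derive_scal (fun s => s) s sg 1%R (is_derive_Rid s)).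
          eapply is_derive_eq.
          + exact (is_derive_Rmult _ _ _ _ _ (is_derive_Rcomp exp _ _ _ _ (is_derive_exp _) De) (is_derive_Rid s)).
          + simpl. ring.
        - intros s Hs. destruct (HE s ltac:(lra)) as [_ E2]. specialize (Hq2 s ltac:(lra)).
          replace (_ * z' s) with (- ((c - a) * (1 - a)) * (kE a c (z s) * kU a c (z s)) * (z' s / (z s * z s)))
            by (unfold Cdiv; ring).
          rewrite Cmod_mult, (Cmod_mult (- _)), Cmod_opp. fold lam. rewrite (Cmod_mult (kE a c (z s))).
          apply Rle_trans with (lam * (c2 * (Rk * (exp (sg * s) * s ^ 2)) * Um) * (6 / (R0 * s ^ 2)))%R.
          + apply Rmult_le_compat; auto using Cmod_ge_0; [pos|].
            apply Rmult_le_compat_l; auto. apply Rmult_le_compat; auto using Cmod_ge_0. apply Hsm. lra.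
          + replace (lam * (c2 * (Rk * (exp (sg * s) * s ^ 2)) * Um) * (6 / (R0 * s ^ 2)))%R
              with (G * exp (sg * s))%R by (unfold G; field; split; lra).
            apply Rmult_le_compat_l; auto.
            assert (0 <= sg * exp (sg * s) * s)%R by pos. lra. }
      rewrite Hz1 in I'. clear I.
      assert (HQ : (Cmod (kE a c (z t)) * Cmod (kU1 a c (z t)) <= c2 * (Rk * (exp sg * 1)) * CC + G * (exp (sg * t) * t))%R).
      { rewrite <- Cmod_mult, kE_kU1.
        replace (kQ a c (z t)) with (kQ a c (z t) - kQ a c om + kQ a c om) by ring.
        bound Cmod_triangle.
        assert (Q1 : (Cmod (kQ a c om) <= c2 * (Rk * (exp sg * 1)) * CC)%R).
        { rewrite <- kE_kU1, Cmod_mult. apply Rmult_le_compat; auto using Cmod_ge_0.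
          destruct (HE 1%R (Rle_refl _)) as [_ E2]. rewrite Hz1 in E2.
          replace (exp sg * 1)%R with (exp (sg * 1) * 1 ^ 2)%R; [exact E2|]. rewrite Rmult_1_r. ring. }
        assert (0 <= G * (exp (sg * 1) * 1))%R by pos. lra. }
      destruct (HE t ltac:(lra)) as [E1 _]. pose proof (Cmod_ge_0 (kU1 a c (z t))) as HU1p.
      set (V := Cmod (kU1 a c (z t))) in *. set (y := (Rk * exp (sg * t))%R).
      assert (Hy : (0 < y)) by (unfold y; pos).
      assert (Hexp : (exp sg * 1 <= exp (sg * t) * t)%R).
      { apply Rmult_le_compat; try lra; [pos|]. apply exp_le. nra. }
      assert (L1 : (y * t ^ 2 / c2 * V <= y * t * (c2 * CC + 6 * lam * c2 / R0 * Um))%R).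
      { apply Rle_trans with (Cmod (kE a c (z t)) * V)%R.
        - apply Rmult_le_compat_r; auto. unfold y.
          replace (Rk * exp (sg * t) * t ^ 2 / c2)%R with (Rk * (exp (sg * t) * t ^ 2) / c2)%R by (field; lra).
          exact E1.
        - eapply Rle_trans; [exact HQ|].
          replace (y * t * (c2 * CC + 6 * lam * c2 / R0 * Um))%R
            with (c2 * (Rk * (exp (sg * t) * t)) * CC + G * (exp (sg * t) * t))%R by (unfold y, G; field; lra).
          apply Rplus_le_compat_r. apply Rmult_le_compat_r; auto.
          apply Rmult_le_compat_l; [lra|]. apply Rmult_le_compat_l; lra. }
      apply Rle_div_r; [lra|].
      apply (Rmult_le_reg_l (y * t / c2)%R).
      - apply Rdiv_lt_0_compat; auto. nra.
      - replace (y * t / c2 * (V * t))%R with (y * t ^ 2 / c2 * V)%R by (field; lra).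
        replace (y * t / c2 * X)%R with (y * t * (c2 * CC + 6 * lam * c2 / R0 * Um))%R
          by (unfold X; field; lra). exact L1. }
    set (Y := (3 * kap * X + 6 * lam * Um / R0)%R).
    assert (HY : (0 <= Y)).
    { unfold Y. assert (0 <= 6 * lam * Um / R0)%R.
      { apply Rmult_le_pos; [nra|pos]. } nra. }
    assert (Step2 : (Cmod (kP a c (z sm) - kP a c (z 1%R)) <= Y)%R).
    { pose proof (Cmod_increment_le (fun s => kP a c (z s))
        (fun s => (- (2 * a - c) * (kU1 a c (z s) / z s) - (c - a) * (1 - a) * (kU a c (z s) / (z s * z s))) * z' s)
        (fun s => - Y * / s)%R (fun s => - Y * - (1 / s ^ 2))%R 1 sm) as I.
      cbv beta in I. bound I.
      - lra.
      - intros s Hs. apply Cder_kP; [exact Hc|apply Hz'; lra|apply Hslit; lra].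
      - intros s Hs. apply is_derive_scal.
        eapply is_derive_eq; [apply (is_derive_inv (fun s => s)); [apply is_derive_Rid|lra]|]. cbv beta. field. lra.
      - intros s Hs. specialize (Hq1 s ltac:(lra)). specialize (Hq2 s ltac:(lra)).
        replace (_ * z' s) with (- (2 * a - c) * (kU1 a c (z s) * (z' s / z s))
          - (c - a) * (1 - a) * (kU a c (z s) * (z' s / (z s * z s)))) by (unfold Cdiv; ring).
        bound Cmod_triangle. rewrite Cmod_opp, !(Cmod_mult _ (_ * _)), Cmod_opp, !(Cmod_mult _ (z' s / _)).
        fold kap lam.
        replace (- Y * - (1 / s ^ 2))%R with (kap * (X / s * (3 / s)) + lam * (Um * (6 / (R0 * s ^ 2))))%R
          by (unfold Y; field; lra).
        apply Rplus_le_compat; apply Rmult_le_compat_l; auto; apply Rmult_le_compat; auto using Cmod_ge_0.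
        + apply Step1. lra.
        + apply Hsm. lra.
      - rewrite Rinv_1. assert (0 < / sm)%R by (apply Rinv_0_lt_compat; lra). nra. }
    assert (HUmK : (Um <= K)).
    { assert (E1 : (Cmod (kU1 a c (z sm)) <= X)).
      { eapply Rle_trans; [apply Step1; lra|]. apply Rle_div_l; [lra|]. nra. }
      assert (E2 : (Cmod (kP a c om) <= 2 * CC)%R).
      { rewrite kP_eq. bound Cmod_triangle. lra. }
      rewrite Hz1 in Step2.
      assert (E3 : (Um <= 2 * CC + Y + X)%R).
      { unfold Um. replace (kU a c (z sm)) with ((kP a c (z sm) - kP a c om) + (kP a c om + - kU1 a c (z sm)))
          by (rewrite (kP_eq a c (z sm)); ring).
        bound Cmod_triangle.
        pose proof (Cmod_triangle (kP a c om) (- kU1 a c (z sm))) as T1. rewrite Cmod_opp in T1. lra. }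
      replace (2 * CC + Y + X)%R with (2 * CC + al * CC + 6 * lam * (al + 1) / R0 * Um)%R in E3
        by (unfold Y, X, al; field; lra).
      assert (E4 : (6 * lam * (al + 1) / R0 <= / 2)%R) by (apply Rle_div_l; lra).
      unfold K. nra. }
    split.
    - eapply Rle_trans; [apply Hsm; lra|exact HUmK].
    - eapply Rle_trans; [apply Step1; lra|]. apply Rmult_le_compat_r; [pos|].
      unfold X, K'. apply Rplus_le_compat_l. now apply Rmult_le_compat_l. }
  exists R0, (K + K')%R. repeat split; try lra.
  - destruct (Main om T) as [M1 M2]; auto. lra.
  - destruct (Main om T) as [M1 M2]; auto. eapply Rle_trans; [exact M2|].
    apply Rmult_le_compat_r; [pos|lra].
Qed.

Lemma ln_lt_linear (k x : R) : (0 <= k) -> (1 <= x) -> (4 * k ^ 2 < x)%R -> (k * ln x < x)%R.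
Proof.
  intros Hk Hx1 Hx. set (y := sqrt x).
  assert (Hy : (0 < y)) by (apply sqrt_lt_R0; lra).
  assert (Ey : (y * y = x)%R) by (apply sqrt_sqrt; lra).
  assert (El : (ln x = 2 * ln y)%R) by (rewrite <- Ey, ln_mult by auto; ring).
  assert (Ly : (ln y < y)).
  { pose proof (exp_ineq1_le (ln y)) as H. rewrite exp_ln in H by auto. lra. }
  assert (H2 : (2 * k < y)%R).
  { apply Rsqr_incrst_0; [unfold Rsqr; nra|lra|lra]. }
  rewrite El. destruct (Rle_dec (ln y) 0) as [Hn|Hn]; nra.
Qed.

(** For [p < 0] the region extends beyond the imaginary axis, to points where
    [exp z] is as small as a given power of [1 / |z|]. *)
Definition log_region (p : R) (z : C) : Prop := (p * ln (Cmod z) <= Re z)%R.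

(** A distant point [w] is the end point, at [T = |w| / R0], of the curve from
    [log_path] that starts at [(w - p0 ln T) / T]. *)
Lemma log_region_bound (a c : C) (p : R) : ~ nonpos_int c -> (2 - Re (2 * a - c) < p)%R ->
  exists M K, (1 <= M) /\ (0 <= K) /\ forall w, (M < Cmod w) -> log_region p w ->
  (Cmod (kU a c w) <= K) /\ (Cmod (kU1 a c w) <= K / Cmod w)%R.
Proof.
  intros Hc Hp. destruct (log_path_bound a c Hc) as [R0 [K [HR1 [HRp [HK H]]]]].
  set (p0 := (2 - Re (2 * a - c))%R) in *.
  pose proof (ln_ge_0 R0 HR1) as LR.
  exists (Rmax R0 (exp (Rabs p0 * ln R0 / (p - p0)))), (K * R0)%R.
  split; [eapply Rle_trans; [exact HR1|apply Rmax_l]|]. split; [nra|].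
  intros w Hw Hreg.
  apply Rmax_Rlt in Hw as [HwR Hwe'].
  assert (Hwe : (Rabs p0 * ln R0 / (p - p0) <= ln (Cmod w))%R).
  { rewrite <- (ln_exp (Rabs p0 * ln R0 / (p - p0))). apply ln_le; [apply exp_pos|].
    now left. }
  set (T := (Cmod w / R0)%R).
  assert (HT : (1 <= T)) by (apply Rle_div_r; lra).
  assert (HTw : (R0 * T = Cmod w)%R) by (unfold T; field; lra).
  set (om := (w - RtoC (p0 * ln T)) / RtoC T).
  assert (HTn : RtoC T <> 0) by (apply RtoC_neq_0; lra).
  assert (Eom : om * RtoC T = w - RtoC (p0 * ln T)) by (unfold om; field; auto).
  assert (Ew : log_path om p0 T = w) by (unfold log_path; rewrite Eom; ring).
  destruct (ln_le_self T HT) as [LT0 LT1].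
  assert (Hln : ln T = (ln (Cmod w) - ln R0)%R) by (unfold T; apply ln_div; lra).
  assert (Hre : (0 <= Re om)).
  { assert (E : (Re om * T = Re w - p0 * ln T)%R).
    { replace (Re om * T)%R with (Re (om * RtoC T)) by (destruct om; simpl; ring).
      rewrite Eom. reflexivity. }
    assert (0 <= Re om * T)%R; [|nra]. rewrite E. unfold log_region in Hreg. rewrite Hln.
    apply Rle_div_l in Hwe; [|lra].
    pose proof (Rmult_Rabs_bounds p0 (ln R0) LR). nra. }
  assert (Hom : (3 / 4 * R0 <= Cmod om <= 5 / 4 * R0)%R).
  { assert (E : (Cmod om * T = Cmod (w - RtoC (p0 * ln T)))%R).
    { rewrite <- Eom, Cmod_mult, Cmod_R, Rabs_pos_eq; lra. }
    pose proof (Cmod_triangle w (- RtoC (p0 * ln T))) as T1.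
    pose proof (Cmod_triangle_minus w (- RtoC (p0 * ln T))) as T2.
    rewrite Cmod_opp, Cmod_R, Rabs_mult, (Rabs_pos_eq (ln T)) in T1, T2 by lra.
    unfold Cminus in E. rewrite <- E in T1, T2. pose proof (Rabs_pos p0).
    split; apply (Rmult_le_reg_r T); nra. }
  destruct (H om T Hre Hom HT) as [H1 H2]. rewrite Ew in H1, H2. split.
  - eapply Rle_trans; [exact H1|]. nra.
  - eapply Rle_trans; [exact H2|]. right. unfold T. field. split; lra.
Qed.

Lemma cos_mult_ge (phi th : R) : (- PI <= phi <= PI)%R -> (0 <= th <= 1) ->
  (cos phi <= cos (phi * th))%R.
Proof.
  intros Hp Ht.
  assert (Q : forall x, (0 <= x <= PI) -> (cos x <= cos (x * th))%R).
  { intros x Hx. destruct (Req_dec (x * th) x) as [->|E]; [lra|].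
    left. apply cos_decreasing_1; nra. }
  destruct (Rle_dec 0 phi) as [H|H]; [apply Q; lra|].
  rewrite <- (cos_neg phi), <- (cos_neg (phi * th)).
  replace (- (phi * th))%R with (- phi * th)%R by ring. apply Q. lra.
Qed.

Lemma log_region_slit (p : R) (z : C) : (1 <= Cmod z) -> (4 * p ^ 2 < Cmod z)%R ->
  log_region p z -> slit z.
Proof.
  intros H1 Hm Hr. destruct (Req_dec (Im z) 0) as [E|E]; [left|right; auto].
  assert (Hl : (Rabs p * ln (Cmod z) < Cmod z)%R).
  { apply ln_lt_linear; [apply Rabs_pos|lra|]. rewrite pow2_abs. lra. }
  unfold log_region in Hr.
  pose proof (Rmult_Rabs_bounds p _ (ln_ge_0 _ H1)).
  pose proof (Cmod_le_re_im z) as B. rewrite E, Rabs_R0 in B.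
  unfold Rabs at 1 in B. destruct (Rcase_abs (Re z)); lra.
Qed.

(** Inside the region the derivative of [kP] is [O(1 / z ^ 2)], so an arc of a
    large circle carries the limit found on the positive axis to every
    direction. *)
Lemma exponential_asymptotics (a c : C) (p : R) : ~ nonpos_int c -> (2 - Re (2 * a - c) < p)%R ->
  forall eps, (0 < eps) -> exists M, (1 <= M) /\ forall w, (M < Cmod w) -> log_region p w ->
  (Cmod (kU a c w - Gamma c * rGamma a) < eps)%R.
Proof.
  intros Hc Hp eps Heps. set (A := Gamma c * rGamma a).
  destruct (log_region_bound a c p Hc Hp) as [M1 [K [HM1 [HK B]]]].
  destruct (hyp1F1_positive_axis a c Hc (eps / 2)%R ltac:(lra)) as [M2 [HM2 H2]]. fold A in H2.
  set (kap := Cmod (2 * a - c)). set (lam := Cmod ((c - a) * (1 - a))).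
  assert (Hlam : (0 <= lam)) by apply Cmod_ge_0.
  assert (Hkap : (0 <= kap)) by apply Cmod_ge_0.
  set (L := ((kap + lam) * K * PI + 2 * K)%R).
  pose proof PI_RGT_0 as HPI.
  exists (Rmax (Rmax M1 M2) (Rmax (4 * p ^ 2) (2 * L / eps))). split.
  { eapply Rle_trans; [exact HM1|]. eapply Rle_trans; apply Rmax_l. }
  intros w Hw Hreg. set (r := Cmod w) in *.
  apply Rmax_Rlt in Hw as [Hr Hr']. apply Rmax_Rlt in Hr as [Hr1 Hr2].
  apply Rmax_Rlt in Hr' as [Hr3 Hr4].
  set (phi := Carg w). pose proof (Carg_bound w) as Hphi. fold phi in Hphi.
  set (z := fun t : R => RtoC r * Cexp (RtoC t * (Ci * RtoC phi))).
  assert (Hw0 : w <> 0) by (apply Cmod_gt_0; fold r; lra).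
  assert (Hzm : forall t, Cmod (z t) = r).
  { intro t. unfold z. rewrite Cmod_mult, Cmod_R, Cmod_Cexp, Rabs_pos_eq by lra.
    replace (Re (RtoC t * (Ci * RtoC phi))) with 0%R by (simpl; ring). rewrite exp_0. ring. }
  assert (Hzre : forall t, Re (z t) = (r * cos (phi * t))%R).
  { intro t. unfold z, Cexp. simpl.
    replace (t * (0 * phi - 1 * 0) - 0 * (0 * 0 + 1 * phi))%R with 0%R by ring. rewrite exp_0.
    replace (t * (0 * 0 + 1 * phi) + 0 * (0 * phi - 1 * 0))%R with (phi * t)%R by ring. ring. }
  assert (Hz1 : z 1%R = w).
  { rewrite <- (Cexp_Cln w Hw0) at 1. unfold Cln. fold r phi. unfold z, Cexp. simpl.
    replace (1 * (0 * phi - 1 * 0) - 0 * (0 * 0 + 1 * phi))%R with 0%R by ring. rewrite exp_0.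
    replace (1 * (0 * 0 + 1 * phi) + 0 * (0 * phi - 1 * 0))%R with phi by ring.
    rewrite exp_ln by lra. unfold Cmult, RtoC; simpl. f_equal; ring. }
  assert (Hz0 : z 0%R = RtoC r).
  { unfold z. rewrite Cmult_0_l, Cexp_0. ring. }
  assert (Hzreg : forall t, (0 <= t <= 1) -> log_region p (z t)).
  { intros t Ht. unfold log_region in *. rewrite Hzm, Hzre. fold r in Hreg.
    eapply Rle_trans; [exact Hreg|]. rewrite <- Hz1, Hzre. apply Rmult_le_compat_l; [lra|].
    rewrite Rmult_1_r. now apply cos_mult_ge. }
  assert (Hzs : forall t, (0 <= t <= 1) -> slit (z t)).
  { intros t Ht. apply (log_region_slit p); rewrite ?Hzm; auto; lra. }
  assert (HzB : forall t, (0 <= t <= 1) -> (Cmod (kU a c (z t)) <= K) /\ (Cmod (kU1 a c (z t)) <= K / r)%R).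
  { intros t Ht. rewrite <- (Hzm t). apply B; [rewrite Hzm; lra|auto]. }
  set (Y := ((kap + lam) * K * PI / r)%R).
  assert (Arc : (Cmod (kP a c w - kP a c (RtoC r)) <= Y)%R).
  { pose proof (Cmod_increment_le (fun s => kP a c (z s))
      (fun s => (- (2 * a - c) * (kU1 a c (z s) / z s) - (c - a) * (1 - a) * (kU a c (z s) / (z s * z s)))
         * (Ci * RtoC phi * z s)) (fun s => Y * s)%R (fun _ => Y * 1)%R 0 1 Rle_0_1) as I.
    cbv beta in I. rewrite Hz1, Hz0 in I. rewrite Rmult_0_r, Rminus_0_r, Rmult_1_r in I. apply I.
    - intros s Hs. apply Cder_kP; [exact Hc| |now apply Hzs].
      unfold z. eapply Cder_eq; [apply Cder_scal, Cder_Cexp, Cder_tz|]. cbv beta. ring.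
    - intros s Hs. eapply is_derive_eq; [apply is_derive_scal, is_derive_Rid|]. ring.
    - intros s Hs. destruct (HzB s Hs) as [U0 U1]. pose proof (Hzm s) as Hm.
      assert (Hzn : z s <> 0) by (apply Cmod_gt_0; lra).
      rewrite Cmod_mult.
      replace (Cmod (Ci * RtoC phi * z s)) with (Rabs phi * r)%R
        by (rewrite !Cmod_mult, Cmod_Ci, Cmod_R, Hm; ring).
      destruct (Rinv_pos_le_1 r ltac:(lra)) as [Hir Hir1].
      assert (Ha : (Cmod (- (2 * a - c) * (kU1 a c (z s) / z s)) <= kap * (K / r * / r))%R).
      { rewrite Cmod_mult, Cmod_opp, Cmod_div, Hm by auto. apply Rmult_le_compat_l; auto.
        apply Rmult_le_compat_r; lra. }
      assert (Hb : (Cmod ((c - a) * (1 - a) * (kU a c (z s) / (z s * z s))) <= lam * (K * (/ r * / r)))%R).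
      { rewrite Cmod_mult. fold lam. rewrite Cmod_div, Cmod_mult, Hm by now apply Cmult_neq_0.
        apply Rmult_le_compat_l; auto. unfold Rdiv. rewrite Rinv_mult.
        apply Rmult_le_compat_r; [nra|exact U0]. }
      apply Rle_trans with ((kap * (K / r * / r) + lam * (K * (/ r * / r))) * (PI * r))%R.
      + apply Rmult_le_compat; auto using Cmod_ge_0.
        * pos.
        * bound Cmod_triangle. rewrite (Cmod_opp ((c - a) * (1 - a) * _)). lra.
        * apply Rmult_le_compat_r; [lra|]. now apply Rabs_le.
      + right. unfold Y. field. lra. }
  destruct (HzB 1%R ltac:(lra)) as [_ U1w]. rewrite Hz1 in U1w.
  destruct (HzB 0%R ltac:(lra)) as [_ U1r]. rewrite Hz0 in U1r.
  specialize (H2 r Hr2). change (Cexp (- r) * Cpower r (c - a) * hyp1F1 a c r) with (kU a c (RtoC r)) in H2.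
  replace (kU a c w - A) with ((kP a c w - kP a c (RtoC r)) + ((kU1 a c (RtoC r) - kU1 a c w)
    + (kU a c (RtoC r) - A))) by (rewrite !kP_eq; ring).
  eapply Rle_lt_trans; [apply Cmod_triangle|].
  pose proof (Cmod_triangle (kU1 a c (RtoC r) - kU1 a c w) (kU a c (RtoC r) - A)) as T1.
  pose proof (Cmod_triangle (kU1 a c (RtoC r)) (- kU1 a c w)) as T2. rewrite Cmod_opp in T2.
  unfold Cminus in *.
  assert (HLr : (Y + 2 * (K / r) < eps / 2)%R).
  { replace (Y + 2 * (K / r))%R with (L / r)%R by (unfold Y, L; field; lra).
    apply Rlt_div_l; [lra|]. apply Rlt_div_l in Hr4; lra. }
  lra.
Qed.

(** * Both contributions, in every direction *)

(** Neighbourhoods of infinity within [D]. *)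
Definition inf_in (D : C -> Prop) (P : C -> Prop) : Prop :=
  exists M : R, forall z, D z -> (M < Cmod z) -> P z.

#[global] Instance inf_in_filter (D : C -> Prop) : Filter (inf_in D).
Proof.
  split.
  - exists 0%R. auto.
  - intros P Q [M HM] [N HN]. exists (Rmax M N). intros z Hz Hm. apply Rmax_Rlt in Hm as [Hm Hm']. split.
    + apply HM; auto.
    + apply HN; auto.
  - intros P Q HPQ [M HM]. exists M. auto.
Qed.

Lemma Ctends_inf_in_sub (D D' : C -> Prop) (f : C -> C) (l : C) :
  (forall z, D' z -> D z) -> Ctends (inf_in D) f l -> Ctends (inf_in D') f l.
Proof.
  intros HD H eps Heps. destruct (H eps Heps) as [M HM]. exists M. auto.
Qed.

Lemma inf_in_neq_0 (D : C -> Prop) : inf_in D (fun z => z <> 0).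
Proof. exists 0%R. intros z _ Hz. now apply Cmod_gt_0. Qed.

Lemma Cinv_tends_0 (D : C -> Prop) : Ctends (inf_in D) (fun z => / z) 0.
Proof.
  intros eps Heps. exists (/ eps)%R. intros z _ Hz.
  assert (He : (0 < / eps)%R) by pos.
  assert (Hn : z <> 0) by (apply Cmod_gt_0; lra).
  replace (/ z - 0) with (/ z) by ring. rewrite Cmod_inv by auto.
  rewrite <- (Rinv_inv eps). apply Rinv_lt_contravar; [nra|exact Hz].
Qed.

(** Limits of sums and products, when the limit is written in the same shape. *)
Ltac limit_algebra := repeat first
  [ typeclasses eauto | assumption | apply Cinv_tends_0 | apply Ctends_const
  | apply Ctends_plus | apply Ctends_mult ].

Definition phi1 (a c z : C) : C := Cpower z (a - c) * Cexp z.
Definition phi2 (a z : C) : C := Cpower (- z) (- a).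

Lemma phi1_neq_0 (a c z : C) : phi1 a c z <> 0.
Proof. apply Cmult_neq_0; [apply Cpower_neq_0|apply Cexp_neq_0]. Qed.

Lemma phi2_neq_0 (a z : C) : phi2 a z <> 0.
Proof. apply Cpower_neq_0. Qed.

Lemma Cpower_opp_mult (z w : C) : Cpower z (- w) * Cpower z w = 1.
Proof. rewrite Cpower_opp. pose proof (Cpower_neq_0 z w). field. auto. Qed.

Lemma hyp1F1_kU (a c z : C) : hyp1F1 a c z = phi1 a c z * kU a c z.
Proof.
  unfold phi1, kU.
  transitivity ((Cexp (- z) * Cexp z) * (Cpower z (- (c - a)) * Cpower z (c - a)) * hyp1F1 a c z).
  - rewrite Cexp_opp_l, Cpower_opp_mult. ring.
  - replace (- (c - a)) with (a - c) by ring. ring.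
Qed.

Lemma hyp1F1_kU_reflected (a c z : C) : ~ nonpos_int c ->
  hyp1F1 a c z = phi2 a z * kU (c - a) c (- z).
Proof.
  intro Hc. rewrite (kummer_transformation a c z Hc). unfold phi2, kU.
  replace (- - z) with z by ring. replace (c - (c - a)) with a by ring.
  transitivity (Cexp z * (Cpower (- z) (- a) * Cpower (- z) a) * hyp1F1 (c - a) c (- z)); [|ring].
  rewrite Cpower_opp_mult. ring.
Qed.

Lemma kU_tends (a c : C) (p : R) : ~ nonpos_int c -> (2 - Re (2 * a - c) < p)%R ->
  Ctends (inf_in (log_region p)) (kU a c) (Gamma c * rGamma a).
Proof.
  intros Hc Hp eps Heps. destruct (exponential_asymptotics a c p Hc Hp eps Heps) as [M [_ HM]].
  exists M. auto.
Qed.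

Lemma kU_reflected_tends (a c : C) (p : R) : ~ nonpos_int c -> (2 + Re (2 * a - c) < p)%R ->
  Ctends (inf_in (fun z => log_region p (- z))) (fun z => kU (c - a) c (- z)) (Gamma c * rGamma (c - a)).
Proof.
  intros Hc Hp eps Heps.
  destruct (exponential_asymptotics (c - a) c p Hc) with (eps := eps) as [M [_ HM]]; auto.
  { replace (2 * (c - a) - c) with (- (2 * a - c)) by ring.
    change (Re (- (2 * a - c))) with (- Re (2 * a - c))%R. lra. }
  exists M. intros z Hz Hm. apply HM; auto. now rewrite Cmod_opp.
Qed.

Lemma phi2_over_phi1_tends (a c : C) (p : R) : (2 - Re (2 * a - c) < p)%R ->
  Ctends (inf_in (log_region p)) (fun z => phi2 a z / phi1 a c z) 0.
Proof.
  intros Hp. set (k := Re (2 * a - c)) in *.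
  set (I := exp (Rabs (Im (- a)) * PI)). set (I' := exp (Rabs (Im (a - c)) * PI)).
  assert (HI : (0 < I)) by apply exp_pos. assert (HI' : (0 < I')) by apply exp_pos.
  intros eps Heps. exists (Rmax 1 (I * I' / eps)). intros z Hz Hm.
  apply Rmax_Rlt in Hm as [H1 H2].
  replace (phi2 a z / phi1 a c z - 0) with (phi2 a z / phi1 a c z) by ring.
  rewrite Cmod_div by apply phi1_neq_0. unfold phi1, phi2. rewrite Cmod_mult, Cmod_Cexp.
  pose proof (Cmod_Cpower_le (- z) (- a)) as B2. fold I in B2. rewrite Cmod_opp in B2.
  pose proof (Cmod_Cpower_ge z (a - c)) as B1. rewrite exp_Ropp in B1. fold I' in B1.
  assert (L0 : (0 <= ln (Cmod z))) by (apply ln_ge_0; lra).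
  assert (B3 : (exp (p * ln (Cmod z)) <= exp (Re z))%R) by now apply exp_le.
  assert (Hd : (Rpower (Cmod z) (Re (a - c)) * / I' * exp (p * ln (Cmod z)) <=
    Cmod (Cpower z (a - c)) * exp (Re z))%R).
  { apply Rmult_le_compat; auto; [|pos].
    pos. }
  assert (Hd0 : (0 < Rpower (Cmod z) (Re (a - c)) * / I' * exp (p * ln (Cmod z)))%R).
  { pos. }
  apply Rle_lt_trans with (Rpower (Cmod z) (Re (- a)) * I /
     (Rpower (Cmod z) (Re (a - c)) * / I' * exp (p * ln (Cmod z))))%R.
  { unfold Rdiv. apply Rmult_le_compat; auto using Cmod_ge_0.
    - left. apply Rinv_0_lt_compat. lra.
    - now apply Rinv_le_contravar. }
  replace (Rpower (Cmod z) (Re (- a)) * I / (Rpower (Cmod z) (Re (a - c)) * / I' * exp (p * ln (Cmod z))))%R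
    with (I * I' * exp (- (k + p) * ln (Cmod z)))%R.
  2: { unfold Rpower. rewrite <- (Rinv_inv (exp (Re (- a) * ln (Cmod z)))), <- exp_Ropp.
    replace (exp (- (k + p) * ln (Cmod z))) with
      (/ (exp (- (Re (- a) * ln (Cmod z))) * exp (Re (a - c) * ln (Cmod z)) * exp (p * ln (Cmod z))))%R.
    - field. repeat split; apply Rgt_not_eq; auto; apply exp_pos.
    - rewrite <- !exp_plus, <- exp_Ropp. f_equal. unfold k. destruct a, c. simpl. ring. }
  assert (E : (exp (- (k + p) * ln (Cmod z)) <= / Cmod z)%R).
  { rewrite <- (exp_ln (Cmod z)) at 2 by lra. rewrite <- exp_Ropp. apply exp_le. nra. }
  apply Rle_lt_trans with (I * I' * / Cmod z)%R.
  - apply Rmult_le_compat_l; [nra|exact E].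
  - apply Rlt_div_l; [lra|]. apply Rlt_div_l in H2; lra.
Qed.

(** Each coefficient has its own limit, whichever contribution dominates. *)
Definition two_term (D : C -> Prop) (f : C -> C) (k1 : C) (p1 : C -> C) (k2 : C) (p2 : C -> C) : Prop :=
  exists u v : C -> C, Ctends (inf_in D) u k1 /\ Ctends (inf_in D) v k2 /\
    inf_in D (fun z => f z = u z * p1 z + v z * p2 z).

Definition kummer_two_term (D : C -> Prop) (a c : C) : Prop :=
  two_term D (hyp1F1 a c) (Gamma c * rGamma a) (phi1 a c) (Gamma c * rGamma (c - a)) (phi2 a).

Lemma two_term_right (a c : C) (p : R) : ~ nonpos_int c -> (2 - Re (2 * a - c) < p)%R ->
  kummer_two_term (log_region p) a c.
Proof.
  intros Hc Hp. set (B := Gamma c * rGamma (c - a)).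
  exists (fun z => kU a c z + (- B) * (phi2 a z / phi1 a c z)), (fun _ => B).
  repeat split.
  - pose proof (kU_tends a c p Hc Hp). pose proof (phi2_over_phi1_tends a c p Hp).
    replace (Gamma c * rGamma a) with (Gamma c * rGamma a + - B * 0) by ring. limit_algebra.
  - limit_algebra.
  - apply filter_forall. intro z. rewrite hyp1F1_kU. pose proof (phi1_neq_0 a c z). field. auto.
Qed.

(** Kummer's transformation exchanges the two contributions, the parameters
    [a] and [c - a], and the two half-planes. *)
Lemma two_term_reflect (D : C -> Prop) (a c : C) : ~ nonpos_int c ->
  kummer_two_term D (c - a) c -> kummer_two_term (fun z => D (- z)) a c.
Proof.
  intros Hc [u [v [Hu [Hv H]]]]. exists (fun z => v (- z)), (fun z => u (- z)).
  replace (c - (c - a)) with a in Hv by ring.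
  assert (Q : forall f l, Ctends (inf_in D) f l -> Ctends (inf_in (fun z => D (- z))) (fun z => f (- z)) l).
  { intros f l Hf eps Heps. destruct (Hf eps Heps) as [M HM]. exists M. intros z Hz Hm.
    apply HM; auto. now rewrite Cmod_opp. }
  repeat split; auto. destruct H as [M HM]. exists M. intros z Hz Hm.
  rewrite kummer_transformation, HM by (auto; now rewrite Cmod_opp).
  unfold phi1, phi2. replace (- - z) with z by ring.
  replace (c - a - c) with (- a) by ring. replace (- (c - a)) with (a - c) by ring.
  transitivity (v (- z) * (Cpower z (a - c) * Cexp z) + u (- z) * Cpower (- z) (- a) * (Cexp (- z) * Cexp z)).
  - ring.
  - rewrite Cexp_opp_l. ring.
Qed.

(** [hyp1F1 al] expressed through its upper neighbour [hyp1F1 (al + 1)], whose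
    coefficient carries the exponential part, and a remainder that carries the
    algebraic part. *)
Definition linked (D : C -> Prop) (al c : C) : Prop :=
  exists s t : C -> C, inf_in D (fun z => hyp1F1 al c z = s z * hyp1F1 (al + 1) c z + t z) /\
    Ctends (inf_in D) (fun z => z * s z) al /\
    Ctends (inf_in D) (fun z => t z / phi2 al z) (Gamma c * rGamma (c - al)).

Lemma phi2_pred (al z : C) : z <> 0 -> phi2 (al - 1) z = - z * phi2 al z.
Proof.
  intro Hz. unfold phi2. replace (- (al - 1)) with (- al + 1) by ring. apply Cpower_succ.
  intro H. apply Hz. replace z with (- - z) by ring. rewrite H. ring.
Qed.

Lemma phi1_succ (al c z : C) : z <> 0 -> phi1 (al + 1) c z = z * phi1 al c z.
Proof.
  intro Hz. unfold phi1. replace (al + 1 - c) with (al - c + 1) by ring.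
  rewrite Cpower_succ by auto. ring.
Qed.

(** Eliminating the lower neighbour from the three-term recurrence amounts to
    one step of Gaussian elimination on a tridiagonal system. *)
Lemma linked_step (D : C -> Prop) (al c : C) (s t : C -> C) : ~ nonpos_int c ->
  inf_in D (fun z => hyp1F1 (al - 1) c z = s z * hyp1F1 al c z + t z) ->
  Ctends (inf_in D) s 0 ->
  Ctends (inf_in D) (fun z => t z / phi2 (al - 1) z) (Gamma c * rGamma (c - (al - 1))) ->
  linked D al c.
Proof.
  intros Hc HF Hs Ht.
  set (Dn := fun z => 1 + (2 * al - c + (c - al) * s z) * / z).
  assert (HDn : Ctends (inf_in D) Dn 1).
  { replace (RtoC 1) with (1 + (2 * al - c + (c - al) * 0) * 0) by ring. unfold Dn.
    limit_algebra. }
  assert (H10 : RtoC 1 <> 0) by (apply RtoC_neq_0; lra).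
  assert (HDn0 : inf_in D (fun z => Dn z <> 0)).
  { refine (filter_imp _ _ _ (Ctends_lower _ _ _ H10 HDn)). intros z Hz.
    rewrite Cmod_1 in Hz. apply Cmod_gt_0. lra. }
  pose proof (Ctends_inv _ _ _ H10 HDn) as HDi.
  pose proof (inf_in_neq_0 D) as Hz0.
  exists (fun z => al * / (z * Dn z)), (fun z => - (c - al) * t z * / (z * Dn z)). repeat split.
  - refine (filter_imp _ _ _ (filter_and _ _ HF (filter_and _ _ HDn0 Hz0))).
    intros z [H1 [H2 H3]]. pose proof (kummer_contiguous al c z Hc) as K. rewrite H1 in K.
    assert (E : z * Dn z * hyp1F1 al c z = al * hyp1F1 (al + 1) c z - (c - al) * t z).
    { replace (z * Dn z) with (z + (2 * al - c + (c - al) * s z)) by (unfold Dn; field; auto).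
      replace ((z + (2 * al - c + (c - al) * s z)) * hyp1F1 al c z)
        with (z * hyp1F1 al c z + (2 * al - c + (c - al) * s z) * hyp1F1 al c z) by ring.
      rewrite K. ring. }
    replace (hyp1F1 al c z) with (z * Dn z * hyp1F1 al c z * / (z * Dn z)) by (field; auto).
    rewrite E. ring.
  - apply (Ctends_ext _ (fun z => al * / Dn z)).
    + refine (filter_imp _ _ _ (filter_and _ _ HDn0 Hz0)). intros z [H2 H3]. field. auto.
    + pose proof (Ctends_mult _ _ _ _ _ (Ctends_const (inf_in D) al) HDi) as Q.
      replace (al * / 1) with al in Q by (field; auto). exact Q.
  - apply (Ctends_ext _ (fun z => (c - al) * (t z / phi2 (al - 1) z) * / Dn z)).
    + refine (filter_imp _ _ _ (filter_and _ _ HDn0 Hz0)). intros z [H2 H3].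
      rewrite phi2_pred by auto. pose proof (phi2_neq_0 al z). field. auto.
    + replace (Gamma c * rGamma (c - al)) with ((c - al) * (Gamma c * rGamma (c - (al - 1))) * / 1).
      * limit_algebra.
      * rewrite (rGamma_succ (c - al)). replace (c - (al - 1)) with (c - al + 1) by ring. field.
Qed.

Lemma linked_start (D : C -> Prop) (al c : C) : ~ nonpos_int c ->
  Ctends (inf_in D) (fun z => hyp1F1 (al - 1) c z / phi2 (al - 1) z) (Gamma c * rGamma (c - (al - 1))) ->
  linked D al c.
Proof.
  intros Hc H. apply (linked_step D al c (fun _ => 0) (hyp1F1 (al - 1) c)); auto.
  - apply filter_forall. intro z. ring.
  - limit_algebra.
Qed.

Lemma linked_succ (D : C -> Prop) (al c : C) : ~ nonpos_int c ->
  linked D (al - 1) c -> linked D al c.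
Proof.
  intros Hc [s [t [HF [Hs Ht]]]]. apply (linked_step D al c s t); auto.
  - refine (filter_imp _ _ _ HF). intros z ->. now replace (al - 1 + 1) with al by ring.
  - apply (Ctends_ext _ (fun z => / z * (z * s z))).
    + refine (filter_imp _ _ _ (inf_in_neq_0 D)). intros z Hz. field. auto.
    + replace (RtoC 0) with (0 * (al - 1)) by ring. limit_algebra.
Qed.

Lemma two_term_pred (D : C -> Prop) (al c : C) :
  linked D al c -> kummer_two_term D (al + 1) c -> kummer_two_term D al c.
Proof.
  intros [s [t [HF [Hs Ht]]]] [u [v [Hu [Hv HF']]]].
  exists (fun z => z * s z * u z), (fun z => - (1) * (/ z * / z * (z * s z) * v z) + t z / phi2 al z).
  repeat split.
  - replace (Gamma c * rGamma al) with (al * (Gamma c * rGamma (al + 1))).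
    + limit_algebra.
    + rewrite (rGamma_succ al). ring.
  - set (B' := Gamma c * rGamma (c - (al + 1))) in *.
    replace (Gamma c * rGamma (c - al)) with (- (1) * (0 * 0 * al * B') + Gamma c * rGamma (c - al)) by ring.
    limit_algebra.
  - refine (filter_imp _ _ _ (filter_and _ _ (inf_in_neq_0 D) (filter_and _ _ HF HF'))).
    intros z [Hz [-> ->]]. rewrite (phi1_succ al c z Hz).
    pose proof (phi2_pred (al + 1) z Hz) as E. replace (al + 1 - 1) with al in E by ring.
    pose proof (phi2_neq_0 (al + 1) z). rewrite E. field. auto.
Qed.

(** The neighbourhood of the imaginary axis in which the two contributions
    differ by powers of [z] only. *)
Definition strip (L : R) (z : C) : Prop := log_region (- L) z /\ log_region (- L) (- z).

(** The recurrence is anchored far down, where only the algebraic part is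
    visible in the strip, and far up, where only the exponential part is. *)
Lemma two_term_strip (a c : C) (L : R) : ~ nonpos_int c -> kummer_two_term (strip L) a c.
Proof.
  intro Hc. set (k := Re (2 * a - c)).
  destruct (nfloor_ex (Rabs L + Rabs k + 3)) as [N [_ HN]].
  { pose proof (Rabs_pos L). pose proof (Rabs_pos k). lra. }
  assert (HLb : (- Rabs L <= L <= Rabs L)%R) by (apply Rabs_le_between; lra).
  assert (Hkb : (- Rabs k <= k <= Rabs k)%R) by (apply Rabs_le_between; lra).
  set (n := S N). assert (Hn : (Rabs L + Rabs k + 3 < INR n)%R) by (unfold n; rewrite S_INR; lra).
   clearbody n.
  assert (Hre : forall x : R, Re (2 * (a + RtoC x) - c) = (k + 2 * x)%R).
  { intro x. unfold k. destruct a, c. simpl. ring. }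
  assert (Hlink : forall j, linked (strip L) (a - INR n + 1 + INR j) c).
  { induction j as [|j IH].
    - change (INR 0) with 0%R. apply linked_start; auto.
      replace (a - INR n + 1 + 0 - 1) with (a - INR n) by ring.
      apply (Ctends_ext _ (fun z => kU (c - (a - INR n)) c (- z))).
      + apply filter_forall. intro z. rewrite (hyp1F1_kU_reflected (a - INR n) c z Hc).
        pose proof (phi2_neq_0 (a - INR n) z). field. auto.
      + apply (Ctends_inf_in_sub (fun z => log_region (- L) (- z))); [now intros z [_ Hz]|].
        apply kU_reflected_tends; auto.
        unfold Cminus at 2. rewrite <- RtoC_opp, Hre. lra.
    - apply linked_succ; auto.
      replace (a - INR n + 1 + INR (S j) - 1) with (a - INR n + 1 + INR j)
        by (rewrite S_INR, RtoC_plus; ring). exact IH. }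
  assert (Htop : kummer_two_term (strip L) (a + INR n) c).
  { destruct (two_term_right (a + INR n) c (- L) Hc) as [u [v [Hu [Hv [M HM]]]]].
    { rewrite Hre. lra. }
    exists u, v. repeat split.
    - now apply (Ctends_inf_in_sub (log_region (- L))); [intros z [Hz _]|].
    - now apply (Ctends_inf_in_sub (log_region (- L))); [intros z [Hz _]|].
    - exists M. intros z [Hz _]. now apply HM. }
  assert (Hdown : forall i, (i <= n)%nat -> kummer_two_term (strip L) (a + INR n - INR i) c).
  { induction i as [|i IH]; intro Hi.
    - change (INR 0) with 0%R. now replace (a + INR n - 0) with (a + INR n) by ring.
    - apply two_term_pred.
      + specialize (Hlink (2 * n - i - 2)%nat).
        replace (a + INR n - INR (S i)) with (a - INR n + 1 + INR (2 * n - i - 2)); [exact Hlink|].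
        replace (INR (2 * n - i - 2)) with (2 * INR n - INR i - 2)%R.
        * rewrite S_INR, !RtoC_minus, RtoC_plus, RtoC_mult. ring.
        * rewrite !minus_INR, mult_INR by lia. simpl (INR 2). ring.
      + replace (a + INR n - INR (S i) + 1) with (a + INR n - INR i) by (rewrite S_INR, RtoC_plus; ring).
        apply IH. lia. }
  specialize (Hdown n (le_n n)). now replace (a + INR n - INR n) with a in Hdown by ring.
Qed.

Lemma two_term_cover (D D' D'' : C -> Prop) (f : C -> C) (k1 : C) (p1 : C -> C) (k2 : C) (p2 : C -> C) :
  (forall z, {D z} + {~ D z}) -> (forall z, D'' z -> ~ D z -> D' z) ->
  two_term D f k1 p1 k2 p2 -> two_term D' f k1 p1 k2 p2 -> two_term D'' f k1 p1 k2 p2.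
Proof.
  intros dec Hd [u [v [Hu [Hv [M HM]]]]] [u' [v' [Hu' [Hv' [M' HM']]]]].
  set (pick := fun (g g' : C -> C) z => if dec z then g z else g' z).
  assert (Q : forall g g' l, Ctends (inf_in D) g l -> Ctends (inf_in D') g' l -> Ctends (inf_in D'') (pick g g') l).
  { intros g g' l H H' eps Heps. destruct (H eps Heps) as [N HN]. destruct (H' eps Heps) as [N' HN'].
    exists (Rmax N N'). intros z Hz Hm. apply Rmax_Rlt in Hm as [Hm Hm'].
    unfold pick. destruct (dec z); auto. }
  exists (pick u u'), (pick v v'). repeat split; auto.
  exists (Rmax M M'). intros z Hz Hm. apply Rmax_Rlt in Hm as [Hm Hm'].
  unfold pick. destruct (dec z); auto.
Qed.

Lemma hyp1F1_asymptotics (a c : C) : ~ nonpos_int c -> kummer_two_term (fun _ => True) a c.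
Proof.
  intros Hc. set (k := Re (2 * a - c)). set (L := (Rabs k + 3)%R).
  (* [L] exceeds the thresholds [2 - k] and [2 + k] of the two half-planes *)
  assert (Hkb : (- Rabs k <= k <= Rabs k)%R) by (apply Rabs_le_between; lra).
  assert (dec : forall z, {log_region L z} + {~ log_region L z}) by (intro z; apply Rle_dec).
  apply (two_term_cover (log_region L) (fun z => ~ log_region L z)); auto.
  { apply two_term_right; auto. fold k. unfold L. lra. }
  apply (two_term_cover (fun z => log_region L (- z)) (strip L)); auto.
  { intros z H1 H2. unfold strip, log_region in *. rewrite Cmod_opp in *.
    change (Re (- z)) with (- Re z)%R in *. lra. }
  { apply (two_term_reflect (log_region L)); auto. apply two_term_right; auto.
    replace (2 * (c - a) - c) with (- (2 * a - c)) by ring.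
    change (Re (- (2 * a - c))) with (- k)%R. unfold L. lra. }
  now apply two_term_strip.
Qed.

(** * Summation over the first index *)

Lemma ex_series_drop (v : nat -> R) (N : nat) : ex_series v -> ex_series (fun k => v (N + k)%nat).
Proof.
  intro H. induction N as [|N IH]; [exact H|].
  apply (ex_series_incr_1 (fun k => v (N + k)%nat)) in IH.
  refine (ex_series_ext _ _ _ IH). intro k. f_equal. lia.
Qed.

Lemma Series_drop_S (v : nat -> R) (N : nat) : ex_series v ->
  Series (fun k => v (N + k)%nat) = (v N + Series (fun k => v (S N + k)%nat))%R.
Proof.
  intro H. rewrite Series_incr_1 by now apply ex_series_drop. rewrite Nat.add_0_r. f_equal.
  apply Series_ext. intro k. f_equal. lia.
Qed.

Lemma Series_tail_small (v : nat -> R) (eps : R) : ex_series v -> (0 < eps) ->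
  exists N, (Series (fun k => v (N + k)%nat) < eps)%R.
Proof.
  intros H Heps. pose proof (Series_correct v H) as Hs.
  assert (Hl : is_lim_seq (sum_n v) (Series v)) by exact Hs.
  apply is_lim_seq_spec in Hl. destruct (Hl (mkposreal _ Heps)) as [N HN]. simpl in HN.
  exists (S N). specialize (HN N (le_n N)).
  rewrite (Series_incr_n v (S N)) in HN by (auto; lia). simpl pred in HN.
  rewrite <- sum_n_Reals in HN. apply Rabs_lt_between in HN. lra.
Qed.

(** Dominated convergence: finitely many terms are small eventually, and the
    tail is controlled by that of [v]. *)
Lemma tannery {T} (F : (T -> Prop) -> Prop) {FF : Filter F} (f : nat -> T -> R) (v : nat -> R) :
  (forall m z, (0 <= f m z)) -> F (fun z => forall m, (f m z <= v m)) -> ex_series v ->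
  (forall m eps, (0 < eps) -> F (fun z => (f m z <= eps))) ->
  forall eps, (0 < eps) -> F (fun z => (Series (fun m => f m z) <= eps)).
Proof.
  intros H0 Hdom Hv Hterm eps Heps.
  assert (Hex : F (fun z => ex_series (fun m => f m z))).
  { refine (filter_imp _ _ _ Hdom). intros z Hz.
    apply (ex_series_le (V := R_CompleteNormedModule) _ v); auto.
    intro n. unfold norm; simpl; unfold abs; simpl. rewrite Rabs_pos_eq; auto. }
  assert (Hhead : forall N e, (0 < e) -> F (fun z =>
    (Series (fun m => f m z) <= e + Series (fun k => f (N + k)%nat z))%R)).
  { induction N as [|N IH]; intros e He.
    - apply filter_forall. intro z. simpl. lra.
    - assert (He2 : (0 < e / 2)%R) by lra.
      refine (filter_imp _ _ _ (filter_and _ _ (filter_and _ _ (IH _ He2) (Hterm N _ He2)) Hex)).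
      intros z [[A B] E]. rewrite (Series_drop_S (fun m => f m z)) in A by auto. lra. }
  destruct (Series_tail_small v (eps / 2)%R Hv) as [N HN]; [lra|].
  assert (He2 : (0 < eps / 2)%R) by lra.
  refine (filter_imp _ _ _ (filter_and _ _ (Hhead N _ He2) Hdom)).
  intros z [A B]. eapply Rle_trans; [exact A|].
  assert (Series (fun k => f (N + k)%nat z) <= Series (fun k => v (N + k)%nat))%R.
  { apply Series_le; [|now apply ex_series_drop]. intro k. auto. }
  lra.
Qed.

Lemma Cpoch_add (a : C) (m n : nat) : Cpoch a (m + n) = Cpoch a m * Cpoch (a + INR m) n.
Proof.
  induction n as [|n IH].
  - rewrite Nat.add_0_r. simpl. ring.
  - rewrite Nat.add_succ_r. simpl. rewrite IH, plus_INR, RtoC_plus. ring.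
Qed.

Lemma rGamma_shift (a : C) (m : nat) : rGamma a = Cpoch a m * rGamma (a + INR m).
Proof.
  induction m as [|m IH].
  - simpl. replace (a + 0) with a by ring. ring.
  - rewrite IH, (rGamma_succ (a + INR m)), S_INR, RtoC_plus. simpl. rewrite Cplus_assoc. ring.
Qed.

(** The [m]-th term of the series over the first index, with [x = y / z], after
    removal of the coefficient [(b)_m y ^ m / ((c)_m m!)]. *)
Definition psi_row (a c : C) (m : nat) (z : C) : C :=
  Cpoch a m * / z ^ m * hyp1F1 (a + INR m) c z.

Lemma HumbertPsi1_rows (a b c c' x y : C) : ~ nonpos_int c -> ~ nonpos_int c' -> x <> 0 -> y <> 0 ->
  HumbertPsi1 a b c c' x (y / x) =
  CSeries (fun m => hcoef b c m * (y ^ m / INR (fact m)) * psi_row a c' m (y / x)).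
Proof.
  intros Hc Hc' Hx Hy. unfold HumbertPsi1. apply CSeries_ext. intro m.
  destruct (hcoef_bound (a + INR m) c' Hc') as [B HB].
  pose proof (egf_summable _ _ _ (y / x) HB) as Hs.
  rewrite (CSeries_ext _ (fun n => Cpoch a m * hcoef b c m * (x ^ m / INR (fact m)) *
     (hcoef (a + INR m) c' n * ((y / x) ^ n / INR (fact n))))).
  - rewrite CSeries_scal by exact Hs.
    change (CSeries (fun n => hcoef (a + INR m) c' n * ((y / x) ^ n / INR (fact n))))
      with (hyp1F1 (a + INR m) c' (y / x)).
    unfold psi_row. replace (x ^ m) with (y ^ m * / (y / x) ^ m); [unfold Cdiv; ring|].
    unfold Cdiv. rewrite Cpow_mult_l, Cpow_inv by auto.
    pose proof (Cpow_nz x m Hx). pose proof (Cpow_nz y m Hy). field. auto.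
  - intro n. rewrite Cpoch_add. unfold hcoef.
    pose proof (Cpoch_neq_0 c m Hc). pose proof (Cpoch_neq_0 c' n Hc').
    pose proof (INR_fact_neq_0_C m). pose proof (INR_fact_neq_0_C n). field. auto.
Qed.

Lemma psi_row_recurrence (a c z : C) (m : nat) : ~ nonpos_int c -> z <> 0 ->
  psi_row a c (S (S m)) z =
  (1 + (2 * (a + INR (S m)) - c) / z) * psi_row a c (S m) z
  + (c - (a + INR (S m))) * (a + INR m) / (z * z) * psi_row a c m z.
Proof.
  intros Hc Hz. unfold psi_row.
  pose proof (kummer_contiguous (a + INR (S m)) c z Hc) as K.
  replace (a + INR (S m) + 1) with (a + INR (S (S m))) in K by (rewrite (S_INR (S m)), RtoC_plus; ring).
  replace (a + INR (S m) - 1) with (a + INR m) in K by (rewrite S_INR, RtoC_plus; ring).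
  change (Cpoch a (S (S m))) with (Cpoch a m * (a + INR m) * (a + INR (S m))).
  change (Cpoch a (S m)) with (Cpoch a m * (a + INR m)).
  rewrite !Cpow_S. pose proof (Cpow_nz z m Hz) as Hzm.
  set (F2 := hyp1F1 (a + INR (S (S m))) c z) in *. set (F1 := hyp1F1 (a + INR (S m)) c z) in *.
  set (F0 := hyp1F1 (a + INR m) c z) in *.
  transitivity (Cpoch a m * (a + INR m) * / (z * (z * z ^ m)) * ((a + INR (S m)) * F2)); [field; auto|].
  replace ((a + INR (S m)) * F2) with (z * F1 + (2 * (a + INR (S m)) - c) * F1 + (c - (a + INR (S m))) * F0)
    by (rewrite K; ring).
  field. auto.
Qed.

Fixpoint row_majorant (D Z : R) (m : nat) : R :=
  match m with
  | O => 1%R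
  | S k => (row_majorant D Z k * (1 + D * (INR k + 1) / Z))%R
  end.

Lemma row_majorant_ge_1 (D Z : R) (m : nat) : (0 <= D) -> (0 < Z) -> (1 <= row_majorant D Z m).
Proof.
  intros HD HZ. induction m as [|m IH]; simpl; [lra|].
  pose proof (pos_INR m). assert (0 <= D * (INR m + 1) / Z)%R by (apply Rle_div_r; nra). nra.
Qed.

Lemma row_majorant_antitone (D Z Z' : R) (m : nat) : (0 <= D) -> (0 < Z) -> (Z <= Z') ->
  (row_majorant D Z' m <= row_majorant D Z m).
Proof.
  intros HD HZ HZ'. induction m as [|m IH]; simpl; [lra|].
  pose proof (pos_INR m).
  pose proof (row_majorant_ge_1 D Z' m HD ltac:(lra)).
  assert (0 <= D * (INR m + 1) / Z')%R by (apply Rle_div_r; nra).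
  apply Rmult_le_compat; try lra. apply Rplus_le_compat_l. unfold Rdiv.
  apply Rmult_le_compat_l; [nra|]. now apply Rinv_le_contravar.
Qed.

(** The majorant grows essentially like [D ^ m * m! / |z| ^ m]: this leaves a series in
    [m] that is dominated, by geometric terms, as soon as [|z|] is large. *)
Lemma psi_row_bound (a c : C) : ~ nonpos_int c -> exists D, (0 <= D) /\
  forall z H, (0 < Cmod z) -> (Cmod (psi_row a c 0 z) <= H) -> (Cmod (psi_row a c 1 z) <= H) ->
  forall m, (Cmod (psi_row a c m z) <= H * row_majorant D (Cmod z) m)%R.
Proof.
  intro Hc. set (E := (2 * Cmod a + Cmod c + 2)%R).
  pose proof (Cmod_ge_0 a) as Ha0. pose proof (Cmod_ge_0 c) as Hc0.
  assert (HE : (2 <= E)) by (unfold E; lra).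
  exists (2 * E)%R. split; [lra|]. intros z H Hz H0 H1.
  set (Z := Cmod z) in *. set (G := row_majorant (2 * E) Z).
  assert (HH : (0 <= H)) by (eapply Rle_trans; [apply Cmod_ge_0|exact H0]).
  assert (HG : forall m, (1 <= G m)) by (intro m; apply row_majorant_ge_1; lra).
  assert (Hz0 : z <> 0) by now apply Cmod_gt_0.
  assert (Q : forall m, (Cmod (psi_row a c m z) <= H * G m /\ Cmod (psi_row a c (S m) z) <= H * G (S m))%R).
  { induction m as [|m [I0 I1]].
    - split; [unfold G; simpl; lra|]. eapply Rle_trans; [exact H1|].
      specialize (HG 1%nat). nra.
    - split; auto. rewrite psi_row_recurrence by auto.
      pose proof (pos_INR m) as Hm.
      set (q := ((INR m + 1) / Z)%R). assert (Hq : (0 < q)) by pos.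
      assert (B1 : (Cmod (1 + (2 * (a + INR (S m)) - c) / z) <= 1 + E * q)%R).
      { bound Cmod_triangle. rewrite Cmod_1, Cmod_div by auto. fold Z.
        apply Rplus_le_compat_l. unfold q, Rdiv. rewrite <- Rmult_assoc.
        apply Rmult_le_compat_r; [pos|].
        replace (2 * (a + INR (S m)) - c) with (RtoC 2 * a + (RtoC 2 * RtoC (INR (S m)) + - c)) by ring.
        bound Cmod_triangle. rewrite Cmod_mult, Cmod_R.
        pose proof (Cmod_triangle (RtoC 2 * RtoC (INR (S m))) (- c)) as T.
        rewrite Cmod_mult, Cmod_opp, Cmod_R, Cmod_INR in T. rewrite !(Rabs_pos_eq 2) in * by lra.
        rewrite S_INR in *. unfold E. nra. }
      assert (B2 : (Cmod ((c - (a + INR (S m))) * (a + INR m) / (z * z)) <= E * q * (E * q))%R).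
      { rewrite Cmod_div by now apply Cmult_neq_0. rewrite !Cmod_mult. fold Z.
        assert (T1 : (Cmod (c - (a + INR (S m))) <= E * (INR m + 1))%R).
        { replace (c - (a + INR (S m))) with (c + (- a + - INR (S m))) by ring.
          bound Cmod_triangle.
          pose proof (Cmod_triangle (- a) (- INR (S m))) as T. rewrite !Cmod_opp, Cmod_INR, S_INR in T.
          rewrite S_INR. unfold E. nra. }
        assert (T2 : (Cmod (a + INR m) <= E * (INR m + 1))%R).
        { bound Cmod_triangle. rewrite Cmod_INR. unfold E. nra. }
        replace (E * q * (E * q))%R with (E * (INR m + 1) * (E * (INR m + 1)) / (Z * Z))%R
          by (unfold q; field; lra).
        unfold Rdiv. apply Rmult_le_compat_r; [left; apply Rinv_0_lt_compat; nra|].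
        apply Rmult_le_compat; auto using Cmod_ge_0. }
      bound Cmod_triangle. rewrite (Cmod_mult (1 + _)), (Cmod_mult (_ / (z * z))).
      assert (S1 : (Cmod (1 + (2 * (a + INR (S m)) - c) / z) * Cmod (psi_row a c (S m) z)
         <= (1 + E * q) * (H * G (S m)))%R) by (apply Rmult_le_compat; auto using Cmod_ge_0).
      assert (S2 : (Cmod ((c - (a + INR (S m))) * (a + INR m) / (z * z)) * Cmod (psi_row a c m z)
         <= E * q * (E * q) * (H * G m))%R) by (apply Rmult_le_compat; auto using Cmod_ge_0).
      assert (G1 : G (S m) = (G m * (1 + 2 * (E * q)))%R) by (unfold G, q; simpl; field; lra).
      assert (G2 : (G (S m) * (1 + 2 * (E * q)) <= G (S (S m)))%R).
      { change (G (S (S m))) with (G (S m) * (1 + 2 * E * (INR (S m) + 1) / Z))%R.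
        apply Rmult_le_compat_l; [specialize (HG (S m)); lra|].
        apply Rplus_le_compat_l.
        replace (2 * (E * q))%R with (2 * E * (INR m + 1) / Z)%R by (unfold q; field; lra).
        unfold Rdiv. apply Rmult_le_compat_r; [pos|].
        rewrite S_INR. nra. }
      set (t := (E * q)%R) in *. assert (Ht : (0 < t)) by (unfold t; nra).
      specialize (HG m).
      assert (G3 : (t * t * G m <= t * G (S m))%R).
      { rewrite G1. nra. }
      apply Rle_trans with (H * G (S m) * (1 + t) + H * (t * G (S m)))%R; [nra|].
      replace (H * G (S m) * (1 + t) + H * (t * G (S m)))%R with (H * (G (S m) * (1 + 2 * t)))%R by ring.
      now apply Rmult_le_compat_l. }
  intro m. apply Q.
Qed.

Lemma row_majorant_summable (be D Z : R) : (0 < be) -> (0 <= D) -> (0 < Z) -> (be * D < Z)%R ->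
  ex_series (fun m => be ^ m / INR (fact m) * row_majorant D Z m)%R.
Proof.
  intros Hbe HD HZ HbD.
  set (v := fun m => (be ^ m / INR (fact m) * row_majorant D Z m)%R).
  assert (Hv : forall m, (0 < v m)).
  { intro m. apply Rmult_lt_0_compat.
    - apply Rdiv_lt_0_compat; [now apply pow_lt|apply INR_fact_lt_0].
    - pose proof (row_majorant_ge_1 D Z m HD HZ). lra. }
  apply (ex_series_ext (fun m => Rabs (v m))).
  { intro m. apply Rabs_pos_eq. left. apply Hv. }
  apply (ex_series_DAlembert v (be * D / Z)).
  - apply Rlt_div_l; lra.
  - intro m. apply Rgt_not_eq, Hv.
  - apply (is_lim_seq_ext (fun m => be * / INR (S m) + be * D / Z)%R).
    + intro m. rewrite Rabs_pos_eq by (left; apply Rdiv_lt_0_compat; apply Hv).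
      unfold v. rewrite fact_simpl, mult_INR. simpl row_majorant. rewrite S_INR. simpl pow.
      pose proof (pos_INR m). pose proof (INR_fact_neq_0 m). pose proof (pow_nonzero be m ltac:(lra)).
      pose proof (row_majorant_ge_1 D Z m HD HZ). field. repeat split; lra.
    + assert (L : is_lim_seq (fun m => / INR (S m))%R 0%R).
      { apply (is_lim_seq_incr_1 (fun n => / INR n)%R).
        apply (is_lim_seq_inv INR p_infty); [apply is_lim_seq_INR|discriminate]. }
      pose proof (is_lim_seq_scal_l _ be _ L) as L'.
      replace (Rbar_mult be 0%R) with (Finite 0) in L' by (simpl; f_equal; ring).
      pose proof (is_lim_seq_plus' _ _ _ _ L' (is_lim_seq_const (be * D / Z)%R)) as L2.
      now rewrite Rplus_0_l in L2.
Qed.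

Definition weight (a c z : C) : R := (Cmod (phi1 a c z) + Cmod (phi2 a z))%R.

Lemma weight_pos (a c z : C) : (0 < weight a c z).
Proof.
  unfold weight. pose proof (proj1 (Cmod_gt_0 _) (phi1_neq_0 a c z)).
  pose proof (Cmod_ge_0 (phi2 a z)). lra.
Qed.

Lemma phi1_shift (a c z : C) (m : nat) : z <> 0 -> phi1 (a + INR m) c z = z ^ m * phi1 a c z.
Proof.
  intro Hz. induction m as [|m IH].
  - simpl. replace (a + 0) with a by ring. ring.
  - replace (a + INR (S m)) with (a + INR m + 1) by (rewrite S_INR, RtoC_plus; ring).
    rewrite phi1_succ, IH, Cpow_S by auto. ring.
Qed.

Lemma phi2_shift (a z : C) (m : nat) : z <> 0 ->
  phi2 (a + INR m) z = (- (1) * / z) ^ m * phi2 a z.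
Proof.
  intro Hz. induction m as [|m IH].
  - simpl. replace (a + 0) with a by ring. ring.
  - pose proof (phi2_pred (a + INR (S m)) z Hz) as E.
    replace (a + INR (S m) - 1) with (a + INR m) in E by (rewrite S_INR, RtoC_plus; ring).
    transitivity (- (1) * / z * phi2 (a + INR m) z); [rewrite E; field; auto|].
    rewrite IH, Cpow_S. ring.
Qed.

Lemma Ctends_pow {T} (F : (T -> Prop) -> Prop) {FF : Filter F} (f : T -> C) (l : C) (m : nat) :
  Ctends F f l -> Ctends F (fun x => f x ^ m) (l ^ m).
Proof. intro H. induction m as [|m IH]; simpl; limit_algebra. Qed.

(** In each row the exponential part survives with the same coefficient, while
    the algebraic part is damped by [z ^ (- 2 m)]. *)
Lemma psi_row_two_term (a c : C) (m : nat) : ~ nonpos_int c ->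
  two_term (fun _ => True) (psi_row a c m) (Gamma c * rGamma a) (phi1 a c)
    (match m with O => Gamma c * rGamma (c - a) | S _ => 0 end) (phi2 a).
Proof.
  intros Hc. destruct (hyp1F1_asymptotics (a + INR m) c Hc) as [u [v [Hu [Hv H]]]].
  exists (fun z => Cpoch a m * u z), (fun z => Cpoch a m * v z * (/ z * (- (1) * / z)) ^ m).
  repeat split.
  - rewrite (rGamma_shift a m).
    replace (Gamma c * (Cpoch a m * rGamma (a + INR m))) with (Cpoch a m * (Gamma c * rGamma (a + INR m))) by ring.
    limit_algebra.
  - replace (match m with O => Gamma c * rGamma (c - a) | S _ => 0 end)
      with (Cpoch a m * (Gamma c * rGamma (c - (a + INR m))) * (0 * (- (1) * 0)) ^ m).
    + apply Ctends_mult; [typeclasses eauto|limit_algebra|].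
      apply Ctends_pow; [typeclasses eauto|]. limit_algebra.
    + destruct m as [|m]; [|simpl; ring]. change (INR 0) with 0%R. simpl Cpow. simpl Cpoch.
      replace (c - (a + 0)) with (c - a) by ring. ring.
  - refine (filter_imp _ _ _ (filter_and _ _ H (inf_in_neq_0 _))). intros z [E Hz].
    unfold psi_row. rewrite E, phi1_shift, phi2_shift by auto. set (w := - (1) * / z).
    rewrite Cpow_mult_l, Cpow_inv by auto. pose proof (Cpow_nz z m Hz) as Hzm.
    revert Hzm. generalize (z ^ m), (w ^ m). intros p q Hp. field. auto.
Qed.

Lemma two_term_estimate (D : C -> Prop) (f : C -> C) (k1 : C) (p1 : C -> C) (k2 : C) (p2 : C -> C) :
  two_term D f k1 p1 k2 p2 -> forall eps, (0 < eps) -> inf_in D (fun z =>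
   (Cmod (f z - (k1 * p1 z + k2 * p2 z)) <= eps * (Cmod (p1 z) + Cmod (p2 z)))%R).
Proof.
  intros [u [v [Hu [Hv H]]]] eps Heps.
  refine (filter_imp _ _ _ (filter_and _ _ H (filter_and _ _ (Hu eps Heps) (Hv eps Heps)))).
  intros z [-> [H1 H2]].
  replace (_ - _) with ((u z - k1) * p1 z + (v z - k2) * p2 z) by ring.
  bound Cmod_triangle. rewrite !Cmod_mult.
  pose proof (Cmod_ge_0 (p1 z)). pose proof (Cmod_ge_0 (p2 z)). nra.
Qed.

Definition row_limit (a c : C) (m : nat) (z : C) : C :=
  Gamma c * rGamma a * phi1 a c z +
  (match m with O => Gamma c * rGamma (c - a) | S _ => 0 end) * phi2 a z.

Lemma psi_row_asymptotics (a c : C) (m : nat) : ~ nonpos_int c -> forall eps, (0 < eps) ->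
  inf_in (fun _ => True) (fun z => (Cmod (psi_row a c m z - row_limit a c m z) <= eps * weight a c z)%R).
Proof. intro Hc. exact (two_term_estimate _ _ _ _ _ _ (psi_row_two_term a c m Hc)). Qed.

Lemma psi_rows_asymptotics (a b c c' y : C) : ~ nonpos_int c -> ~ nonpos_int c' -> y <> 0 ->
  forall eps, (0 < eps) -> inf_in (fun _ => True) (fun z =>
   (Cmod (CSeries (fun m => hcoef b c m * (y ^ m / INR (fact m)) * psi_row a c' m z)%C -
     (Gamma c' * rGamma a * hyp1F1 b c y * phi1 a c' z + Gamma c' * rGamma (c' - a) * phi2 a z))
    <= eps * weight a c' z)%R).
Proof.
  intros Hc Hc' Hy eps Heps.
  set (A := Gamma c' * rGamma a). set (B := Gamma c' * rGamma (c' - a)).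
  destruct (hcoef_bound b c Hc) as [Q0 [_ [HQ0 HQ]]]. set (Q := (Q0 + 1)%R).
  pose proof (proj1 (Cmod_gt_0 y) Hy) as Hym.
  set (be := (Q * Cmod y)%R). assert (Hbe : (0 < be)) by (unfold be, Q; nra).
  set (co := fun m => hcoef b c m * (y ^ m / INR (fact m))).
  assert (Hco : forall m, (Cmod (co m) <= be ^ m / INR (fact m))%R).
  { intro m. unfold co. rewrite Cmod_egf_term. unfold be. rewrite Rpow_mult_distr. unfold Rdiv.
    rewrite Rmult_assoc. apply Rmult_le_compat_r.
    - pos.
    - bound HQ. rewrite Rmult_1_l. apply pow_incr. unfold Q. lra. }
  destruct (psi_row_bound a c' Hc') as [D [HD Hrow]].
  (* beyond this modulus the majorant is summable; it decreases with [|z|] *)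
  set (Z := (be * D + 1)%R). assert (HZ : (1 <= Z)) by (unfold Z; nra).
  set (v0 := fun m => (be ^ m / INR (fact m) * row_majorant D Z m)%R).
  assert (Hv0 : ex_series v0) by (apply row_majorant_summable; auto; unfold Z; nra).
  set (K := (Cmod A + Cmod B + 1)%R).
  pose proof (Cmod_ge_0 A) as HA0. pose proof (Cmod_ge_0 B) as HB0.
  assert (Hlim : forall m z, (Cmod (row_limit a c' m z) <= (Cmod A + Cmod B) * weight a c' z)%R).
  { intros m z. unfold row_limit. fold A B. bound Cmod_triangle.
    unfold weight. pose proof (Cmod_ge_0 (phi1 a c' z)). pose proof (Cmod_ge_0 (phi2 a z)).
    rewrite !Cmod_mult. destruct m as [|m]; [|rewrite Cmod_0]; nra. }
  assert (Hfirst : forall m, inf_in (fun _ => True) (fun z => (Cmod (psi_row a c' m z) <= K * weight a c' z)%R)).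
  { intro m. refine (filter_imp _ _ _ (psi_row_asymptotics a c' m Hc' 1%R Rlt_0_1)). intros z Hz.
    replace (psi_row a c' m z) with (psi_row a c' m z - row_limit a c' m z + row_limit a c' m z) by ring.
    bound Cmod_triangle. pose proof (Hlim m z). unfold K. lra. }
  assert (HZin : inf_in (fun _ => True) (fun z => (Z <= Cmod z))).
  { exists Z. intros z _ Hz. lra. }
  assert (Hdom : inf_in (fun _ => True) (fun z => forall m,
    (Cmod (psi_row a c' m z) <= K * weight a c' z * row_majorant D Z m)%R)).
  { refine (filter_imp _ _ _ (filter_and _ _ HZin (filter_and _ _ (Hfirst O) (Hfirst 1%nat)))).
    intros z [Hz [H0 H1]] m. eapply Rle_trans; [apply (Hrow z _ ltac:(lra) H0 H1)|].
    apply Rmult_le_compat_l.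
    - pose proof (weight_pos a c' z). unfold K. nra.
    - apply row_majorant_antitone; lra. }
  set (f := fun m z => (Cmod (co m * (psi_row a c' m z - row_limit a c' m z)) / weight a c' z)%R).
  assert (Hf0 : forall m z, (0 <= f m z)).
  { intros m z. apply Rmult_le_pos; [apply Cmod_ge_0|]. left. apply Rinv_0_lt_compat, weight_pos. }
  assert (Hfac : forall m, (0 <= be ^ m / INR (fact m))%R).
  { intro m. pos. }
  assert (Hfd : inf_in (fun _ => True) (fun z => forall m, (f m z <= (2 * K) * v0 m)%R)).
  { refine (filter_imp _ _ _ Hdom). intros z Hz m. pose proof (weight_pos a c' z) as Hw.
    unfold f. apply Rle_div_l; auto. rewrite Cmod_mult.
    pose proof (row_majorant_ge_1 D Z m HD ltac:(lra)) as Hr.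
    assert (S1 : (Cmod (psi_row a c' m z - row_limit a c' m z) <= 2 * K * weight a c' z * row_majorant D Z m)%R).
    { bound Cmod_triangle. rewrite Cmod_opp.
      specialize (Hz m). specialize (Hlim m z).
      assert ((Cmod A + Cmod B) * weight a c' z <= K * weight a c' z * row_majorant D Z m)%R.
      { apply Rle_trans with (K * weight a c' z)%R; [unfold K; nra|].
        rewrite <- (Rmult_1_r (K * weight a c' z)) at 1. apply Rmult_le_compat_l; [unfold K; nra|lra]. }
      lra. }
    replace (2 * K * v0 m * weight a c' z)%R
      with (be ^ m / INR (fact m) * (2 * K * weight a c' z * row_majorant D Z m))%R by (unfold v0; ring).
    apply Rmult_le_compat; auto using Cmod_ge_0. }
  assert (Hft : forall m e, (0 < e) -> inf_in (fun _ => True) (fun z => (f m z <= e))).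
  { intros m e He. pose proof (Hfac m) as Hfm.
    set (e' := (e / (be ^ m / INR (fact m) + 1))%R).
    assert (He' : (0 < e')) by pos.
    refine (filter_imp _ _ _ (psi_row_asymptotics a c' m Hc' e' He')). intros z Hz.
    pose proof (weight_pos a c' z) as Hw. unfold f. apply Rle_div_l; auto. rewrite Cmod_mult.
    apply Rle_trans with ((be ^ m / INR (fact m) + 1) * (e' * weight a c' z))%R.
    - apply Rmult_le_compat; auto using Cmod_ge_0. specialize (Hco m). lra.
    - right. unfold e'. field. split; [apply INR_fact_neq_0|].
      pose proof (INR_fact_lt_0 m). pose proof (pow_lt be m Hbe). lra. }
  pose proof (tannery (inf_in (fun _ => True)) f (fun m => (2 * K) * v0 m)%R Hf0 Hfd
    (ex_series_scal (2 * K)%R v0 Hv0) Hft eps Heps) as Htan.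
  refine (filter_imp _ _ _ (filter_and _ _ Htan (filter_and _ _ Hfd Hdom))).
  intros z [Ht [Hz Hrows]]. pose proof (weight_pos a c' z) as Hw.
  assert (Sp : Csummable (fun m => co m * psi_row a c' m z)).
  { apply (Csummable_le _ (fun m => K * weight a c' z * v0 m)%R).
    - intro m. rewrite Cmod_mult. replace (K * weight a c' z * v0 m)%R
        with (be ^ m / INR (fact m) * (K * weight a c' z * row_majorant D Z m))%R by (unfold v0; ring).
      apply Rmult_le_compat; auto using Cmod_ge_0.
    - exact (ex_series_scal (K * weight a c' z)%R v0 Hv0). }
  assert (Sc : Csummable co).
  { destruct (hcoef_bound b c Hc) as [Q' HQ']. exact (egf_summable _ _ _ y HQ'). }
  set (d0 := fun m : nat => match m with O => B * phi2 a z | S _ => 0 end).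
  assert (Sd : Csummable d0).
  { apply Csummable_incr_1. apply (Csummable_le _ (fun n => 0 * (1 ^ n / INR (fact n)))%R).
    - intro n. simpl. rewrite Cmod_0. lra.
    - apply ex_series_exp. }
  assert (Ed : CSeries d0 = B * phi2 a z).
  { rewrite CSeries_incr_1 by auto. rewrite CSeries_0 by reflexivity. simpl. ring. }
  assert (Esum : CSeries (fun m => co m * (psi_row a c' m z - row_limit a c' m z)) =
    CSeries (fun m => co m * psi_row a c' m z)
     - (A * hyp1F1 b c y * phi1 a c' z + B * phi2 a z)).
  { rewrite (CSeries_ext _ (fun m => (co m * psi_row a c' m z + (- (A * phi1 a c' z)) * co m) + (- (1)) * d0 m)).
    - rewrite CSeries_plus, CSeries_plus, !CSeries_scal, Ed; auto using Csummable_plus, Csummable_scal.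
      change (CSeries co) with (hyp1F1 b c y). ring.
    - intro m. unfold row_limit, d0. fold A B. destruct m as [|m]; [|ring].
      unfold co. rewrite hcoef_0. simpl. field. }
  change (Cmod (CSeries (fun m => co m * psi_row a c' m z)%C
     - (A * hyp1F1 b c y * phi1 a c' z + B * phi2 a z)) <= eps * weight a c' z)%R.
  rewrite <- Esum.
  assert (Ss : Csummable (fun m => co m * (psi_row a c' m z - row_limit a c' m z))).
  { apply (Csummable_le _ (fun m => weight a c' z * (2 * K * v0 m))%R).
    - intro m. pose proof (proj1 (Rle_div_l _ _ _ Hw) (Hz m)) as Hm. cbv beta. lra.
    - exact (ex_series_scal (weight a c' z) _ (ex_series_scal (2 * K)%R v0 Hv0)). }
  eapply Rle_trans; [apply Cmod_CSeries_le; exact Ss|].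
  rewrite (Series_ext _ (fun m => weight a c' z * f m z)%R).
  - rewrite Series_scal_l, (Rmult_comm eps). apply Rmult_le_compat_l; [lra|exact Ht].
  - intro m. unfold f. field. lra.
Qed.

(** An error small against the sum of the two contributions can be charged
    entirely to the larger one. *)
Lemma asymp2_of_estimate (F : (C -> Prop) -> Prop) {FF : Filter F} (f p1 p2 : C -> C) (k1 k2 : C) :
  (forall x, p1 x <> 0) -> (forall x, p2 x <> 0) ->
  (forall eps, (0 < eps) -> F (fun x =>
    (Cmod (f x - (k1 * p1 x + k2 * p2 x)) <= eps * (Cmod (p1 x) + Cmod (p2 x)))%R)) ->
  asymp2 F f k1 p1 k2 p2.
Proof.
  intros H1 H2 H. set (r := fun x => f x - (k1 * p1 x + k2 * p2 x)).
  set (e1 := fun x => if Rle_dec (Cmod (p2 x)) (Cmod (p1 x)) then r x / p1 x else RtoC 0).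
  set (e2 := fun x => if Rle_dec (Cmod (p2 x)) (Cmod (p1 x)) then RtoC 0 else r x / p2 x).
  assert (Hlim : forall e : C -> C, (forall eps, (0 < eps) -> F (fun x => (Cmod (e x) <= eps))) ->
    filterlim e F (locally (RtoC 0))).
  { intros e He P [d Hd]. assert (Hd2 : (0 < d / 2)%R) by (pose proof (cond_pos d); lra).
    refine (filter_imp (fun x => (Cmod (e x) <= d / 2)%R) (fun x => P (e x)) _ (He (d / 2)%R Hd2)).
    intros x Hx. apply Hd.
    assert (Hlt : (Cmod (e x) < d)) by (pose proof (cond_pos d); lra).
    split; unfold ball; simpl; unfold AbsRing_ball, abs, minus, plus, opp; simpl; rewrite Ropp_0, Rplus_0_r.
    - eapply Rle_lt_trans; [apply (re_le_Cmod (e x))|exact Hlt].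
    - eapply Rle_lt_trans; [apply (im_le_Cmod (e x))|exact Hlt]. }
  exists e1, e2. split; [|split].
  - apply Hlim. intros eps Heps. assert (He2 : (0 < eps / 2)%R) by lra.
    refine (filter_imp _ _ _ (H _ He2)).
    intros x Hx. fold (r x) in Hx. unfold e1. pose proof (proj1 (Cmod_gt_0 _) (H1 x)) as Hp.
    destruct (Rle_dec (Cmod (p2 x)) (Cmod (p1 x))) as [D|D]; [|rewrite Cmod_0; lra].
    rewrite Cmod_div by auto. apply Rle_div_l; auto. nra.
  - apply Hlim. intros eps Heps. assert (He2 : (0 < eps / 2)%R) by lra.
    refine (filter_imp _ _ _ (H _ He2)).
    intros x Hx. fold (r x) in Hx. unfold e2. pose proof (proj1 (Cmod_gt_0 _) (H2 x)) as Hp.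
    destruct (Rle_dec (Cmod (p2 x)) (Cmod (p1 x))) as [D|D]; [rewrite Cmod_0; lra|].
    rewrite Cmod_div by auto. apply Rle_div_l; auto. nra.
  - apply filter_forall. intro x. unfold e1, e2. specialize (H1 x). specialize (H2 x).
    destruct (Rle_dec (Cmod (p2 x)) (Cmod (p1 x))); unfold r; field; auto.
Qed.

Theorem theorem3p4 (a b c c' : C)
  (hc : ~ nonpos_int c) (hc' : ~ nonpos_int c')
  (hb : (0 < Re b)) (hbc : (Re b < Re c))
  (y : C) (hy : y <> 0) :
  asymp2
    (within (fun x : C => (- PI <= Carg (- (y / x)) <= PI)%R)
       (locally' (RtoC 0)))
    (fun x => HumbertPsi1 a b c c' x (y / x))
    (Gamma c' * rGamma a * hyp1F1 b c y)
    (fun x => Cpower (y / x) (a - c') * Cexp (y / x))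
    (Gamma c' * rGamma (c' - a))
    (fun x => Cpower (- (y / x)) (- a)).
Proof.
  apply asymp2_of_estimate.
  - typeclasses eauto.
  - intro x. apply (phi1_neq_0 a c' (y / x)).
  - intro x. apply (phi2_neq_0 a (y / x)).
  - intros eps Heps.
    destruct (psi_rows_asymptotics a b c c' y hc hc' hy eps Heps) as [M HM].
    pose proof (proj1 (Cmod_gt_0 y) hy) as Hy.
    assert (Hd : (0 < Cmod y / (2 * (Rabs M + 1)))%R).
    { apply Rdiv_lt_0_compat; auto. pose proof (Rabs_pos M). lra. }
    exists (mkposreal _ Hd). intros x Hx Hxn _. simpl in Hx. change (x <> RtoC 0) in Hxn.
    assert (Hsmall : (Cmod x < Cmod y / (Rabs M + 1))%R).
    { destruct Hx as [B1 B2]. unfold ball in B1, B2; simpl in B1, B2.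
      unfold AbsRing_ball, abs, minus, plus, opp in B1, B2; simpl in B1, B2.
      rewrite Ropp_0, Rplus_0_r in B1, B2.
      eapply Rle_lt_trans; [apply Cmod_le_re_im|]. unfold Re, Im.
      replace (Cmod y / (Rabs M + 1))%R with (Cmod y / (2 * (Rabs M + 1)) + Cmod y / (2 * (Rabs M + 1)))%R.
      - lra.
      - field. pose proof (Rabs_pos M). lra. }
    revert Hxn Hsmall. clear Hx. generalize (x : C). clear x. intros x Hxn Hsmall.
    rewrite (HumbertPsi1_rows a b c c' x y hc hc' Hxn hy).
    apply (HM (y / x) I).
    pose proof (proj1 (Cmod_gt_0 x) Hxn) as Hxm.
    rewrite Cmod_div by auto. apply Rlt_div_r; auto.
    pose proof (Rabs_pos M) as HM0. apply Rlt_div_r in Hsmall; [|lra].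
    pose proof (Rle_abs M). nra.
Qed.
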